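(* Let $K$ be a field of characteristic $0$ and $n\ge 3$ an integer. Let $X\subset\mathbb{P}^{n-2}$ be a set of $n$ points in general position (defined over $K$), and let $\Omega_1,\ldots,\Omega_{n-1}$ be the quadratic forms associated to a minimal free resolution of $X$. Then there exists a commutative and associative $K$-algebra $A$, of dimension $n$, and a $K$-basis $1=\alpha_0,\alpha_1,\ldots,\alpha_{n-1}$ for $A$, such that for all $1\le i,j\le n-1$ we have $$\alpha_i\alpha_j=c^0_{ij}+\sum_{k=1}^{n-1}\frac{\partial^2\Omega_k}{\partial x_i\,\partial x_j}\,\alpha_k$$ for some constant $c^0_{ij}\in K$. Moreover $A$ is isomorphic to the affine coordinate ring (i.e. the ring of global functions) $\Gamma(X,\mathcal{O}_X)$ of $X$, and $\alpha_1,\ldots,\alpha_{n-1}$ span the trace zero subspace of $A$.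
   Context: Let $R=K[x_1,\ldots,x_{n-1}]$ with its usual grading, the homogeneous coordinate ring of $\mathbb{P}^{n-2}$, and $\mathfrak{m}=(x_1,\ldots,x_{n-1})$. A set of $n$ points in general position is a zero-dimensional variety $X\subset\mathbb{P}^{n-2}$ defined over $K$, of degree $n$, such that $X(\bar K)$ consists of $n$ points no $n-1$ of which are contained in a hyperplane (the individual points need not be defined over $K$). Let $I\subset R$ be the homogeneous ideal of $X$. A minimal free resolution of $X$ means a minimal graded free resolution $F_\bullet$ of $R/I$, with graded differentials $\phi_k:F_k\to F_{k-1}$ satisfying $\phi_k(F_k)\subset\mathfrak{m}F_{k-1}$. It is known that for $n\ge4$ it has the form $$0\to R(-n)\xrightarrow{\phi_{n-2}}R(-n+2)^{b_{n-3}}\xrightarrow{\phi_{n-3}}R(-n+3)^{b_{n-4}}\to\cdots\to R(-3)^{b_2}\xrightarrow{\phi_2}R(-2)^{b_1}\xrightarrow{\phi_1}R\to0,$$ with $b_i=n\binom{n-2}{i}-\binom{n}{i+1}$; for $n=3$ it is $0\to R(-3)\xrightarrow{\phi_1}R\to0$. Choosing bases of the free modules, $\phi_k$ is also written for the matrix representing it, so $\phi_k\phi_{k+1}=0$. For $1\le a_1,\ldots,a_{n-2}\le n-1$ define the quadratic form $$[a_1,\ldots,a_{n-2}]=\frac{\partial\phi_1}{\partial x_{a_1}}\frac{\partial\phi_2}{\partial x_{a_2}}\cdots\frac{\partial\phi_{n-2}}{\partial x_{a_{n-2}}}$$ (entrywise partial derivatives, matrix product). With $\sigma=(1\,2\,\ldots\,n-2)\in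 S_{n-2}$ the $(n-2)$-cycle, put $$[[a_1,\ldots,a_{n-2}]]=\sum_{k=1}^{n-2}[a_{\sigma^{2k}(1)},\ldots,a_{\sigma^{2k}(n-2)}],$$ and for $1\le j\le n-1$ put $\Omega_j=(-1)^j[[1,2,\ldots,\widehat{j},\ldots,n-1]]$ (with $j$ omitted). The trace zero subspace of $A$ is $\{a\in A:\operatorname{Tr}_{A/K}(a)=0\}$. *)

(* Defs.v *)
From HB Require Import structures.
From mathcomp Require Import all_boot all_order all_algebra all_field.
From mathcomp.multinomials Require Import mpoly.

Set Implicit Arguments.
Unset Strict Implicit.
Unset Printing Implicit Defensive.

Import GRing.Theory passmx.
Local Open Scope ring_scope.

(* Points of P^{N-1}(L) are given by nonzero row vectors of homogeneous
   coordinates; finite subsets are given by families of such vectors. *)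

Section ProjectivePoints.

Variables (K L : fieldType) (iota : {rmorphism K -> L}) (N m : nat).

Definition eval_at (f : {mpoly K[N]}) (v : 'rV[L]_N) : L :=
  (map_mpoly iota f).@[v 0].

Definition is_homog (f : {mpoly K[N]}) : Prop := exists d, f \is d.-homog.

Definition same_point (u v : 'rV[L]_N) : Prop :=
  exists2 c : L, c != 0 & v = c *: u.

Variable p : 'I_m -> 'rV[L]_N.

Definition distinct_points : Prop :=
  (forall i, p i != 0) /\ (forall i j, same_point (p i) (p j) -> i = j).

(* The points form the zero locus in P^{N-1}(L) of a set of homogeneous
   polynomials with coefficients in K. *)
Definition defined_over : Prop :=
  exists S : {mpoly K[N]} -> Prop,
    (forall f, S f -> is_homog f) /\
    (forall v : 'rV[L]_N, v != 0 ->
       ((forall f, S f -> eval_at f v = 0) <-> exists i, same_point (p i) v)).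

(* No m-1 of the m points lie on a hyperplane of P^{N-1}(L). *)
Definition general_position : Prop :=
  forall S : {set 'I_m}, #|S| = m.-1 ->
  forall h : 'cV[L]_N, h != 0 -> exists2 i, i \in S & p i *m h != 0.

(* The homogeneous ideal: all homogeneous components vanish at the points. *)
Definition vanishing_ideal (f : {mpoly K[N]}) : Prop :=
  forall d i, eval_at (pihomog mdeg d f) (p i) = 0.

(* A global section of O_X: a function on X(L) which near each point, in the
   Zariski topology of P^{N-1} over K, is a quotient of two forms over K of
   the same degree. *)
Definition regular_function (s : 'I_m -> L) : Prop :=
  forall i, exists d (g h : {mpoly K[N]}),
    [/\ g \is d.-homog, h \is d.-homog, eval_at h (p i) != 0 &
        forall j, eval_at h (p j) != 0 ->
          s j = eval_at g (p j) / eval_at h (p j)].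

Definition iso_to_global_functions (A : falgType K) : Prop :=
  exists Phi : A -> 'I_m -> L,
    [/\ [/\ forall i, Phi 1 i = 1,
            forall a b i, Phi (a + b) i = Phi a i + Phi b i,
            forall a b i, Phi (a * b) i = Phi a i * Phi b i &
            forall (c : K) a i, Phi (c *: a) i = iota c * Phi a i],
        forall a b, Phi a =1 Phi b -> a = b,
        forall a, regular_function (Phi a) &
        forall s, regular_function s -> exists a, Phi a =1 s].

End ProjectivePoints.

Section Resolutions.

Variables (K : fieldType) (N : nat).
Local Notation R := {mpoly K[N]}.

(* F_k = \bigoplus_j R(- tw k j), j < rk k, whose elements are column vectors;
   phi k is the matrix of the differential F_{k+1} -> F_k, so that the phi_k
   of the literature is phi k.-1.  A resolution of finite length is continued
   by zero modules.  Minimality says that all the entries lie in the ideal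
   (x_1, ..., x_N), i.e. have no constant term. *)
Record minimal_graded_free_resolution (I : R -> Prop) (rk : nat -> nat)
    (tw : forall k, 'I_(rk k) -> nat) (phi : forall k, 'M[R]_(rk k, rk k.+1))
    : Prop := MinimalGradedFreeResolution {
  mgfr_rk0 : rk 0%N = 1%N;
  mgfr_tw0 : forall i, tw 0%N i = 0%N;
  mgfr_coker : forall f : R,
    I f <-> exists c : 'cV[R]_(rk 1%N), phi 0%N *m c = const_mx f;
  mgfr_exact : forall k (v : 'cV[R]_(rk k.+1)),
    phi k *m v = 0 <-> exists w : 'cV[R]_(rk k.+2), v = phi k.+1 *m w;
  mgfr_graded : forall k i j,
    if (tw k i <= tw k.+1 j)%N
    then phi k i j \is (tw k.+1 j - tw k i)%N.-homog else phi k i j == 0;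
  mgfr_minimal : forall k i j, (phi k i j)@_0%MM = 0
}.

End Resolutions.

(* Ranks and twists of the resolution of n >= 3 points in general position in
   P^{n-2}.  For k > n - 2 the formula gives rank 0. *)
Definition betti (n k : nat) : nat :=
  if (k == 0)%N || (k == n.-2) then 1%N
  else (n * 'C(n.-2, k) - 'C(n, k.+1))%N.

Definition shift (n k : nat) : nat :=
  if (k == 0)%N then 0%N else if k == n.-2 then n else k.+1.

Lemma betti_last n : betti n n.-2 = 1%N.
Proof. by rewrite /betti eqxx orbT. Qed.

Fixpoint mxchain (R : pzSemiRingType) (rk : nat -> nat)
    (psi : forall k, 'M[R]_(rk k, rk k.+1)) (m : nat) : 'M[R]_(rk 0%N, rk m) :=
  if m is m'.+1 then mxchain psi m' *m psi m' else 1%:M.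

Section Omega.

Variables (K : fieldType) (n : nat).
Local Notation R := {mpoly K[n.-1]}.
Variable phi : forall k, 'M[R]_(betti n k, betti n k.+1).

(* [a_1, ..., a_{n-2}]; only the factors with k < n - 2 are used. *)
Definition bracket (a : 'I_n.-2 -> 'I_n.-1) : R :=
  let psi k : 'M[R]_(betti n k, betti n k.+1) :=
    if insub k is Some i then map_mx (mderiv (a i)) (phi k) else 0 in
  (castmx (erefl (betti n 0%N), betti_last n) (mxchain psi n.-2) : 'M[R]_1) 0 0.

(* [[a_1, ..., a_{n-2}]]; ordS is the cycle (1 2 ... n-2). *)
Definition dbracket (a : 'I_n.-2 -> 'I_n.-1) : R :=
  \sum_(1 <= k < n.-1) bracket (fun i => a (iter k.*2 (@ordS _) i)).

(* Indices start at 0, whence the exponent j + 1; lift j enumerates the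
   indices other than j in increasing order. *)
Definition Omega (j : 'I_n.-1) : R := (-1) ^+ j.+1 * dbracket (lift j).

(* The constant d^2 Omega_k / dx_i dx_j, as an element of K. *)
Definition Omega_coef (k i j : 'I_n.-1) : K :=
  (mderiv i (mderiv j (Omega k)))@_0%MM.

End Omega.

Definition alg_trace (K : fieldType) (A : falgType K) (a : A) : K :=
  \tr (mxof (vbasis {:A}) (vbasis {:A}) (amull a)).

(* Main.v *)
(* Rescale the coordinate vectors P_1, ..., P_n so that their sum is zero, and
   differentiate the chain phi_1 ... phi_(n-2) along them.  Every form in the
   ideal vanishes at the points, and so do the entries of the last matrix, which
   null-homotopies express through the generators.  Together with
   phi_k phi_(k+1) = 0 this makes the second derivatives of
   D_(v_1) phi_1 ... D_(v_(n-2)) phi_(n-2) along the P_i vanish in so many cases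
   that, as a function of indices of points, they are an alternating function
   which is determined by the relation \sum_i P_i = 0 up to a scalar: it is a
   multiple of a determinant.  Summing over the rotations and expanding in the
   v_k gives, with one constant c != 0 and Omega = (Omega_1, ..., Omega_(n-1)),
       Omega (P_i, P_j) = c (n [i = j] P_i - P_i - P_j)
   for the polar forms.  The right hand side describes the multiplication of L^n
   on the vectors of sum zero, modulo constants; the dual basis alpha_i of the
   coordinates on that space therefore has the structure constants of the
   theorem, and the constant terms are rational because, up to a factor n - 2,
   they form the trace form of the rational structure constants.  Regular
   functions are the K-span of the quadrics in rational coordinates. *)

From HB Require Import structures.
Require Import Defs.
From mathcomp Require Import all_boot all_fingroup all_algebra all_field.
From mathcomp Require Import ring.
From mathcomp.multinomials Require Import mpoly.

Set Implicit Arguments.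
Unset Strict Implicit.
Unset Printing Implicit Defensive.

Import GRing.Theory.
Local Open Scope ring_scope.

(** * Directional derivatives *)

(** All the vanishing has one source. Differentiating phi_k phi_(k+1) = 0 shows that a product of
    consecutive matrices, all differentiated except the first and the last, is zero. If D_p D_p
    kills those two, as it does when p is one of the points, and the matrices in between are linear,
    then D_p D_p of this product is twice the product in which the two are differentiated along p as
    well; so that product is zero too. The double bracket averages over rotations because a single
    bracket at (P_i, P_j), i and j distinct, depends on which points sit at the two ends of the
    chain, the only places where the matrices are quadratic. Even powers of the cycle preserve the
    determinant, and the indices 2k and 2k - 1 that they bring to the first and the last place run
    twice through the residues modulo n - 2 for k = 1, ..., n - 2; so no place is preferred. For n =
    3 the chain is a single matrix of cubic forms, without two quadratic ends; it needs its own
    argument, with a symmetric trilinear function. *)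

Section DirectionalDerivative.

Variables (L : fieldType) (N : nat).
Local Notation R := {mpoly L[N]}.
Implicit Types (f g : R) (u v : 'rV[L]_N).

Definition dird v f : R := \sum_i v 0 i *: f^`M(i).

Lemma dird_is_linear v : linear (dird v).
Proof.
move=> c f g; rewrite /dird scaler_sumr -big_split; apply: eq_bigr => i _ /=.
by rewrite mderivD mderivZ scalerDr !scalerA mulrC.
Qed.

HB.instance Definition _ v := GRing.isLinear.Build L R R _ (dird v)
  (dird_is_linear v).

Lemma dirdM v f g : dird v (f * g) = dird v f * g + f * dird v g.
Proof.
rewrite /dird mulr_suml mulr_sumr -big_split; apply: eq_bigr => i _ /=.
by rewrite mderivM scalerDr scalerAl scalerAr.
Qed.

Lemma dird_comm u v f : dird u (dird v f) = dird v (dird u f).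
Proof.
rewrite /dird.
under eq_bigr => i _ do rewrite (linear_sum (mderiv i)) scaler_sumr.
under [RHS]eq_bigr => i _ do rewrite (linear_sum (mderiv i)) scaler_sumr.
rewrite exchange_big; apply: eq_bigr => i _; apply: eq_bigr => j _ /=.
by rewrite !mderivZ !scalerA mulrC mderiv_comm.
Qed.

Lemma dird_lincomb (I : finType) (c : I -> L) (w : I -> 'rV[L]_N) f :
  dird (\sum_i c i *: w i) f = \sum_i c i *: dird (w i) f.
Proof.
rewrite /dird; under [RHS]eq_bigr do rewrite scaler_sumr.
rewrite exchange_big; apply: eq_bigr => j _ /=.
rewrite summxE scaler_suml; apply: eq_bigr => i _.
by rewrite mxE scalerA.
Qed.

Lemma dird_delta i f : dird (delta_mx 0 i) f = f^`M(i).
Proof.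
rewrite /dird (bigD1 i) //= mxE !eqxx scale1r big1 ?addr0 // => j neq_ji.
by rewrite mxE (negPf neq_ji) andbF scale0r.
Qed.

Lemma mderiv_homog d i f : f \is d.-homog -> f^`M(i) \is d.-1.-homog.
Proof.
move=> fd; apply/dhomogP => m; rewrite mcoeff_msupp mcoeff_mderiv => nz.
have : f@_(m + U_(i)) != 0 by apply: contraNneq nz => ->; rewrite mul0rn.
by rewrite -mcoeff_msupp => /(dhomog_mf fd) <- /=; rewrite mdegD mdeg1 addn1.
Qed.

Lemma dird_homog d v f : f \is d.-homog -> dird v f \is d.-1.-homog.
Proof.
by move=> fd; apply: rpred_sum => i _; apply/rpredZ/mderiv_homog.
Qed.

Lemma homog0P f : f \is 0.-homog -> f = (f@_0)%:MP.
Proof.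
move=> f0; apply/mpolyP => m; rewrite mcoeffC.
have [->|nz] := eqVneq m 0%MM; first by rewrite mulr1.
by rewrite mulr0 (dhomog_nemf_coeff f0) // mdeg_eq0.
Qed.

Lemma dirdC v c : dird v c%:MP = 0.
Proof. by rewrite /dird big1 // => i _; rewrite mderivC scaler0. Qed.

Lemma dird_homog0 v f : f \is 0.-homog -> dird v f = 0.
Proof. by move/homog0P->; rewrite dirdC. Qed.

Lemma Euler_dird d v f : f \is d.-homog ->
  (dird v f).@[v 0] = d%:R * f.@[v 0].
Proof.
move=> fd; rewrite [f]mpolyE (linear_sum (dird v)) !(linear_sum (meval (v 0))) mulr_sumr /=.
rewrite big_seq [RHS]big_seq; apply: eq_bigr => m /(dhomog_mf fd) /= md.
rewrite linearZ !mevalZ mulrCA; congr (_ * _).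
rewrite /dird rmorph_sum /= mevalX -[in RHS]md mdegE natr_sum mulr_suml.
apply: eq_bigr => i _; rewrite mderivX !mevalZ mevalX.
have [m0|m0] := eqVneq (m i) 0%N; first by rewrite m0 !mul0r mulr0.
rewrite mulrCA; congr (_ * _); rewrite (bigD1 i) //= [RHS](bigD1 i) //= mulrA.
congr (_ * _).
  by rewrite -exprS mnmBE mnm1E eqxx subn1 prednK // lt0n.
by apply: eq_bigr => j nji; rewrite mnmBE mnm1E eq_sym (negPf nji) subn0.
Qed.

Lemma meval_homog0 (x : 'I_N -> L) f : f \is 0.-homog -> f = (f.@[x])%:MP.
Proof. by move=> /homog0P ->; rewrite mevalC. Qed.

(** The iterated derivative is a constant, so it may be evaluated at v, where Euler's identity turns
    it into a multiple of f(v). *)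
Lemma dird2_vanish v f : f \is 2.-homog -> f.@[v 0] = 0 ->
  dird v (dird v f) = 0.
Proof.
move=> f2 fv0; have f1 := dird_homog v f2; have f0 := dird_homog v f1.
by rewrite (meval_homog0 (v 0) f0) (Euler_dird v f1) (Euler_dird v f2) fv0 !mulr0.
Qed.

Lemma dird3_vanish v f : f \is 3.-homog -> f.@[v 0] = 0 ->
  dird v (dird v (dird v f)) = 0.
Proof.
move=> f3 fv0; have f2 := dird_homog v f3; have f1 := dird_homog v f2.
have f0 := dird_homog v f1; rewrite (meval_homog0 (v 0) f0).
by rewrite (Euler_dird v f1) (Euler_dird v f2) (Euler_dird v f3) fv0 !mulr0.
Qed.

End DirectionalDerivative.

Section DirectionalDerivativeMatrix.

Variables (L : fieldType) (N : nat).
Local Notation R := {mpoly L[N]}.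
Implicit Types (u v : 'rV[L]_N).

Definition dmx v p q (M : 'M[R]_(p, q)) := map_mx (dird v) M.

Lemma dmxD v p q (A B : 'M[R]_(p, q)) : dmx v (A + B) = dmx v A + dmx v B.
Proof. exact: map_mxD. Qed.

Lemma dmx0 v p q : dmx v (0 : 'M[R]_(p, q)) = 0.
Proof. exact: map_mx0. Qed.

Lemma dmxM v p q r (A : 'M[R]_(p, q)) (B : 'M[R]_(q, r)) :
  dmx v (A *m B) = dmx v A *m B + A *m dmx v B.
Proof.
apply/matrixP => i j; rewrite !mxE linear_sum -big_split; apply: eq_bigr => k _.
by rewrite /= dirdM !mxE.
Qed.

Lemma dmx_comm u v p q (A : 'M[R]_(p, q)) : dmx u (dmx v A) = dmx v (dmx u A).
Proof. by apply/matrixP => i j; rewrite !mxE dird_comm. Qed.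

Lemma dmx_lincomb (I : finType) (c : I -> L) (w : I -> 'rV[L]_N) p q
    (A : 'M[R]_(p, q)) :
  dmx (\sum_i c i *: w i) A = \sum_i (c i)%:MP *: dmx (w i) A.
Proof.
apply/matrixP => i j; rewrite summxE mxE dird_lincomb; apply: eq_bigr => k _.
by rewrite !mxE mul_mpolyC.
Qed.

Lemma dmx_sum v (I : finType) (c : I -> L) p q (A : I -> 'M[R]_(p, q)) :
  dmx v (\sum_i (c i)%:MP *: A i) = \sum_i (c i)%:MP *: dmx v (A i).
Proof.
apply/matrixP => r s; rewrite mxE !summxE (linear_sum (dird v)).
by apply: eq_bigr => i _; rewrite !mxE !mul_mpolyC linearZ.
Qed.

End DirectionalDerivativeMatrix.

(** * Chains of differentials *)

Section MatrixChains.

Variables (R : comPzRingType) (rk : nat -> nat).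
Implicit Types (psi : forall k, 'M[R]_(rk k, rk k.+1)).

Fixpoint mxsegment psi i l : 'M[R]_(rk i, rk (l + i)) :=
  if l is l'.+1 then mxsegment psi i l' *m psi (l' + i)%N else 1%:M.

Lemma mxchainS psi m : mxchain psi m.+1 = mxchain psi m *m psi m.
Proof. by []. Qed.

Lemma eq_mxchain psi psi' m : (forall k, (k < m)%N -> psi k = psi' k) ->
  mxchain psi m = mxchain psi' m.
Proof.
elim: m => //= m IH eq_psi; rewrite IH ?eq_psi // => k lt_km.
by apply: eq_psi; apply: ltnW.
Qed.

Lemma eq_mxsegment psi psi' i l :
    (forall k, (i <= k < l + i)%N -> psi k = psi' k) ->
  mxsegment psi i l = mxsegment psi' i l.
Proof.
elim: l => //= l IH eq_psi; rewrite IH ?eq_psi ?leq_addl ?ltnSn // => k /andP[ik kl].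
by apply: eq_psi; rewrite ik ltnW.
Qed.

Lemma mxchain_segment psi i l :
  mxchain psi (l + i) = mxchain psi i *m mxsegment psi i l.
Proof. by elim: l => [|l IH] /=; rewrite ?mulmx1 // IH mulmxA. Qed.

Lemma mxchain_split psi i l :
  mxchain psi (l + i.+1).+1 =
    mxchain psi i *m (psi i *m mxsegment psi i.+1 l *m psi (l + i.+1)%N).
Proof. by rewrite /= mxchain_segment /= !mulmxA. Qed.

Lemma mxchain_eq0 psi j m : (j <= m)%N -> mxchain psi j = 0 -> mxchain psi m = 0.
Proof.
move=> le_jm chain0; rewrite -(subnK le_jm).
by rewrite mxchain_segment chain0 mul0mx.
Qed.

Lemma mxchain_lincomb (I : finType) (c : I -> R) psi
    (psis : I -> forall k, 'M[R]_(rk k, rk k.+1)) k m : (k < m)%N ->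
    (forall i j, (j < m)%N -> j != k -> psis i j = psi j) ->
    psi k = \sum_i c i *: psis i k ->
  mxchain psi m = \sum_i c i *: mxchain (psis i) m.
Proof.
elim: m => //= m IH; rewrite ltnS leq_eqVlt => /orP[/eqP eq_km|lt_km] eq_psi psik.
  rewrite -eq_km psik mulmx_sumr; apply: eq_bigr => i _.
  rewrite -scalemxAr; congr (_ *: (_ *m _)); apply: eq_mxchain => j lt_jk.
  by rewrite eq_psi // ?ltn_eqF // -eq_km ltnS ltnW.
rewrite IH // => [|i j lt_jm]; last by apply: eq_psi; apply: ltnW.
rewrite mulmx_suml; apply: eq_bigr => i _.
by rewrite -scalemxAl eq_psi // gtn_eqF.
Qed.

End MatrixChains.

(** * Derivatives of a complex along the points *)

Section ChainDerivatives.

Variables (L : fieldType) (N : nat) (rk : nat -> nat).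
Local Notation R := {mpoly L[N]}.
Hypothesis two_neq0 : 2%:R != 0 :> L.
Variable phi : forall k, 'M[R]_(rk k, rk k.+1).
Hypothesis phi_complex : forall k, phi k *m phi k.+1 = 0.
Implicit Types (a b c d p u v x y : 'rV[L]_N).

Local Notation dphi w := (fun k => dmx (w k) (phi k)).

Definition affine_mx r s (A : 'M[R]_(r, s)) :=
  forall u v, dmx u (dmx v A) = 0.

Definition quadratic_mx r s (A : 'M[R]_(r, s)) :=
  forall u v x, dmx u (dmx v (dmx x A)) = 0.

Lemma double_eq0 r s (A : 'M[R]_(r, s)) : A + A = 0 -> A = 0.
Proof.
move=> AA; apply/matrixP => i j; move/matrixP/(_ i j): AA; rewrite !mxE => AA.
apply/mpolyP => k; move/mpolyP/(_ k): AA; rewrite mcoeffD !mcoeff0 => /eqP.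
by rewrite -mulr2n -mulr_natl mulf_eq0 (negPf two_neq0) => /eqP.
Qed.

Lemma dmx_segment u w i l :
    (forall k, (i <= k < l + i)%N -> affine_mx (phi k)) ->
  dmx u (mxsegment (dphi w) i l) = 0.
Proof.
elim: l => [|l IH] aff /=.
  by apply/matrixP => r s; rewrite !mxE; case: (r == s); rewrite ?dirdC ?raddf0.
rewrite dmxM aff ?leq_addl ?ltnSn // mulmx0 addr0 IH ?mul0mx // => k /andP[ik kl].
by apply: aff; rewrite ik ltnW.
Qed.

(** The derivative of phi_k phi_(k+1) = 0 moves the undifferentiated last factor one place to the
    left, up to sign, until it meets [phi i]. *)
Lemma phi_segment_phi w i l :
  phi i *m mxsegment (dphi w) i.+1 l *m phi (l + i.+1)%N = 0.
Proof.
elim: l => [|l IH] /=; first by rewrite mulmx1 phi_complex.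
have /(congr1 (@dmx _ _ (w (l + i.+1)%N) _ _)) := phi_complex (l + i.+1).
rewrite dmxM dmx0 => /(canRL (addrK _)); rewrite sub0r => E.
by rewrite !mulmxA -[_ *m phi _.+1]mulmxA E mulmxN mulmxA IH mul0mx oppr0.
Qed.

Section ConstantMiddle.

Variables (r s t q : nat) (A : 'M[R]_(r, s)) (mid : 'M[R]_(s, t)) (B : 'M[R]_(t, q)).
Variable p : 'rV[L]_N.
Hypothesis dmid : forall u, dmx u mid = 0.
Hypothesis prod0 : A *m mid *m B = 0.
Hypothesis ddA : dmx p (dmx p A) = 0.
Hypothesis ddB : dmx p (dmx p B) = 0.

Lemma dmx_mid u r' q' (A' : 'M[R]_(r', s)) (B' : 'M[R]_(t, q')) :
  dmx u (A' *m mid *m B') = dmx u A' *m mid *m B' + A' *m mid *m dmx u B'.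
Proof. by rewrite !dmxM dmid mulmx0 addr0. Qed.

(** In the second derivative of A mid B = 0 along p the terms with both derivatives on one factor
    vanish, and the cross term occurs twice. *)
Lemma dmid_prod0 : dmx p A *m mid *m dmx p B = 0.
Proof.
apply: double_eq0; have /(congr1 (fun M => dmx p (dmx p M))) := prod0.
rewrite dmx_mid dmxD !dmx_mid ddA ddB !mul0mx mulmx0 !dmx0.
by rewrite add0r addr0.
Qed.

Lemma ddmid_prod0l b : affine_mx B -> dmx b (dmx p A) *m mid *m dmx p B = 0.
Proof.
move=> affB; have := dmx_mid b (dmx p A) (dmx p B).
by rewrite affB mulmx0 addr0 dmid_prod0 dmx0.
Qed.

Lemma ddmid_prod0r d : affine_mx A -> dmx p A *m mid *m dmx d (dmx p B) = 0.
Proof.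
move=> affA; have := dmx_mid d (dmx p A) (dmx p B).
by rewrite affA !mul0mx add0r dmid_prod0 dmx0.
Qed.

(** Third derivatives of A and B are zero, so differentiating [dmid_prod0] along b and d leaves only
    the two mixed terms. *)
Lemma ddmid_prodN b d : quadratic_mx A -> quadratic_mx B ->
  dmx b (dmx p A) *m mid *m dmx d (dmx p B) =
    - (dmx d (dmx p A) *m mid *m dmx b (dmx p B)).
Proof.
move=> quadA quadB; have := dmx_mid b (dmx p A) (dmx p B).
rewrite dmid_prod0 dmx0 => /esym/(congr1 (@dmx _ _ d _ _)).
rewrite dmxD dmx_mid dmx_mid dmx0 quadA quadB !mul0mx mulmx0 add0r addr0.
by move/eqP; rewrite addr_eq0 => /eqP.
Qed.

End ConstantMiddle.

Section SegmentAtPoint.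

Variables (p : 'rV[L]_N) (w : nat -> 'rV[L]_N) (i l : nat).
Hypothesis mid_affine :
  forall k, (i < k < l + i.+1)%N -> affine_mx (phi k).
Hypothesis phi_i_p : dmx p (dmx p (phi i)) = 0.
Hypothesis phi_j_p : dmx p (dmx p (phi (l + i.+1)%N)) = 0.
Let dmid u : dmx u (mxsegment (dphi w) i.+1 l) = 0 := dmx_segment u w mid_affine.

Definition dphi_segment_dphi :=
  dmid_prod0 dmid (phi_segment_phi w i l) phi_i_p phi_j_p.
Definition ddphi_segment_dphi :=
  ddmid_prod0l dmid (phi_segment_phi w i l) phi_i_p phi_j_p.
Definition dphi_segment_ddphi :=
  ddmid_prod0r dmid (phi_segment_phi w i l) phi_i_p phi_j_p.
Definition ddphi_segment_ddphi :=
  ddmid_prodN dmid (phi_segment_phi w i l) phi_i_p phi_j_p.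

End SegmentAtPoint.

(* The first factor carries the derivatives along a and b, the last one those
   along c and d; w gives the directions of the factors in between. *)
Definition polarized_chain m w a b c d k : 'M[R]_(rk k, rk k.+1) :=
  if k == 0%N then dmx b (dmx a (phi k))
  else if k == m.-1 then dmx c (dmx d (phi k))
  else dmx (w k) (phi k).

Definition polarized m w a b c d : 'M[R]_(rk 0, rk m) :=
  mxchain (polarized_chain m w a b c d) m.

Section Polarized.

Variable m : nat.
Hypothesis m_gt1 : (1 < m)%N.
Hypothesis phi_affine : forall k, (0 < k < m.-1)%N -> affine_mx (phi k).
Hypothesis phi_first : quadratic_mx (phi 0).
Hypothesis phi_last : quadratic_mx (phi m.-1).

Lemma polarizedCl w a b c d : polarized m w a b c d = polarized m w b a c d.
Proof.
apply: eq_mxchain => k _; rewrite /polarized_chain.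
by case: eqP => // ->; rewrite dmx_comm.
Qed.

Lemma polarizedCr w a b c d : polarized m w a b c d = polarized m w a b d c.
Proof.
apply: eq_mxchain => k _; rewrite /polarized_chain.
by case: eqP => // _; case: eqP => // ->; rewrite dmx_comm.
Qed.

Lemma polarized_linear (I : finType) (e : I -> L) (z : I -> 'rV[L]_N) w a b c :
  polarized m w a b c (\sum_i e i *: z i) =
    \sum_i (e i)%:MP *: polarized m w a b c (z i).
Proof.
have m1 : (m.-1 < m)%N by case: (m) m_gt1.
have m0 : (m.-1 == 0)%N = false by case: (m) m_gt1 => [|[]].
apply: (mxchain_lincomb m1) => [i j _ /negPf ne|]; rewrite /polarized_chain.
  by rewrite ne.
rewrite m0 eqxx dmx_comm dmx_lincomb.
by apply: eq_bigr => i _; rewrite dmx_comm.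
Qed.

Lemma polarized_linearl (I : finType) (e : I -> L) (z : I -> 'rV[L]_N) w a c d :
  polarized m w a (\sum_i e i *: z i) c d =
    \sum_i (e i)%:MP *: polarized m w a (z i) c d.
Proof.
apply: (mxchain_lincomb (ltnW m_gt1)) => [i j _ /negPf ne|]; rewrite /polarized_chain.
  by rewrite ne.
by rewrite eqxx dmx_lincomb.
Qed.

Lemma polarized_linearm (I : finType) (e : I -> L) (w : nat -> 'rV[L]_N)
    a b c d k
    (ws : I -> nat -> 'rV[L]_N) :
    (0 < k < m.-1)%N ->
    w k = \sum_i e i *: ws i k -> (forall i j, j != k -> ws i j = w j) ->
  polarized m w a b c d = \sum_i (e i)%:MP *: polarized m (ws i) a b c d.
Proof.
case/andP=> k0 km wk eqw.
have [ne0 nem] : (k == 0)%N = false /\ (k == m.-1) = false.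
  by split; [rewrite gtn_eqF | rewrite ltn_eqF].
apply: (mxchain_lincomb (k := k)) => [|i j _ nejk|].
- by apply: leq_trans km _; apply: leq_pred.
- by rewrite /polarized_chain; do 2!case: eqP => // _; rewrite eqw.
by rewrite /polarized_chain ne0 nem wk dmx_lincomb.
Qed.

(* As D_p D_p f = 2 f(p) for a quadratic form f, this says that p is a zero of
   the entries of the first and of the last matrix. *)
Definition chain_point p :=
  dmx p (dmx p (phi 0)) = 0 /\ dmx p (dmx p (phi m.-1)) = 0.

Let chain_pointE p k : chain_point p -> (k < m)%N -> dmx p (dmx p (phi k)) = 0.
Proof.
case=> p0 pm lt_km; have [->//|k0] := posnP k.
have [->//|nek] := eqVneq k m.-1; apply: phi_affine.
by rewrite k0 ltn_neqAle nek -ltnS prednK // ltnW.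
Qed.

(** Puts j in the form in which [mxsegment] indexes its end, so that it can be substituted in the
    dependent types. *)
Let lt_split i j : (i < j)%N -> exists l, j = (l + i.+1)%N.
Proof. by move=> lt_ij; exists (j - i.+1)%N; rewrite subnK. Qed.

Let chain_split : exists l, m = (l + 1).+1.
Proof. by exists m.-2; rewrite addn1; case: (m) m_gt1 => [|[]]. Qed.

Lemma polarized_aa p w c d : chain_point p -> polarized m w p p c d = 0.
Proof.
case=> p0 _; apply: (@mxchain_eq0 _ _ _ 1) => /=; first exact: ltnW.
by rewrite /polarized_chain /= p0 mulmx0.
Qed.

Lemma polarized_cc p w a b : chain_point p -> polarized m w a b p p = 0.
Proof.
case=> _ pm; have last0 : polarized_chain m w a b p p m.-1 = 0.
  by rewrite /polarized_chain eqxx gtn_eqF ?pm // -ltnS prednK // ltnW.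
by rewrite /polarized; case: (m) m_gt1 last0 => //= m' _ ->; rewrite mulmx0.
Qed.

(** The factors 0 to k already multiply to zero, by [ddphi_segment_dphi]: the extra derivative along
    b can only fall on the first factor, because [phi k] is affine. *)
Lemma polarized_left p w b c d k : chain_point p -> (0 < k < m.-1)%N ->
  w k = p -> polarized m w p b c d = 0.
Proof.
move=> pt /andP[k0 km] wk; have lt_km : (k < m)%N.
  by apply: leq_trans km _; apply: leq_pred.
apply: (@mxchain_eq0 _ _ _ k.+1) => //.
have affk : affine_mx (phi k) by apply: phi_affine; rewrite k0.
have chain_mid j : (0 < j <= k)%N ->
    polarized_chain m w p b c d j = dmx (w j) (phi j).
  case/andP=> j0 jk; rewrite /polarized_chain gtn_eqF //.
  by rewrite ltn_eqF // (leq_ltn_trans jk).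
have aff j : (0 < j < k)%N -> affine_mx (phi j).
  by case/andP=> j0 jk; apply: phi_affine; rewrite j0 (ltn_trans jk).
have pk := chain_pointE pt lt_km.
case: (lt_split k0) wk chain_mid affk aff pk => l -> wk chain_mid affk aff pk.
rewrite mxchain_split mul1mx (eq_mxsegment (psi' := dphi w)); last first.
  by move=> j /andP[j0 jk]; apply: chain_mid; rewrite j0 ltnW.
rewrite (chain_mid (l + 1)%N) ?leqnn ?andbT; last by rewrite addn1.
rewrite wk {1}/polarized_chain /=.
by apply: ddphi_segment_dphi => //; apply: chain_pointE => //; apply: ltnW.
Qed.

Lemma polarized_right p w a b d k : chain_point p -> (0 < k < m.-1)%N ->
  w k = p -> polarized m w a b d p = 0.
Proof.
move=> pt /andP[k0 km] wk; have lt_km : (k < m)%N.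
  by apply: leq_trans km _; apply: leq_pred.
have m1 : (m.-1 < m)%N by case: (m) m_gt1.
apply: (@mxchain_eq0 _ _ _ m.-1.+1) => //.
have affk : affine_mx (phi k) by apply: phi_affine; rewrite k0.
have nem : (m.-1 == 0)%N = false by rewrite gtn_eqF // (ltn_trans k0).
have last_chain : polarized_chain m w a b d p m.-1 = dmx d (dmx p (phi m.-1)).
  by rewrite /polarized_chain nem eqxx.
have chain_mid j : (k <= j < m.-1)%N ->
    polarized_chain m w a b d p j = dmx (w j) (phi j).
  case/andP=> kj jm; rewrite /polarized_chain (ltn_eqF jm) gtn_eqF //.
  exact: leq_trans kj.
have aff j : (k < j < m.-1)%N -> affine_mx (phi j).
  by case/andP=> kj jm; apply: phi_affine; rewrite jm (leq_trans _ kj).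
have pm : dmx p (dmx p (phi m.-1)) = 0 by case: pt.
case: (lt_split km) last_chain chain_mid aff pm => l -> last_chain chain_mid aff pm.
rewrite mxchain_split (eq_mxsegment (psi' := dphi w)); last first.
  by move=> j /andP[kj jl]; apply: chain_mid; rewrite ltnW.
rewrite last_chain chain_mid ?leqnn ?leq_addl // wk.
by rewrite dphi_segment_ddphi ?mulmx0 // chain_pointE.
Qed.

Lemma polarized_repeat p w a b c d k k' : chain_point p ->
  (0 < k)%N -> (k < k')%N -> (k' < m.-1)%N -> w k = p -> w k' = p ->
  polarized m w a b c d = 0.
Proof.
move=> pt k0 kk' km' wk wk'.
have lt_k'm : (k' < m)%N by apply: leq_trans km' _; apply: leq_pred.
apply: (@mxchain_eq0 _ _ _ k'.+1) => //.
have chain_mid j : (k <= j <= k')%N ->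
    polarized_chain m w a b c d j = dmx (w j) (phi j).
  case/andP=> kj jk'; rewrite /polarized_chain gtn_eqF ?(leq_trans k0) //.
  by rewrite ltn_eqF // (leq_ltn_trans jk').
have aff j : (k < j < k')%N -> affine_mx (phi j).
  case/andP=> kj jk'; apply: phi_affine.
  by rewrite (ltn_trans k0 kj) (ltn_trans jk').
have pk' := chain_pointE pt lt_k'm.
have pk := chain_pointE pt (ltn_trans kk' lt_k'm).
case: (lt_split kk') wk' chain_mid aff pk' => l -> wk' chain_mid aff pk'.
rewrite mxchain_split (eq_mxsegment (psi' := dphi w)); last first.
  by move=> j /andP[kj jl]; apply: chain_mid; rewrite (ltnW kj) (ltnW jl).
have lek : (k <= l + k.+1)%N := leq_trans (leqnSn k) (leq_addl _ _).
rewrite !chain_mid ?leqnn ?lek //.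
by rewrite wk wk' dphi_segment_dphi ?mulmx0.
Qed.

(** Here the segment is the whole chain, with p at both ends; as both ends are quadratic, only the
    antisymmetry [ddmid_prodN] is available. *)
Lemma polarized_share p w b d : chain_point p ->
  polarized m w p b d p = - polarized m w p d b p.
Proof.
case=> p0; have [l def_m] := chain_split.
rewrite /polarized; move: phi_affine phi_last.
rewrite def_m -[(l + 1).+1.-1]/(l + 1)%N => aff plast pm.
have nz : (l + 1 == 0)%N = false by rewrite addn1.
have split b' d' : mxchain (polarized_chain (l + 1).+1 w p b' d' p) (l + 1).+1 =
    dmx b' (dmx p (phi 0)) *m mxsegment (dphi w) 1 l *m
      dmx d' (dmx p (phi (l + 1)%N)).
  rewrite mxchain_split mul1mx (eq_mxsegment (psi' := dphi w)); last first.
    move=> j /andP[j0 jl]; rewrite /polarized_chain gtn_eqF //.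
    by rewrite ltn_eqF.
  by rewrite {1 2}/polarized_chain /= nz eqxx.
by rewrite !split; apply: ddphi_segment_ddphi.
Qed.

(** The inner factors are constant and each end factor admits just one more derivative, so x and y
    fall on different ends. *)
Lemma dmx2_mxchain x y (v : nat -> 'rV[L]_N) :
  dmx x (dmx y (mxchain (dphi v) m)) =
    polarized m v (v 0%N) x y (v m.-1) + polarized m v (v 0%N) y x (v m.-1).
Proof.
have [l def_m] := chain_split; rewrite /polarized; move: phi_affine phi_last.
rewrite def_m -[(l + 1).+1.-1]/(l + 1)%N => aff plast.
have nz : (l + 1 == 0)%N = false by rewrite addn1.
have split b' d' : mxchain (polarized_chain (l + 1).+1 v (v 0%N) b' d'
      (v (l + 1)%N)) (l + 1).+1 =
    dmx b' (dmx (v 0%N) (phi 0)) *m mxsegment (dphi v) 1 l *m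
      dmx d' (dmx (v (l + 1)%N) (phi (l + 1)%N)).
  rewrite mxchain_split mul1mx (eq_mxsegment (psi' := dphi v)); last first.
    move=> j /andP[j0 jl]; rewrite /polarized_chain gtn_eqF //.
    by rewrite ltn_eqF.
  by rewrite {1 2}/polarized_chain /= nz eqxx.
rewrite !split mxchain_split mul1mx.
have dmid u : dmx u (mxsegment (dphi v) 1 l) = 0 by apply: dmx_segment.
rewrite !dmxM !dmid !mulmx0 !addr0 !dmxD !dmxM !dmid !mulmx0 !addr0.
by rewrite phi_first plast !mul0mx mulmx0 add0r addr0 addrC.
Qed.

End Polarized.

End ChainDerivatives.

(** * Alternating functions on the points *)

Section AlternatingFunctions.

Variables (L : fieldType) (m : nat).
Hypothesis two_neq0 : 2%:R != 0 :> L.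
Local Notation n := m.+2.
Implicit Types (u v : nat -> 'I_n).

Definition upd (T : Type) (u : nat -> T) s b k := if k == s then b else u k.

Lemma uniq_full (s : seq 'I_n) x : uniq s -> size s = n -> x \in s.
Proof.
move=> us sz; have := @subset_leqif_card _ (mem s) predT (subset_predT _).
by case=> _; rewrite (card_uniqP us) sz card_ord eqxx => /esym/subsetP->.
Qed.

(** Models u |-> det(P_(u 0), ..., P_(u m)) for n = m + 2 vectors of sum zero: only the entries 0,
    ..., m of the sequence count, and [palt_sum] reflects linearity in one entry together with
    \sum_i P_i = 0. *)
Record point_alternating (G : (nat -> 'I_n) -> L) : Prop := PointAlternating {
  palt_ext : forall u u', (forall k, (k <= m)%N -> u k = u' k) -> G u = G u';
  palt_rep : forall u s t, (s < t)%N -> (t <= m)%N -> u s = u t -> G u = 0;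
  palt_sum : forall u s, (s <= m)%N -> \sum_b G (upd u s b) = 0 }.

Lemma palt_sub G1 G2 c : point_alternating G1 -> point_alternating G2 ->
  point_alternating (fun u => G1 u - c * G2 u).
Proof.
move=> alt1 alt2; split=> [u u' eq_u|u s t lt_st le_tm eq_u|u s le_sm].
- by rewrite (palt_ext alt1 eq_u) (palt_ext alt2 eq_u).
- by rewrite (palt_rep alt1 lt_st) // (palt_rep alt2 lt_st) // mulr0 subr0.
by rewrite sumrB -mulr_sumr !palt_sum // mulr0 subr0.
Qed.

Section Unique.

Variable G : (nat -> 'I_n) -> L.
Hypothesis altG : point_alternating G.

Let H (s : 'S_n) := G (fun k => s (inord k)).

(** In the sum over the entry at place x, every index other than [s x] and the omitted [s ord_max]
    repeats an entry; the two remaining terms must cancel. *)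
Let H_star (s : 'S_n) (x : 'I_n) : x != ord_max -> H (tperm x ord_max * s) = - H s.
Proof.
move=> nx; have le_xm : (x <= m)%N.
  by rewrite -ltnS ltn_neqAle -[m.+1]/(@ord_max m.+1 : nat) (inj_eq val_inj) nx -ltnS /=.
have := palt_sum altG (fun k => s (inord k)) le_xm.
rewrite (bigD1 (s x)) //= (bigD1 (s ord_max)) /=; last first.
  by rewrite (inj_eq perm_inj) eq_sym.
rewrite big1 ?addr0 => [|b /andP[nb nb']]; last first.
  pose y := (s^-1)%g b; have def_b : b = s y by rewrite permKV.
  rewrite def_b !(inj_eq perm_inj) in nb nb'.
  have le_ym : (y <= m)%N.
    by rewrite -ltnS ltn_neqAle -[m.+1]/(@ord_max m.+1 : nat) (inj_eq val_inj) nb' -ltnS /=.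
  have rep : upd (fun k => s (inord k)) x b x = upd (fun k => s (inord k)) x b y.
    rewrite /upd eqxx (inj_eq val_inj) (negPf nb) inord_val //.
  have : (x != y :> nat) by rewrite (inj_eq val_inj) eq_sym.
  rewrite neq_ltn => /orP[lt_xy|lt_yx]; first exact: palt_rep lt_xy le_ym rep.
  exact: palt_rep lt_yx le_xm (esym rep).
move/eqP; rewrite addrC addr_eq0 => /eqP; rewrite /H => E.
rewrite (palt_ext altG (u' := upd (fun k => s (inord k)) x (s ord_max))) ?E.
  congr (- _); apply: palt_ext => // k le_km; rewrite /upd.
  by case: eqP => // ->; rewrite inord_val.
move=> k le_km; rewrite /upd permM; case: eqP => [->|/eqP nkx].
  by rewrite inord_val tpermL.
rewrite tpermD //.
  by rewrite -val_eqE /= inordK ?ltnS ?(leqW le_km) // eq_sym.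
by rewrite -val_eqE /= inordK ?ltnS ?(leqW le_km) // gtn_eqF.
Qed.

Let H_tperm (s : 'S_n) (x y : 'I_n) : x != y -> H (tperm x y * s) = - H s.
Proof.
case: (eqVneq x ord_max) => [->|nx] nxy.
  by rewrite tpermC H_star // eq_sym.
have [->|ny] := eqVneq y ord_max; first exact: H_star.
have -> : tperm x y = (tperm x ord_max * tperm y ord_max * tperm x ord_max)%g.
  rewrite -{1}[tperm x ord_max]tpermV -mulgA -conjgE tpermJ tpermR tpermC tpermD //.
  by rewrite eq_sym.
by rewrite -!mulgA !H_star // opprK.
Qed.

(** A sequence either repeats an entry or is the beginning of a permutation, and transpositions only
    change the sign, so one value determines all of them. *)
Lemma palt_eq0 : G (fun k => inord k) = 0 -> forall u, G u = 0.
Proof.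
move=> G0; have H1 : H 1 = 0.
  by rewrite -[RHS]G0; apply: palt_ext => // k _; rewrite perm1.
have Hs s : H s = 0.
  have [ts -> /=] := prod_tpermP s.
  elim: ts => [|t ts IH] /=; first by rewrite big_nil.
  by case/andP=> dt /IH H0; rewrite big_cons H_tperm // H0 oppr0.
move=> u; pose s := [seq u k | k <- iota 0 m.+1].
have [us|nus] := boolP (uniq s); last first.
  have [i [j [lt_ij lt_j eq_u]]] : exists i j, [/\ (i < j)%N, (j < m.+1)%N & u i = u j].
    move: nus => /(uniqPn (u 0%N))[i [j [lt_ij lt_j]]].
    rewrite size_map size_iota in lt_j; have lt_i := ltn_trans lt_ij lt_j.
    rewrite !(nth_map 0%N) ?size_iota // !nth_iota // !add0n => E.
    by exists i, j.
  exact: palt_rep lt_ij lt_j eq_u.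
have [l nl] : exists l, l \notin s.
  apply/existsP; rewrite -negb_forall; apply: contraL us => /forallP all_s.
  apply/negP => us; have := card_uniqP us.
  rewrite size_map size_iota (eq_card (B := predT)) => [|x]; last by rewrite all_s.
  by rewrite card_ord => /eqP; rewrite eqn_leq ltnn.
(* [s] has m + 1 entries; at the last index the default value of [nth] supplies the omitted point
   [l], which completes [u] to a permutation. *)
pose w (k : 'I_n) := nth l s k.
have szs : size (rcons s l) = n by rewrite size_rcons size_map size_iota.
have w_inj : injective w.
  move=> i j /eqP; rewrite /w; have nthE (k : 'I_n) : nth l s k = nth l (rcons s l) k.
    by rewrite nth_rcons; case: ltngtP => // [/ltnW|/esym/eq_leq] le_k; rewrite nth_default.
  by rewrite !nthE nth_uniq ?szs ?ltn_ord // ?rcons_uniq ?nl // (inj_eq val_inj) => /eqP.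
rewrite -[RHS](Hs (perm w_inj)); apply: palt_ext => // k le_km.
rewrite permE /w /s inordK ?ltnS ?leqW // (nth_map 0%N) ?size_iota // nth_iota //.
Qed.

End Unique.

End AlternatingFunctions.

(** * The polarized chain as a function of indices of points *)

Section PolarizedCombinatorics.

Variables (L : fieldType) (m : nat).
Hypothesis two_neq0 : 2%:R != 0 :> L.
Hypothesis m_gt1 : (1 < m)%N.
Local Notation n := m.+2.
Variable T : (nat -> 'I_n) -> 'I_n -> 'I_n -> 'I_n -> 'I_n -> L.
Implicit Types (w v u : nat -> 'I_n) (a b c d i j p x : 'I_n).

Hypothesis T_ext : forall w w' a b c d,
  (forall k, (0 < k < m.-1)%N -> w k = w' k) -> T w a b c d = T w' a b c d.
Hypothesis TCl : forall w a b c d, T w a b c d = T w b a c d.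
Hypothesis TCr : forall w a b c d, T w a b c d = T w a b d c.
Hypothesis T_aa : forall w a c d, T w a a c d = 0.
Hypothesis T_cc : forall w a b c, T w a b c c = 0.
Hypothesis T_left : forall w a b c d k, (0 < k < m.-1)%N -> w k = a ->
  T w a b c d = 0.
Hypothesis T_right : forall w a b c d k, (0 < k < m.-1)%N -> w k = d ->
  T w a b c d = 0.
Hypothesis T_repeat : forall w a b c d k k', (0 < k)%N -> (k < k')%N ->
  (k' < m.-1)%N -> w k = w k' -> T w a b c d = 0.
Hypothesis T_share : forall w p b d, T w p b d p = - T w p d b p.
Hypothesis T_suml : forall w a c d, \sum_x T w a x c d = 0.
Hypothesis T_sumr : forall w a b c, \sum_x T w a b c x = 0.
Hypothesis T_summ : forall w a b c d k, (0 < k < m.-1)%N ->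
  \sum_x T (upd w k x) a b c d = 0.

Let double0 (x : L) : x + x = 0 -> x = 0.
Proof. by move/eqP; rewrite -mulr2n -mulr_natl mulf_eq0 (negPf two_neq0) => /eqP. Qed.

Let T_left' w a b c d k : (0 < k < m.-1)%N -> w k = b -> T w a b c d = 0.
Proof. by move=> km wk; rewrite TCl (T_left _ _ _ km wk). Qed.

Let T_right' w a b c d k : (0 < k < m.-1)%N -> w k = c -> T w a b c d = 0.
Proof. by move=> km wk; rewrite TCr (T_right _ _ _ km wk). Qed.

Let T_share' w p b d : T w p b p d = - T w p d p b.
Proof. by rewrite TCr T_share TCr. Qed.

Let T_abab w a b : T w a b a b = 0.
Proof. by apply: double0; rewrite {1}T_share' addNr. Qed.

Let T_abba w a b : T w a b b a = 0.
Proof. by rewrite TCr T_abab. Qed.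

Let T_sumr' w a b d : \sum_x T w a b x d = 0.
Proof. by under eq_bigr do rewrite TCr; apply: T_sumr. Qed.

Let sum4 (f : 'I_n -> L) a b c d : uniq [:: a; b; c; d] ->
    (forall x, x \notin [:: a; b; c; d] -> f x = 0) ->
  \sum_x f x = f a + f b + f c + f d.
Proof.
move=> us f0; rewrite (bigID (mem [:: a; b; c; d])) /= [X in _ + X]big1 // addr0.
by rewrite -big_uniq //= !big_cons big_nil addr0 !addrA.
Qed.

(** Unless T vanishes for a simpler reason, the m - 2 inner indices and a, b, c, d exhaust the m + 2
    points. The sum relations in the last two slots then involve a, b, c, d only, and four of them
    combine to 2 T = 0. *)
Lemma polarized_distinct w a b c d : uniq [:: a; b; c; d] -> T w a b c d = 0.
Proof.
move=> us; pose s := [seq w k | k <- iota 1 m.-2].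
have [us'|] := boolP (uniq ([:: a; b; c; d] ++ s)); last first.
  rewrite cat_uniq us andTb negb_and negbK => /orP[/hasP[x /mapP[k]]|].
    rewrite mem_iota add1n => km -> /=.
    have {}km : (0 < k < m.-1)%N by case: (m) m_gt1 km => [|[]].
    rewrite !inE => /or4P[] /eqP wk.
    - exact: T_left km wk.
    - exact: T_left' km wk.
    - exact: T_right' km wk.
    exact: T_right km wk.
  move=> /(uniqPn a)[k [k' [lt_kk' lt_k']]].
  rewrite size_map size_iota in lt_k'; have lt_k := ltn_trans lt_kk' lt_k'.
  rewrite !(nth_map 0%N) ?size_iota // !nth_iota //.
  apply: T_repeat; rewrite !add1n //.
  by case: (m) m_gt1 lt_k' => [|[]].
have other x : x \notin [:: a; b; c; d] -> exists2 k, (0 < k < m.-1)%N & w k = x.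
  move=> nx; have := uniq_full x us'.
  rewrite size_cat size_map size_iota mem_cat (negPf nx).
  have sz : (4 + m.-2 = n)%N by case: (m) m_gt1 => [|[]].
  case/(_ sz)/mapP=> k; rewrite mem_iota add1n => km ->; exists k => //.
  by case: (m) m_gt1 km => [|[]].
have T0l x : x \notin [:: a; b; c; d] -> forall y, T w a b x y = 0.
  by case/other=> k km wk y; apply: T_right' wk.
have T0r x : x \notin [:: a; b; c; d] -> forall y, T w a b y x = 0.
  by case/other=> k km wk y; apply: T_right wk.
have := T_sumr' w a b c; rewrite (sum4 us) => [|x /T0l]; last exact.
rewrite T_cc addr0 => E1.
have := T_sumr' w a b d; rewrite (sum4 us) => [|x /T0l]; last exact.
rewrite T_cc addr0 => E2.
have := T_sumr w a b a; rewrite (sum4 us) => [|x /T0r]; last exact.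
rewrite T_cc T_abab !add0r => E3.
have := T_sumr w a b b; rewrite (sum4 us) => [|x /T0r]; last exact.
rewrite T_cc T_abba !add0r => E4.
apply: double0; rewrite {2}TCr.
have -> : T w a b c d + T w a b d c =
    (T w a b a c + T w a b b c + T w a b d c) +
    (T w a b a d + T w a b b d + T w a b c d) -
    (T w a b a c + T w a b a d) - (T w a b b c + T w a b b d) by ring.
by rewrite E1 E2 E3 E4 !subr0 addr0.
Qed.

(** In \sum_x T w a b x c = 0 only x = a and x = b survive. *)
Lemma polarized_shift w a b c : a != c -> T w a b b c = - T w a b a c.
Proof.
move=> nac; have [->|nab] := eqVneq a b; first by rewrite T_aa oppr0.
have [<-|nbc] := eqVneq b c; first by rewrite T_cc T_abab oppr0.
have := T_sumr' w a b c; rewrite (bigD1 a) //= (bigD1 b) 1?eq_sym //=.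
rewrite (bigD1 c) ?T_cc; last by rewrite ![c == _]eq_sym nac nbc.
rewrite big1 => [/eqP|x /andP[/andP[nxa nxb] nxc]].
  by rewrite /= !addr0 addrC addr_eq0 => /eqP.
apply: polarized_distinct.
by rewrite /= !inE !negb_or nab nac nbc ![_ == x]eq_sym nxa nxb nxc.
Qed.

(** By [dmx2_mxchain], half the second derivative along P_b of the chain whose factors are
    differentiated along the points v 0, ..., v (m-1). *)
Definition polarized_diag v b := T v (v 0%N) b b (v m.-1).

Let m1_lt : (m.-1 < m)%N. Proof. by case: (m) m_gt1. Qed.
Let m1_gt0 : (0 < m.-1)%N. Proof. by case: (m) m_gt1 => [|[]]. Qed.

Lemma polarized_diag_repeat v s t b :
  (s < t)%N -> (t < m)%N -> v s = v t -> polarized_diag v b = 0.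
Proof.
rewrite /polarized_diag => lt_st lt_tm eq_v; have le_tm : (t <= m.-1)%N.
  by rewrite -ltnS prednK // ltnW.
have [s0|s0] := posnP s; last first.
  have [<-|nt] := eqVneq t m.-1.
    by apply: T_right eq_v; rewrite s0 (leq_trans lt_st).
  by apply: T_repeat eq_v => //; rewrite ltn_neqAle nt.
subst s; have [<-|nt] := eqVneq t m.-1; first by rewrite eq_v T_abba.
by apply: T_left (esym eq_v); rewrite lt_st ltn_neqAle nt.
Qed.

Lemma polarized_diag_mem v s : (s < m)%N -> polarized_diag v (v s) = 0.
Proof.
rewrite /polarized_diag => lt_sm; have [->|s0] := posnP s; first by rewrite T_aa.
have [->|ns] := eqVneq s m.-1; first by rewrite T_cc.
apply: T_left' (erefl (v s)).
by rewrite s0 ltn_neqAle ns -ltnS prednK // ltnW.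
Qed.

(** The expression is quadratic in the point b; [polarized_shift] replaces it by one that is linear
    in b, to which the sum relation applies. *)
Lemma polarized_diag_sum v : \sum_b polarized_diag v b = 0.
Proof.
have [eq_v|nv] := eqVneq (v 0%N) (v m.-1).
  by apply: big1 => b _; apply: polarized_diag_repeat eq_v.
rewrite (eq_bigr (fun b => - T v (v 0%N) b (v 0%N) (v m.-1))) ?sumrN ?T_suml ?oppr0 //.
by move=> b _; apply: polarized_shift.
Qed.

Lemma polarized_diag_ext v v' b : (forall k, (k < m)%N -> v k = v' k) ->
  polarized_diag v b = polarized_diag v' b.
Proof.
move=> eq_v; rewrite /polarized_diag !eq_v ?(ltnW m_gt1) //.
by apply: T_ext => k /andP[_ km]; apply/eq_v/(ltn_trans km).
Qed.

Lemma polarized_diag_alternating :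
  point_alternating (fun u => polarized_diag u (u m)).
Proof.
split=> [u u' eq_u|u s t lt_st le_tm eq_u|u s le_sm].
- rewrite eq_u //; apply: polarized_diag_ext => k lt_km.
  by rewrite eq_u // ltnW.
- move: le_tm; rewrite leq_eqVlt => /orP[/eqP eq_tm|lt_tm].
    by rewrite -eq_tm -eq_u polarized_diag_mem // -eq_tm.
  exact: polarized_diag_repeat eq_u.
have upd_same b : upd u s b s = b by rewrite /upd eqxx.
have upd_other b k : k != s -> upd u s b k = u k by rewrite /upd => /negPf->.
move: le_sm; rewrite leq_eqVlt => /orP[/eqP eq_sm|lt_sm].
  rewrite -[RHS](polarized_diag_sum u); apply: eq_bigr => b _.
  rewrite eq_sm /upd eqxx; apply: polarized_diag_ext => k lt_km.
  by rewrite ltn_eqF.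
have nsm : m != s by rewrite gtn_eqF.
rewrite /polarized_diag; under eq_bigr do rewrite (upd_other _ _ nsm).
have [s0|s0] := posnP s.
  subst s; rewrite -[RHS](T_suml u (u m) (u m) (u m.-1)); apply: eq_bigr => b _.
  rewrite upd_same upd_other ?gtn_eqF // TCl.
  by apply: T_ext => k /andP[k0 _]; rewrite upd_other // gtn_eqF.
have [sm|nsm1] := eqVneq s m.-1.
  rewrite -[RHS](T_sumr u (u 0%N) (u m) (u m)); apply: eq_bigr => b _.
  rewrite -sm upd_same upd_other ?ltn_eqF //.
  by apply: T_ext => k /andP[_ km]; rewrite upd_other // sm ltn_eqF.
have sm : (0 < s < m.-1)%N by rewrite s0 ltn_neqAle nsm1 -ltnS prednK // ltnW.
rewrite -[RHS](T_summ u (u 0%N) (u m) (u m) (u m.-1) sm); apply: eq_bigr => b _.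
have n0s : 0%N != s by rewrite ltn_eqF.
have nms : m.-1 != s by rewrite eq_sym.
by rewrite (upd_other _ _ n0s) (upd_other _ _ nms).
Qed.

(** If the two ends share an index, the symmetries within each end bring T to the form T w a b b d,
    a value of [polarized_diag]; otherwise T vanishes anyway. This will exclude that the scalar in
    front of the determinant is zero. *)
Lemma polarized_eq0 : (forall v b, polarized_diag v b = 0) ->
  forall w a b c d, T w a b c d = 0.
Proof.
move=> diag0; have shared w a b d : T w a b b d = 0.
  (* T reads its sequence at the inner places only, so the places 0 and m - 1 are free to hold a and
     d. *)
  pose v := upd (upd w 0%N a) m.-1 d.
  have v0 : v 0%N = a by rewrite /v /upd (ltn_eqF m1_gt0).
  have vm : v m.-1 = d by rewrite /v /upd eqxx.
  have := diag0 v b; rewrite /polarized_diag v0 vm => <-.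
  apply: T_ext => k /andP[k0 km].
  by rewrite /v /upd (ltn_eqF km) (gtn_eqF k0).
move=> w a b c d; have [->|nab] := eqVneq a b; first exact: T_aa.
have [->|ncd] := eqVneq c d; first exact: T_cc.
have [->|nbc] := eqVneq b c; first exact: shared.
have [->|nbd] := eqVneq b d; first by rewrite TCr shared.
have [->|nac] := eqVneq a c; first by rewrite TCl shared.
have [->|nad] := eqVneq a d; first by rewrite TCl TCr shared.
by apply: polarized_distinct; rewrite /= !inE !negb_or nab nac nad nbc nbd ncd.
Qed.

Definition polarized_sym v i j :=
  T v (v 0%N) i j (v m.-1) + T v (v 0%N) j i (v m.-1).

Lemma polarized_sym_diag v i : polarized_sym v i i = 2%:R * polarized_diag v i.
Proof. by rewrite mulr_natl mulr2n. Qed.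

Lemma polarized_sym_repeat v s t i j :
  (s < t)%N -> (t < m)%N -> v s = v t -> polarized_sym v i j = 0.
Proof.
rewrite /polarized_sym => lt_st lt_tm eq_v; have le_tm : (t <= m.-1)%N.
  by rewrite -ltnS prednK // ltnW.
have [s0|s0] := posnP s; last first.
  have [<-|nt] := eqVneq t m.-1.
    have sm : (0 < s < m.-1)%N by rewrite s0 (leq_trans lt_st).
    by rewrite -eq_v !(T_right _ _ _ sm erefl) addr0.
  have lt_t1 : (t < m.-1)%N by rewrite ltn_neqAle nt.
  by rewrite !(T_repeat _ _ _ _ s0 lt_st lt_t1 eq_v) addr0.
subst s; have [<-|nt] := eqVneq t m.-1; first by rewrite -eq_v T_share addNr.
have lt_t1 : (0 < t < m.-1)%N by rewrite lt_st ltn_neqAle nt.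
by rewrite !(T_left _ _ _ lt_t1 (esym eq_v)) addr0.
Qed.

(** Each coefficient counts the ends of v that meet i or j. This dependence on the ends is what the
    sum over the rotations removes. *)
Lemma polarized_sym_neq v i j : i != j -> v 0%N != v m.-1 ->
  polarized_sym v i j =
    - ((v 0%N == j)%:R + (v m.-1 == j)%:R) * polarized_diag v i
    - ((v 0%N == i)%:R + (v m.-1 == i)%:R) * polarized_diag v j.
Proof.
move=> nij nv.
have diag0 : polarized_diag v (v 0%N) = 0 by rewrite polarized_diag_mem // ltnW.
have diagm : polarized_diag v (v m.-1) = 0 by rewrite polarized_diag_mem.
have T0 x : x != v m.-1 -> T v (v 0%N) x (v 0%N) (v m.-1) = - polarized_diag v x.
  by move=> nx; rewrite /polarized_diag polarized_shift ?opprK.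
have Tm x : T v (v 0%N) (v m.-1) x (v m.-1) = - polarized_diag v x.
  rewrite TCl T_share TCr -polarized_shift 1?eq_sym //.
  by rewrite [LHS]TCl T_share' [in LHS]TCl.
rewrite /polarized_sym.
have [v0j|nv0j] := eqVneq (v 0%N) j.
  rewrite -v0j [v m.-1 == v 0%N]eq_sym (negPf nv) T_aa addr0; have [vmi|nvmi] := eqVneq (v m.-1) i.
    by rewrite -vmi T_abab diag0 diagm !mulr0 subr0.
  by rewrite T0 1?eq_sym // diag0 mulr0 subr0 addr0 mulN1r.
have [v0i|nv0i] := eqVneq (v 0%N) i.
  rewrite -v0i [v m.-1 == v 0%N]eq_sym (negPf nv) T_aa add0r.
  have [vmj|nvmj] := eqVneq (v m.-1) j.
    by rewrite -vmj T_abab diag0 diagm !mulr0 subr0.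
  by rewrite T0 1?eq_sym // diag0 mulr0 add0r addr0 mul1r.
rewrite !add0r; have [vmj|nvmj] := eqVneq (v m.-1) j.
  rewrite -vmj T_cc add0r Tm diagm mulr0 subr0.
  by rewrite mulN1r.
have [vmi|nvmi] := eqVneq (v m.-1) i.
  by rewrite -vmi T_cc addr0 Tm diagm mulr0 add0r mul1r.
rewrite !polarized_distinct ?addr0 ?oppr0 ?mul0r ?subr0 //= !inE !negb_or.
  by rewrite nv0j nv0i nv (eq_sym j) nij /= ![_ == v m.-1]eq_sym nvmi nvmj.
by rewrite nv0i nv0j nv nij /= ![_ == v m.-1]eq_sym nvmi nvmj.
Qed.

End PolarizedCombinatorics.

(** * Determinants as alternating functions of points *)

Section RowDeterminants.

Variables (L : fieldType) (m : nat).
Implicit Types (z : nat -> 'rV[L]_m.+1) (x w : 'rV[L]_m.+1).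

Definition rowdet z := \det (\matrix_(i < m.+1, j < m.+1) z i 0 j).

Lemma rowdet_ext z z' : (forall k, (k <= m)%N -> z k = z' k) -> rowdet z = rowdet z'.
Proof.
by move=> eq_z; congr (\det _); apply/matrixP => i j; rewrite !mxE eq_z // -ltnS.
Qed.

Lemma rowdet_upd z k : (k <= m)%N ->
  exists c : 'I_m.+1 -> L, forall x, rowdet (upd z k x) = \sum_j x 0 j * c j.
Proof.
move=> le_km; pose i0 : 'I_m.+1 := inord k; have i0k : i0 = k :> nat by rewrite inordK.
pose A x := \matrix_(i < m.+1, j < m.+1) upd z k x i 0 j.
exists (fun j => cofactor (A 0) i0 j) => x.
rewrite /rowdet -/(A x) (expand_det_row _ i0); apply: eq_bigr => j _.
rewrite mxE /upd i0k eqxx; congr (_ * (_ * \det _)).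
apply/matrixP => r s; rewrite !mxE /upd -i0k.
by rewrite (inj_eq val_inj) eq_sym (negPf (neq_lift _ _)).
Qed.

Lemma rowdet_lincomb (I : finType) (c : I -> L) (x : I -> 'rV[L]_m.+1) z k :
  (k <= m)%N ->
  rowdet (upd z k (\sum_a c a *: x a)) = \sum_a c a * rowdet (upd z k (x a)).
Proof.
move=> le_km; have [d dE] := rowdet_upd z le_km; rewrite dE.
under [RHS]eq_bigr do rewrite dE mulr_sumr.
rewrite exchange_big; apply: eq_bigr => j _.
by rewrite summxE mulr_suml; apply: eq_bigr => a _; rewrite mxE mulrA.
Qed.

Lemma rowdet_repeat z s t : (s < t)%N -> (t <= m)%N -> z s = z t -> rowdet z = 0.
Proof.
move=> lt_st le_tm eq_z; have le_sm := leq_trans (ltnW lt_st) le_tm.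
apply: (determinant_alternate (i1 := inord s) (i2 := inord t)) => [|j].
  by rewrite -val_eqE /= !inordK // ltn_eqF.
by rewrite !mxE !inordK // eq_z.
Qed.

Lemma val_iter_ordS j (i : 'I_m) : iter j (@ordS m) i = ((i + j) %% m)%N :> nat.
Proof.
elim: j => [|j IH] /=; first by rewrite addn0 modn_small.
by rewrite IH -addn1 modnDml addn1 addnS.
Qed.

(* Even powers of the cycle are even permutations. *)
Lemma rowdet_rotate z k :
  rowdet (fun i => if (i < m)%N then z ((i + k.*2) %% m)%N else z i) = rowdet z.
Proof.
pose rot := perm (@ordS_inj m); pose s := lift_perm ord_max ord_max (rot ^+ k.*2)%g.
rewrite /rowdet; set A := (X in _ = \det X).
rewrite -[RHS]mul1r; transitivity (\det (row_perm s A)); last first.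
  rewrite row_permE det_mulmx det_perm /s odd_lift_perm addbb.
  by rewrite -addnn expgD odd_permM addbb expr0.
congr (\det _); apply/matrixP => i j; rewrite !mxE.
have [lt_im|ge_im] := ltnP.
  have -> : i = lift ord_max (Ordinal lt_im) by apply: val_inj; rewrite /= /bump leqNgt lt_im.
  rewrite lift_perm_lift !lift_max permX.
  by rewrite (eq_iter (permE (@ordS_inj m))) val_iter_ordS.
have -> : i = ord_max.
  by apply: val_inj => /=; apply/eqP; rewrite eqn_leq ge_im -ltnS ltn_ord.
by rewrite lift_perm_id.
Qed.

Variable P : 'I_m.+2 -> 'rV[L]_m.+1.
Hypothesis P_sum : \sum_i P i = 0.

Lemma rowdet_alternating : point_alternating (fun u => rowdet (P \o u)).
Proof.
split=> [u u' eq_u|u s t lt_st le_tm eq_u|u s le_sm].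
- by apply: rowdet_ext => k le_km; rewrite /= eq_u.
- by apply: rowdet_repeat lt_st le_tm _; rewrite /= eq_u.
transitivity (\sum_b 1 * rowdet (upd (P \o u) s (P b))).
  apply: eq_bigr => b _; rewrite mul1r; apply: rowdet_ext => k _.
  by rewrite /upd /=; case: eqP.
rewrite -rowdet_lincomb //; under eq_bigr do rewrite scale1r.
rewrite P_sum; have [d ->] := rowdet_upd (P \o u) le_sm.
by rewrite big1 // => j _; rewrite mxE mul0r.
Qed.

Hypothesis P_base : rowdet (fun k => P (inord k)) != 0.

(** The scalar is chosen to fit at the sequence 0, ..., m; the difference is again alternating and
    vanishes there, hence everywhere. *)
Lemma alternating_rowdet (G : (nat -> 'I_m.+2) -> L) : point_alternating G ->
  exists c, forall u, G u = c * rowdet (P \o u).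
Proof.
move=> altG; exists (G (fun k => inord k) / rowdet (fun k => P (inord k))) => u.
apply/eqP; rewrite -subr_eq0; apply/eqP.
apply: (palt_eq0 (palt_sub _ altG rowdet_alternating)).
by rewrite divfK // subrr.
Qed.

End RowDeterminants.

(** * Summation over the rotations *)

Section RotationCount.

Variable m : nat.

(** Modulo m the arguments are 2k and 2k - 1; for k = 1, ..., m they fill the interval from 1 to 2m,
    which is two periods. *)
Lemma sum_rotation (F : nat -> nat) : (0 < m)%N -> (forall r, F (r + m)%N = F r) ->
  (\sum_(1 <= k < m.+1) (F k.*2 + F (m.-1 + k.*2)) = (\sum_(r < m) F r).*2)%N.
Proof.
move=> m_gt0 Fm; transitivity (\sum_(k < m) (F k.*2.+1 + F k.*2.+2))%N.
  rewrite big_add1 big_mkord /=; apply: eq_bigr => k _; rewrite addnC doubleS.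
  have -> : (m.-1 + k.*2.+2 = k.*2.+1 + m)%N by rewrite addnS -addSn prednK // addnC.
  by rewrite Fm.
have split l : (\sum_(k < l) (F k.*2.+1 + F k.*2.+2) = \sum_(r < l.*2) F r.+1)%N.
  elim: l => [|l IH]; first by rewrite !big_ord0.
  by rewrite big_ord_recr IH doubleS !big_ord_recr /= addnA.
have rot : (\sum_(r < m) F r.+1 = \sum_(r < m) F r)%N.
  case: m Fm => [|m'] Fm; first by rewrite !big_ord0.
  by rewrite big_ord_recr big_ord_recl -(Fm 0%N) add0n addnC.
rewrite split -addnn big_split_ord /= -addnn rot; congr (_ + _)%N.
by rewrite -rot; apply: eq_bigr => r _; rewrite -addnS addnC Fm.
Qed.

End RotationCount.

Section RotationSum.

Variables (L : fieldType) (m : nat).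
Hypothesis m_gt1 : (1 < m)%N.
Local Notation n := m.+2.
Variables (sym : (nat -> 'I_n) -> 'I_n -> 'I_n -> L).
Variables (diag : (nat -> 'I_n) -> 'I_n -> L).
Implicit Types (v : nat -> 'I_n) (i j b : 'I_n).

Hypothesis sym_repeat : forall v s t i j,
  (s < t)%N -> (t < m)%N -> v s = v t -> sym v i j = 0.
Hypothesis sym_diag : forall v i, sym v i i = 2%:R * diag v i.
Hypothesis sym_neq : forall v i j, i != j -> v 0%N != v m.-1 ->
  sym v i j = - ((v 0%N == j)%:R + (v m.-1 == j)%:R) * diag v i
              - ((v 0%N == i)%:R + (v m.-1 == i)%:R) * diag v j.
Hypothesis diag_repeat : forall v s t b,
  (s < t)%N -> (t < m)%N -> v s = v t -> diag v b = 0.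
Hypothesis diag_mem : forall v s, (s < m)%N -> diag v (v s) = 0.
Hypothesis diag_sum : forall v, \sum_b diag v b = 0.

Definition rotate v k : nat -> 'I_n := fun x => v ((x + k.*2) %% m)%N.

Hypothesis diag_rotate : forall v k b, diag (rotate v k) b = diag v b.

(** For i = j the m equal terms give the factor m = n - 2. For i and j distinct, every entry of v
    stands at an end twice in total. If i or j is an entry of v, its [diag] vanishes and the other
    term has the right coefficient; if neither is, they are the two points that v misses, and both
    sides are zero by [diag_sum]. *)
Lemma rotation_sum v i j :
  \sum_(1 <= k < m.+1) sym (rotate v k) i j =
    2%:R * ((n * (i == j))%N%:R * diag v i - diag v i - diag v j).
Proof.
have m_gt0 := ltnW m_gt1; have [->|nij] := eqVneq i j.
  under eq_bigr do rewrite sym_diag diag_rotate.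
  rewrite sumr_const_nat subn1 /= muln1 -mulrnAr; congr (_ * _).
  rewrite mulr_natl -addrA -opprD -mulr2n -mulrnBr ?(ltn_trans _ m_gt1) //.
  by rewrite subSS subSS subn0.
rewrite muln0 mul0r sub0r; pose s := [seq v k | k <- iota 0 m].
have [us|] := boolP (uniq s); last first.
  move=> /(uniqPn i)[k [k' [lt_kk' lt_k']]].
  rewrite size_map size_iota in lt_k'; have lt_k := ltn_trans lt_kk' lt_k'.
  rewrite !(nth_map 0%N) ?size_iota // !nth_iota // !add0n => eq_v.
  rewrite !(diag_repeat _ lt_kk' lt_k' eq_v) subr0 oppr0 mulr0.
  apply: big1_seq => r _.
  (* [back] inverts the rotation, so it carries the repetition at k and k' to two places of the
     rotated sequence. *)
  pose back x := ((x + (m - (r.*2 %% m))) %% m)%N.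
  have backK x : (x < m)%N -> rotate v r (back x) = v x.
    move=> lt_xm; rewrite /rotate /back modnDml -modnDmr -addnA subnK.
      by rewrite modnDr modn_small.
    by apply/ltnW/ltn_pmod.
  have lt_back x : (back x < m)%N by apply: ltn_pmod.
  have n_back : back k != back k'.
    apply: contraTneq lt_kk' => eq_b; rewrite -leqNgt.
    have := congr1 (fun x => ((x + r.*2) %% m)%N) eq_b.
    rewrite /back !modnDml -[LHS]modnDmr -[RHS]modnDmr -!addnA !subnK ?(ltnW (ltn_pmod _ _)) //.
    by rewrite !modnDr !modn_small // => ->.
  have eq_rot : rotate v r (back k) = rotate v r (back k') by rewrite !backK.
  by move: n_back; rewrite neq_ltn => /orP[] lt_b; apply: sym_repeat lt_b _ _.
have v_inj x y : (x < m)%N -> (y < m)%N -> (v x == v y) = (x == y).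
  move=> lt_x lt_y; rewrite -[RHS](nth_uniq i (s := s)) ?size_map ?size_iota //.
  by rewrite !(nth_map 0%N) ?size_iota // !nth_iota.
pose c b := (\sum_(r < m) (v r == b))%N.
pose F b r : nat := v (r %% m)%N == b.
have count b : (\sum_(1 <= k < m.+1) (F b k.*2 + F b (m.-1 + k.*2)) = (c b).*2)%N.
  rewrite sum_rotation // => [|r]; last by rewrite /F modnDr.
  by congr double; apply: eq_bigr => r _; rewrite /F modn_small.
transitivity (- (c j).*2%:R * diag v i - (c i).*2%:R * diag v j).
  rewrite -!count !natr_sum mulNr !mulr_suml -opprD -big_split -sumrN.
  apply: eq_bigr => k _ /=; rewrite sym_neq // ?diag_rotate; last first.
    rewrite /rotate v_inj ?ltn_pmod // eqn_modDr mod0n modn_small ?prednK //.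
    by rewrite eq_sym -lt0n -ltnS prednK.
  by rewrite mulNr -opprD /F /rotate add0n !natrD.
have c1 b : b \in s -> c b = 1%N.
  case/mapP=> x; rewrite mem_iota add0n => /andP[_ lt_xm] ->.
  rewrite /c (bigD1 (Ordinal lt_xm)) //= eqxx big1 // => r.
  by rewrite -val_eqE /= v_inj // => /negPf ->.
have c0 b : b \notin s -> c b = 0%N.
  move=> nb; apply: big1 => r _; apply/eqP; rewrite eqb0; apply: contra nb => /eqP <-.
  by rewrite map_f // mem_iota add0n ltn_ord.
have diag_s b : b \in s -> diag v b = 0.
  by case/mapP=> x; rewrite mem_iota add0n => /andP[_ lt_xm] ->; apply: diag_mem.
have [js|njs] := boolP (j \in s).
  rewrite (diag_s _ js) (c1 _ js) -!muln2 !natrM; ring.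
have [i_s|nis] := boolP (i \in s).
  rewrite (diag_s _ i_s) (c1 _ i_s) -!muln2 !natrM; ring.
have us' : uniq [:: i, j & s] by rewrite /= inE negb_or nij nis njs.
rewrite c0 // c0 //; have := diag_sum v.
rewrite (bigD1 i) //= (bigD1 j) 1?eq_sym //= big1 => [E|b /andP[nbi nbj]].
  by move/eqP: E; rewrite /= addr0 addrC addr_eq0 => /eqP ->; ring.
apply: diag_s; have := uniq_full b us'; rewrite !inE (negPf nbi) (negPf nbj) /=.
by apply; rewrite /= size_map size_iota.
Qed.

End RotationSum.

(** * Multilinear functions and determinants *)

Section MultilinearExtension.

Variables (L : fieldType) (m N n' : nat).
Local Notation V := 'rV[L]_N.

Record multilinear (f : (nat -> V) -> L) : Prop := Multilinear {
  mlin_ext : forall v v', (forall k, (k < m)%N -> v k = v' k) -> f v = f v';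
  mlin_sum : forall v k (t : 'I_n' -> L) (z : 'I_n' -> V), (k < m)%N ->
    f (upd v k (\sum_i t i *: z i)) = \sum_i t i * f (upd v k (z i)) }.

Variable P : 'I_n' -> V.
Hypothesis P_span : forall x, exists t, x = \sum_i t i *: P i.

(** Induction on the number [q] of initial entries not yet known to be among the P_i; the entry at
    place q is expanded in the P_i. *)
Lemma multilinear_eq f g : multilinear f -> multilinear g -> (0 < n')%N ->
  (forall u : nat -> 'I_n', f (P \o u) = g (P \o u)) -> forall v, f v = g v.
Proof.
move=> fP gP n_gt0 eq_fg.
have step q : (q <= m)%N -> forall v : nat -> V,
    (forall k, (q <= k < m)%N -> exists i, v k == P i) -> f v = g v.
  elim: q => [_|q IH lt_qm] v vP.
    pose u k := odflt (Ordinal n_gt0) [pick i | v k == P i].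
    have uP k : (k < m)%N -> v k = P (u k).
      rewrite /u => /vP[i vi]; case: pickP => [j /eqP //|/(_ i)].
      by rewrite vi.
    by rewrite (mlin_ext fP uP) (mlin_ext gP uP) eq_fg.
  have [t vq] := P_span (v q).
  have eq_v : forall k, (k < m)%N -> v k = upd v q (\sum_i t i *: P i) k.
    by move=> k _; rewrite /upd -vq; case: (k =P q) => [->|].
  rewrite (mlin_ext fP eq_v) (mlin_ext gP eq_v) !mlin_sum //.
  apply: eq_bigr => i _; congr (_ * _); apply: IH; first exact: ltnW.
  move=> k /andP[qk km]; rewrite /upd; have [_|nkq] := eqVneq k q.
    by exists i.
  by apply: vP; rewrite km ltn_neqAle eq_sym nkq qk.
by move=> v; apply: (step m) => // k /andP[mk]; rewrite ltnNge mk.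
Qed.

Lemma multilinearZ c f : multilinear f -> multilinear (fun v => c * f v).
Proof.
move=> fP; split=> [v v' /(mlin_ext fP)-> //|v k t z lt_km].
by rewrite mlin_sum // mulr_sumr; apply: eq_bigr => i _; rewrite mulrCA.
Qed.

Lemma multilinear_sum (I : Type) (r : seq I) (F : I -> (nat -> V) -> L) :
  (forall i, multilinear (F i)) -> multilinear (fun v => \sum_(i <- r) F i v).
Proof.
move=> FP; split=> [v v' eq_v|v k t z lt_km].
  by apply: eq_bigr => i _; apply: mlin_ext.
under eq_bigr do rewrite mlin_sum //.
by rewrite exchange_big; apply: eq_bigr => i _; rewrite mulr_sumr.
Qed.

Lemma multilinear_perm (s s' : nat -> nat) f : multilinear f ->
    (forall k, (k < m)%N -> (s k < m)%N) -> (forall k, (k < m)%N -> (s' k < m)%N) ->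
    (forall k, (k < m)%N -> s (s' k) = k) -> (forall k, (k < m)%N -> s' (s k) = k) ->
  multilinear (fun v => f (v \o s)).
Proof.
move=> fP s_lt s'_lt sK s'K; split=> [v v' eq_v|v k t z lt_km].
  by apply: (mlin_ext fP) => k lt_km /=; apply/eq_v/s_lt.
have upd_s x : f (upd v k x \o s) = f (upd (v \o s) (s' k) x).
  apply: (mlin_ext fP) => i lt_im; rewrite /upd /=.
  suff -> : (s i == k) = (i == s' k) by [].
  by apply/eqP/eqP => [<-|->]; rewrite ?s'K ?sK.
rewrite upd_s mlin_sum ?s'_lt //; apply: eq_bigr => i _; by rewrite upd_s.
Qed.

End MultilinearExtension.

Section RowDeterminantBasis.

Variables (L : fieldType) (m : nat).

Lemma multilinear_rowdet n' (w : 'rV[L]_m.+1) :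
  multilinear m n' (fun v => rowdet (upd v m w)).
Proof.
split=> [v v' eq_v|v k t z lt_km].
  apply: rowdet_ext => k; rewrite /upd leq_eqVlt => /orP[->//|lt_km].
  by rewrite ltn_eqF // eq_v.
have updC x : rowdet (upd (upd v k x) m w) = rowdet (upd (upd v m w) k x).
  apply: rowdet_ext => i _; rewrite /upd; case: eqP => // ->.
  by rewrite gtn_eqF.
by rewrite updC rowdet_lincomb ?(ltnW lt_km) //; apply: eq_bigr => i _; rewrite updC.
Qed.

(** This reads a coordinate of w off the determinant. The sign, multiplied by the one in [Omega], no
    longer depends on k, which is why the forms Omega_k carry alternating signs. *)
Lemma rowdet_basis (k : 'I_m.+1) (v : nat -> 'rV[L]_m.+1) w :
    (forall i : 'I_m, v i = delta_mx 0 (lift k i)) ->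
  rowdet (upd v m w) = (-1) ^+ (m + k) * w 0 k.
Proof.
move=> vE; rewrite {1}(row_sum_delta w) rowdet_lincomb // (bigD1 k) //=.
rewrite [X in _ + X]big1 ?addr0 => [|j njk]; last first.
  case: (unliftP k j) njk => [i ->|->]; last by rewrite eqxx.
  move=> _; rewrite (rowdet_repeat (s := i) (t := m)) ?mulr0 ?ltn_ord //.
  by rewrite /upd eqxx ltn_eqF // vE.
rewrite mulrC; congr (_ * _); rewrite /rowdet (expand_det_row _ ord_max).
rewrite (bigD1 k) //= big1 ?addr0 => [|j njk]; last first.
  by rewrite !mxE /upd eqxx mxE (negPf njk) andbF mul0r.
rewrite !mxE /upd eqxx mxE !eqxx mul1r /cofactor; set A := row' _ _.
suff -> : A = 1%:M by rewrite det1 mulr1.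
apply/matrixP => r s; rewrite !mxE lift_max ltn_eqF ?ltn_ord // vE mxE eqxx /=.
by rewrite (inj_eq lift_inj) eq_sym.
Qed.

End RowDeterminantBasis.

(** * Minimal resolutions *)

Section HomogeneousMatrices.

Variables (K : fieldType) (N : nat).
Local Notation R := {mpoly K[N]}.

Definition homog_mx d r s (A : 'M[R]_(r, s)) := forall i j, A i j \is d.-homog.

Lemma homogC (c : K) : (c%:MP : R) \is 0.-homog.
Proof. by rewrite -[c%:MP]mulr1 mul_mpolyC rpredZ // dhomog1. Qed.

Lemma homog_mxM d e r s t (A : 'M[R]_(r, s)) (B : 'M[R]_(s, t)) :
  homog_mx d A -> homog_mx e B -> homog_mx (d + e) (A *m B).
Proof.
by move=> Ad Be i j; rewrite mxE; apply: rpred_sum => k _; apply: dhomogM.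
Qed.

Lemma homog_dmx d v r s (A : 'M[R]_(r, s)) :
  homog_mx d A -> homog_mx d.-1 (dmx v A).
Proof. by move=> Ad i j; rewrite mxE; apply: dird_homog. Qed.

Lemma homog_mx0 v r s (A : 'M[R]_(r, s)) : homog_mx 0 A -> dmx v A = 0.
Proof. by move=> A0; apply/matrixP => i j; rewrite !mxE dird_homog0. Qed.

Lemma homog_affine_mx r s (A : 'M[R]_(r, s)) : homog_mx 1 A -> affine_mx A.
Proof. by move=> A1 u v; apply/homog_mx0/(homog_dmx (d := 1)). Qed.

Lemma homog_quadratic_mx r s (A : 'M[R]_(r, s)) : homog_mx 2 A -> quadratic_mx A.
Proof. by move=> A2 u v x; apply/homog_affine_mx/(homog_dmx (d := 2)). Qed.

Hypothesis charK : [pchar K] =i pred0.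

Lemma homog_mderiv_eq0 d (f : R) : (0 < d)%N -> f \is d.-homog ->
  (forall i, f^`M(i) = 0) -> f = 0.
Proof.
move=> d_gt0 fd df; apply/mpolyP => m; rewrite mcoeff0.
have [->|/eqP m0] := eqVneq m 0%MM.
  by rewrite (dhomog_nemf_coeff fd) //= mdeg0 ltn_eqF.
have [i mi] : exists i, m i != 0%N.
  apply/existsP; rewrite -negb_forall; apply/negP => /forallP m_eq0.
  by case: m0; apply/mnmP => i; rewrite mnm0E; apply/eqP.
have : (f^`M(i))@_(m - U_(i)) = 0 by rewrite df mcoeff0.
rewrite mcoeff_mderiv submK ?lem1_mnm1 //; last first.
  apply/mnm_lepP => j; rewrite mnm1E; case: eqP => [<-|_] //; by rewrite lt0n.
move/eqP; rewrite -mulr_natr mulf_eq0 => /orP[/eqP //|].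
by rewrite ((pcharf0P _).1 charK).
Qed.

Lemma homog_dmx_eq0 d r s (A : 'M[R]_(r, s)) : (0 < d)%N -> homog_mx d A ->
  (forall i, dmx (delta_mx 0 i) A = 0) -> A = 0.
Proof.
move=> d_gt0 Ad dA; apply/matrixP => i j; rewrite [RHS]mxE.
apply: (homog_mderiv_eq0 d_gt0) => // k.
by move/matrixP/(_ i j): (dA k); rewrite !mxE dird_delta.
Qed.

Lemma pihomogM_const d (f g : R) : g \is d.-homog ->
  pihomog mdeg d (f * g) = f@_0%MM *: g.
Proof.
move=> gd; rewrite {1}[f]mpolyE mulr_suml linear_sum /=.
have [f0|nf0] := eqVneq f@_0%MM 0.
  rewrite f0 scale0r big_seq big1 // => m m_f; rewrite -scalerAl linearZ /=.
  have m0 : m != 0%MM by apply: contraTneq m_f => ->; rewrite mcoeff_msupp f0 eqxx.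
  rewrite (pihomog_ne0 (d := (mdeg m + d)%N)) ?scaler0 //.
    by rewrite -[X in _ != X]add0n eqn_add2r mdeg_eq0.
  by apply: dhomogM => //; rewrite dhomogX.
rewrite (bigD1_seq 0%MM) ?mcoeff_msupp ?msupp_uniq //= big1 ?addr0 => [|m m0].
  by rewrite -scalerAl mpolyX0 mul1r linearZ /= pihomog_dE.
rewrite -scalerAl linearZ /= (pihomog_ne0 (d := (mdeg m + d)%N)) ?scaler0 //.
  by rewrite -[X in _ != X]add0n eqn_add2r mdeg_eq0.
by apply: dhomogM => //; rewrite dhomogX.
Qed.

End HomogeneousMatrices.

Section MinimalExact.

Variables (K : fieldType) (N : nat) (rk : nat -> nat).
Local Notation R := {mpoly K[N]}.
Hypothesis charK : [pchar K] =i pred0.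
Variable phi : forall k, 'M[R]_(rk k, rk k.+1).
Hypothesis phi_exact : forall k (v : 'cV[R]_(rk k.+1)),
  phi k *m v = 0 <-> exists w : 'cV[R]_(rk k.+2), v = phi k.+1 *m w.
Hypothesis phi_minimal : forall k i j, (phi k i j)@_0%MM = 0.

Lemma exact_complex k : phi k *m phi k.+1 = 0.
Proof.
apply/matrixP => i j; have [_ E] := phi_exact (phi k.+1 *m delta_mx j 0).
have /matrixP/(_ i 0) : phi k *m (phi k.+1 *m delta_mx j (0 : 'I_1)) = 0.
  by apply: E; exists (delta_mx j 0).
by rewrite mulmxA -colE !mxE.
Qed.

Lemma exact_mx k s (V : 'M[R]_(rk k.+1, s)) : phi k *m V = 0 ->
  exists W, V = phi k.+1 *m W.
Proof.
move=> V0; have colV j : exists w, col j V = phi k.+1 *m w.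
  by apply/phi_exact; rewrite colE mulmxA V0 mul0mx.
have [w wE] := fin_all_exists colV; exists (\matrix_(i, j) w j i 0).
apply/matrixP => i j; move/matrixP/(_ i 0): (wE j); rewrite !mxE => ->.
by apply: eq_bigr => l _; rewrite !mxE.
Qed.

(** The columns of a minimal matrix satisfy no linear relation over K: a constant relation lies in
    the image of the next matrix, whose entries have no constant term. *)
Lemma minimal_free k s (w : 'M[R]_(rk k.+1, s)) :
  homog_mx 0 w -> phi k *m w = 0 -> w = 0.
Proof.
move=> w0 /exact_mx[u def_w]; apply/matrixP => i j.
rewrite (homog0P (w0 i j)) def_w !mxE raddf_sum big1 ?mpolyC0 // => l _ /=.
by rewrite mcoeff0_is_multiplicative phi_minimal mul0r.
Qed.

(* Multiplication by an element f of the ideal is homotopic to zero. *)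
Lemma null_homotopy (f : R) (c : 'M_(rk 1, rk 0)) k : phi 0 *m c = f%:M ->
  exists s : 'M_(rk k.+1, rk k), phi k *m s *m phi k = f *: phi k.
Proof.
move=> phic; elim: k => [|k [s sE]].
  by exists c; rewrite phic mul_scalar_mx.
have /exact_mx[s' s'E] : phi k *m (f%:M - s *m phi k) = 0.
  by rewrite mulmxBr mulmxA sE mul_mx_scalar subrr.
by exists s'; rewrite -s'E mulmxBl mul_scalar_mx -mulmxA exact_complex mulmx0 subr0.
Qed.

(** [phi k] is injective, since the next module is zero, and it kills f - s [phi k]. *)
Lemma ideal_last (f : R) k s : phi k *m s *m phi k = f *: phi k ->
  rk k.+2 = 0%N -> s *m phi k = f%:M.
Proof.
move=> sE rk0; have /exact_mx[w wE] : phi k *m (f%:M - s *m phi k) = 0.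
  by rewrite mulmxBr mulmxA sE mul_mx_scalar subrr.
apply/esym/eqP; rewrite -subr_eq0 wE; apply/eqP/matrixP => i j.
rewrite mxE big1 ?mxE // => [[l lt_l]]; exfalso.
by move: (lt_l); rewrite rk0.
Qed.

Section QuadraticEnds.

Variable l : nat.
Hypothesis rk_first : rk 0 = 1%N.
Hypothesis rk_last : rk l.+2 = 1%N.
Hypothesis rk_end : rk l.+3 = 0%N.
Hypothesis rk_sym : rk 1 = rk l.+1.
Hypothesis phi_first : homog_mx 2 (phi 0).
Hypothesis phi_middle : forall k, (0 < k < l.+1)%N -> homog_mx 1 (phi k).
Hypothesis phi_last : homog_mx 2 (phi l.+1).

Let ord_first (i j : 'I_(rk 0)) : i = j.
Proof.
have : forall q, q = 1%N -> forall i j : 'I_q, i = j by move=> q -> x y; rewrite !ord1.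
by apply.
Qed.

(* Null-homotopies express each generator of the ideal through the entries of
   the last matrix; there are equally many of both, so the converse holds. *)
Lemma last_in_ideal (i0 : 'I_(rk 0)) (j0 : 'I_(rk l.+2)) :
  exists S : 'M[K]_(rk l.+1, rk 1),
    forall i, phi l.+1 i j0 = \sum_r S i r *: phi 0 i0 r.
Proof.
have gen r : exists s : 'I_(rk l.+1) -> K,
    phi 0 i0 r = \sum_i s i *: phi l.+1 i j0.
  have phic : phi 0 *m delta_mx r i0 = (phi 0 i0 r)%:M.
    apply/matrixP => i j; rewrite (ord_first i i0) (ord_first j i0) mxE.
    rewrite (bigD1 r) //= big1 => [|k nk]; last by rewrite !mxE (negPf nk) mulr0.
    by rewrite !mxE !eqxx mulr1 addr0.
  have [s /ideal_last/(_ rk_end)/matrixP/(_ j0 j0)] := null_homotopy l.+1 phic.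
  (* The generator and the entries of the last matrix all have degree 2, so in degree 2 only the
     constant terms of the homotopy count. *)
  rewrite !mxE eqxx mulr1n => /(congr1 (pihomog mdeg 2)).
  rewrite (pihomog_dE (phi_first i0 r)) linear_sum => <-.
  by exists (fun i => (s j0 i)@_0%MM); apply: eq_bigr => i _ /=; rewrite pihomogM_const.
have [s sE] := fin_all_exists gen; pose S := \matrix_(r, i) s r i.
(* The generators are linearly independent over K, hence so are the rows of S; as S is square by
   [rk_sym], it has an inverse T. *)
have /row_fullP[T TS] : row_full S.
  suff /eqP rkS : row_free S by rewrite /row_full rkS; apply/eqP.
  apply: inj_row_free => y yS.
  pose Y := map_mx (@mpolyC N K) y^T.
  have Y0 : Y = 0.
    apply: (@minimal_free 0).
      by move=> i j; rewrite mxE homogC.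
    apply/matrixP => i j; rewrite (ord_first i i0) !mxE.
    transitivity (\sum_k (\sum_r y 0 r * S r k) *: phi l.+1 k j0).
      under [RHS]eq_bigr do rewrite scaler_suml.
      rewrite exchange_big; apply: eq_bigr => r _ /=.
      rewrite sE mulr_suml; apply: eq_bigr => k _.
      by rewrite !mxE mulrC mul_mpolyC scalerA ord1.
    apply: big1 => k _; move/matrixP/(_ 0 k): yS; rewrite !mxE => ->.
    by rewrite scale0r.
  apply/rowP => r; move/matrixP/(_ r 0): Y0; rewrite !mxE => /eqP.
  by rewrite mpolyC_eq0 => /eqP.
exists T => i; under eq_bigr do rewrite sE scaler_sumr.
rewrite exchange_big; transitivity (\sum_k (T *m S) i k *: phi l.+1 k j0).
  rewrite TS (bigD1 i) //= big1 => [|k nk]; last by rewrite mxE eq_sym (negPf nk) scale0r.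
  by rewrite mxE eqxx scale1r addr0.
apply: eq_bigr => k _; rewrite mxE scaler_suml; apply: eq_bigr => r _.
by rewrite mxE scalerA.
Qed.

Let e (i : 'I_N) : 'rV[K]_N := delta_mx 0 i.

(** By minimality [phi k] does not kill a nonzero constant vector w. The image consists of forms of
    degree 1, or 2 if k = 0, and in characteristic 0 some derivative of that order is a nonzero
    constant vector, with which the argument continues one place to the left. *)
Lemma chain_neq0 k (w : 'M[R]_(rk k.+1, 1)) c d : (k < l.+1)%N ->
  homog_mx 0 w -> w != 0 -> exists (a b : 'I_N) (u : nat -> 'I_N),
    mxchain (polarized_chain phi l.+2 (e \o u) (e a) (e b) c d) k.+1 *m w != 0.
Proof.
elim: k w => [|k IH] w lt_kl w0 nzw.
  have nz0 : phi 0 *m w != 0 by apply: contraNneq nzw => /(minimal_free w0)->.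
  have [b nzb] : exists b, dmx (e b) (phi 0 *m w) != 0.
    apply/existsP; rewrite -negb_forall; apply: contraNN nz0 => /forallP df.
    apply/eqP/(homog_dmx_eq0 charK (d := 2)) => //; first exact: homog_mxM phi_first w0.
    by move=> i; apply/eqP.
  have [a nza] : exists a, dmx (e a) (dmx (e b) (phi 0 *m w)) != 0.
    apply/existsP; rewrite -negb_forall; apply: contraNN nzb => /forallP df.
    apply/eqP/(homog_dmx_eq0 charK (d := 1)) => //; last by move=> i; apply/eqP.
    exact: homog_dmx (homog_mxM phi_first w0).
  exists b, a, (fun=> a); rewrite /= /polarized_chain /= mul1mx.
  by move: nza; rewrite !dmxM (homog_mx0 _ w0) !mulmx0 !addr0 dmxM (homog_mx0 _ w0) mulmx0 addr0.
have km : (0 < k.+1 < l.+1)%N by [].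
have nz0 : phi k.+1 *m w != 0 by apply: contraNneq nzw => /(minimal_free w0)->.
have [a nza] : exists a, dmx (e a) (phi k.+1 *m w) != 0.
  apply/existsP; rewrite -negb_forall; apply: contraNN nz0 => /forallP df.
  apply/eqP/(homog_dmx_eq0 charK (d := 1)) => //; last by move=> i; apply/eqP.
  exact: homog_mxM (phi_middle km) w0.
have w'0 : homog_mx 0 (dmx (e a) (phi k.+1) *m w).
  exact: homog_mxM (homog_dmx (e a) (phi_middle km)) w0.
rewrite dmxM (homog_mx0 _ w0) mulmx0 addr0 in nza.
have [b [b' [u]]] := IH _ (ltnW lt_kl) w'0 nza.
move=> nz; exists b, b', (fun i => if i == k.+1 then a else u i).
set psi' := polarized_chain _ _ _ _ _ _ _.
set psi := polarized_chain _ _ _ _ _ _ _ in nz.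
have psi'_k : psi' k.+1 = dmx (e a) (phi k.+1).
  by rewrite /psi' /polarized_chain /= eqxx (ltn_eqF lt_kl).
have eq_psi i : (i < k.+1)%N -> psi' i = psi i.
  by move=> lt_ik; rewrite /psi' /psi /polarized_chain /= (ltn_eqF lt_ik).
by rewrite mxchainS psi'_k (eq_mxchain eq_psi) -mulmxA.
Qed.

Lemma polarized_neq0 (j0 : 'I_(rk l.+2)) : exists (a b c d : 'I_N) (u : nat -> 'I_N),
  polarized phi l.+2 (e \o u) (e a) (e b) (e c) (e d) *m delta_mx j0 0
    != 0 :> 'cV_(rk 0).
Proof.
pose D : 'cV[R]_(rk l.+2) := delta_mx j0 0.
have D0 : homog_mx 0 D.
  by move=> i j; rewrite mxE -mpolyC_nat homogC.
have nz0 : phi l.+1 *m D != 0.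
  apply: contraTneq isT => /(minimal_free D0)/matrixP/(_ j0 0).
  by rewrite !mxE !eqxx => /eqP; rewrite oner_eq0.
have [c nzc] : exists c, dmx (e c) (phi l.+1 *m D) != 0.
  apply/existsP; rewrite -negb_forall; apply: contraNN nz0 => /forallP df.
  apply/eqP/(homog_dmx_eq0 charK (d := 2)) => //; first exact: homog_mxM phi_last D0.
  by move=> i; apply/eqP.
have [d nzd] : exists d, dmx (e d) (dmx (e c) (phi l.+1 *m D)) != 0.
  apply/existsP; rewrite -negb_forall; apply: contraNN nzc => /forallP df.
  apply/eqP/(homog_dmx_eq0 charK (d := 1)) => //; last by move=> i; apply/eqP.
  exact: homog_dmx (homog_mxM phi_last D0).
rewrite !dmxM (homog_mx0 _ D0) !mulmx0 !addr0 dmxM (homog_mx0 _ D0) mulmx0 addr0 in nzd.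
have w0 : homog_mx 0 (dmx (e d) (dmx (e c) (phi l.+1)) *m D).
  exact: homog_mxM (homog_dmx (e d) (homog_dmx (e c) phi_last)) D0.
have [a [b [u nz]]] := chain_neq0 (e d) (e c) (ltnSn l) w0 nzd.
exists a, b, d, c, u; rewrite /polarized [mxchain _ l.+2]/= -mulmxA.
rewrite [polarized_chain _ _ _ _ _ _ _ l.+1]/polarized_chain /= eqxx.
exact: nz.
Qed.

End QuadraticEnds.

End MinimalExact.

(** * The quadratic forms at the points *)

Section PointFormula.

Variables (L : fieldType) (m : nat) (rk : nat -> nat).
Local Notation n := m.+2.
Local Notation V := 'rV[L]_m.+1.
Hypothesis two_neq0 : 2%:R != 0 :> L.
Variable psi : forall k, 'M[{mpoly L[m.+1]}]_(rk k, rk k.+1).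
Hypothesis psi_complex : forall k, psi k *m psi k.+1 = 0.
Variables (i0 : 'I_(rk 0)) (j0 : 'I_(rk m)).
Variable P : 'I_n -> V.
Hypothesis P_sum : \sum_i P i = 0.
Hypothesis P_base : rowdet (fun k => P (inord k)) != 0.
Hypothesis P_span : forall x, exists t : 'I_n -> L, x = \sum_i t i *: P i.

Definition chain_coef (A : 'M[{mpoly L[m.+1]}]_(rk 0, rk m)) : L := (A i0 j0)@_0%MM.

Lemma chain_coef_lincomb (I : finType) (t : I -> L) A :
  chain_coef (\sum_i (t i)%:MP *: A i) = \sum_i t i * chain_coef (A i).
Proof.
rewrite /chain_coef summxE raddf_sum; apply: eq_bigr => i _ /=.
by rewrite mxE mcoeffCM.
Qed.

Lemma chain_coef_opp A : chain_coef (- A) = - chain_coef A.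
Proof. by rewrite /chain_coef mxE mcoeffN. Qed.

(** The polar form of the bracket, with arbitrary directions in place of coordinate ones, so that
    points can be inserted everywhere. *)
Definition bracket_form (v : nat -> V) x y : L :=
  chain_coef (dmx x (dmx y (mxchain (fun k => dmx (v k) (psi k)) m))).

Definition dbracket_form (v : nat -> V) x y : L :=
  \sum_(1 <= k < m.+1) bracket_form (fun s => v ((s + k.*2) %% m)%N) x y.

Lemma multilinear_bracket_form n' x y :
  multilinear m n' (fun v => bracket_form v x y).
Proof.
split=> [v v' eq_v|v k t z lt_km]; rewrite /bracket_form.
  by congr (chain_coef (dmx _ (dmx _ _))); apply: eq_mxchain => k /eq_v->.
rewrite (mxchain_lincomb (c := fun i => (t i)%:MP) (k := k)
  (psis := fun i s => dmx (upd v k (z i) s) (psi s)) lt_km); last 2 first.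
- by move=> i s _ nsk; rewrite /upd (negPf nsk).
- by rewrite {1}/upd eqxx dmx_lincomb; apply: eq_bigr => i _; rewrite /upd eqxx.
by rewrite !dmx_sum chain_coef_lincomb.
Qed.

Lemma multilinear_dbracket_form n' x y : (0 < m)%N ->
  multilinear m n' (fun v => dbracket_form v x y).
Proof.
move=> m_gt0; apply: multilinear_sum => k.
apply: (multilinear_perm (s := fun s => ((s + k.*2) %% m)%N)
  (s' := fun s => ((s + (m - k.*2 %% m)) %% m)%N)
  (multilinear_bracket_form n' x y)) => s lt_sm; rewrite ?ltn_pmod //.
  rewrite modnDml -modnDmr -addnA subnK ?(ltnW (ltn_pmod _ _)) //.
  by rewrite modnDr modn_small.
rewrite modnDml -addnA -modnDmr -[in X in (_ + X)%N]modnDml.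
rewrite subnKC ?(ltnW (ltn_pmod _ _)) //.
by rewrite modnn addn0 modn_small.
Qed.

(** Let e_i be the idempotents of L^n and u_i = e_i - 1/n. The u_i sum to zero like the P_i, and n
    u_i u_j = n [i = j] u_i - u_i - u_j modulo constants. *)
Definition point_relation i j : V := (n * (i == j))%N%:R *: P i - P i - P j.

Lemma rowdet_point_relation (u : nat -> 'I_n) i j :
  rowdet (upd (P \o u) m (point_relation i j)) =
    (n * (i == j))%N%:R * rowdet (upd (P \o u) m (P i))
      - rowdet (upd (P \o u) m (P i)) - rowdet (upd (P \o u) m (P j)).
Proof.
have [d dE] := rowdet_upd (P \o u) (leqnn m).
rewrite !dE mulr_sumr -!sumrB; apply: eq_bigr => k _.
by rewrite !mxE; ring.
Qed.

Lemma rowdet_rotate_points u k b :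
  rowdet (upd (P \o rotate u k) m b) = rowdet (upd (P \o u) m b).
Proof.
rewrite -[RHS](rowdet_rotate _ k); apply: rowdet_ext => i.
rewrite /upd leq_eqVlt => /orP[/eqP->|lt_im]; first by rewrite eqxx ltnn.
have m_gt0 : (0 < m)%N by apply: leq_ltn_trans lt_im.
by rewrite lt_im (ltn_eqF lt_im) (ltn_eqF (ltn_pmod _ m_gt0)).
Qed.

Section AtLeastFour.

Hypothesis m_gt1 : (1 < m)%N.
Hypothesis psi_affine : forall k, (0 < k < m.-1)%N -> affine_mx (psi k).
Hypothesis psi_first : quadratic_mx (psi 0).
Hypothesis psi_last : quadratic_mx (psi m.-1).
Hypothesis P_point : forall i, chain_point psi m (P i).
Hypothesis psi_neq0 : exists (u : nat -> V) a b c d,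
  chain_coef (polarized psi m u a b c d) != 0.

Let T (w : nat -> 'I_n) a b c d :=
  chain_coef (polarized psi m (P \o w) (P a) (P b) (P c) (P d)).

Let T_ext w w' a b c d : (forall k, (0 < k < m.-1)%N -> w k = w' k) ->
  T w a b c d = T w' a b c d.
Proof.
move=> eq_w; congr chain_coef; apply: eq_mxchain => k lt_km.
rewrite /polarized_chain; case: eqP => // /eqP k0; case: eqP => // /eqP km /=.
by rewrite eq_w // lt0n k0 ltn_neqAle km -ltnS prednK // ltnW.
Qed.

Let TCl w a b c d : T w a b c d = T w b a c d.
Proof. by rewrite /T polarizedCl. Qed.

Let TCr w a b c d : T w a b c d = T w a b d c.
Proof. by rewrite /T polarizedCr. Qed.

Let chain_coef0 : chain_coef 0 = 0. Proof. by rewrite /chain_coef mxE mcoeff0. Qed.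

Let T_aa w a c d : T w a a c d = 0.
Proof. by rewrite /T (polarized_aa m_gt1 _ _ _ (P_point a)) chain_coef0. Qed.

Let T_cc w a b c : T w a b c c = 0.
Proof. by rewrite /T (polarized_cc m_gt1 _ _ _ (P_point c)) chain_coef0. Qed.

Let T_left w a b c d k : (0 < k < m.-1)%N -> w k = a -> T w a b c d = 0.
Proof.
move=> km wk; have := polarized_left two_neq0 psi_complex m_gt1 psi_affine.
by move=> E; rewrite /T (E _ (P \o w) _ _ _ _ (P_point a) km) ?chain_coef0 //= wk.
Qed.

Let T_right w a b c d k : (0 < k < m.-1)%N -> w k = d -> T w a b c d = 0.
Proof.
move=> km wk; have := polarized_right two_neq0 psi_complex m_gt1 psi_affine.
by move=> E; rewrite /T (E _ (P \o w) _ _ _ _ (P_point d) km) ?chain_coef0 //= wk.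
Qed.

Let T_repeat w a b c d k k' : (0 < k)%N -> (k < k')%N -> (k' < m.-1)%N ->
  w k = w k' -> T w a b c d = 0.
Proof.
move=> k0 kk' k'm eq_w.
have := polarized_repeat two_neq0 psi_complex m_gt1 psi_affine => E.
by rewrite /T (E _ (P \o w) _ _ _ _ _ _ (P_point (w k)) k0 kk' k'm) ?chain_coef0 //= eq_w.
Qed.

Let T_share w p b d : T w p b d p = - T w p d b p.
Proof.
have := polarized_share two_neq0 psi_complex m_gt1 psi_affine psi_first psi_last.
by move=> E; rewrite /T E // chain_coef_opp.
Qed.

(** The sum relation is written as an equality of two linear combinations of the P_i, to both sides
    of which the linearity lemmas apply. *)
Let P_sum1 : \sum_i 1 *: P i = \sum_i 0 *: P i.
Proof.
rewrite [RHS]big1 => [|i _]; last by rewrite scale0r.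
by under eq_bigr do rewrite scale1r.
Qed.

Let sum0 (F : 'I_n -> L) : \sum_i 1 * F i = \sum_i 0 * F i -> \sum_i F i = 0.
Proof.
move=> E; transitivity (\sum_i 1 * F i).
  by apply: eq_bigr => i _; rewrite mul1r.
by rewrite E big1 // => i _; rewrite mul0r.
Qed.

Let T_suml w a c d : \sum_x T w a x c d = 0.
Proof.
by apply: sum0; rewrite -!chain_coef_lincomb -!(polarized_linearl _ m_gt1) P_sum1.
Qed.

Let T_sumr w a b c : \sum_x T w a b c x = 0.
Proof.
by apply: sum0; rewrite -!chain_coef_lincomb -!(polarized_linear _ m_gt1) P_sum1.
Qed.

Let T_summ w a b c d k : (0 < k < m.-1)%N -> \sum_x T (upd w k x) a b c d = 0.
Proof.
move=> km; apply: sum0; rewrite -!chain_coef_lincomb.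
have same x : (P \o upd w k x) k = P x by rewrite /= /upd eqxx.
have other x j : j != k -> (P \o upd w k x) j = (upd (P \o w) k (\sum_i 0 *: P i)) j.
  by rewrite /= /upd => /negPf->.
have wE e : \sum_i e i *: P i = \sum_i 0 *: P i ->
    chain_coef (\sum_i (e i)%:MP *: polarized psi m (P \o upd w k i) (P a) (P b) (P c) (P d))
      = chain_coef (polarized psi m (upd (P \o w) k (\sum_i 0 *: P i)) (P a) (P b) (P c) (P d)).
  move=> eE; congr chain_coef; apply/esym/(polarized_linearm psi _ _ _ _ km) => //.
  by rewrite {1}/upd eqxx -eE; apply: eq_bigr => i _; rewrite same.
by rewrite (wE (fun=> 1)) ?(wE (fun=> 0)).
Qed.

Let diag := polarized_diag T.

(** All the directions are packed into one sequence: the ends keep the places 0 and m - 1, and their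
    additional derivatives take the places m and m + 1. Vanishing at the points can then be extended
    to all directions. *)
Let multilinear_polarized : multilinear m.+2 n
  (fun v => chain_coef (polarized psi m v (v 0%N) (v m) (v m.+1) (v m.-1))).
Proof.
have m1_lt : (m.-1 < m)%N by case: (m) m_gt1.
have m1_gt0 : (0 < m.-1)%N by case: (m) m_gt1 => [|[]].
have ext w w' a b c d : (forall k, (0 < k < m.-1)%N -> w k = w' k) ->
    polarized psi m w a b c d = polarized psi m w' a b c d.
  move=> eq_w; apply: eq_mxchain => k lt_km.
  rewrite /polarized_chain; case: eqP => // /eqP k0; case: eqP => // /eqP km /=.
  by rewrite eq_w // lt0n k0 ltn_neqAle km -ltnS prednK // ltnW.
split=> [v v' eq_v|v k t z lt_k].
  rewrite !eq_v ?(leq_trans m1_lt) ?ltnS ?leqnSn ?leqW //.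
  congr chain_coef; apply: ext => k /andP[_ km]; apply: eq_v.
  by rewrite (ltn_trans km) // (ltn_trans m1_lt) // leqW.
have other x j : j != k -> upd v k x j = v j by rewrite /upd => /negPf->.
have same x : upd v k x k = x by rewrite /upd eqxx.
have ext_end x a b c d : ~~ (0 < k < m.-1)%N ->
    polarized psi m (upd v k x) a b c d = polarized psi m v a b c d.
  by move=> nk; apply: ext => j jm; rewrite other //; apply: contraNneq nk => <-.
rewrite -chain_coef_lincomb; congr chain_coef.
have [k0|k0] := posnP k.
  subst k; have [nm nm' nm1] : [/\ m != 0%N, m.+1 != 0%N & m.-1 != 0%N].
    by rewrite !gtn_eqF // ltnW.
  have ends x : polarized psi m (upd v 0%N x) (upd v 0%N x 0%N) (upd v 0%N x m)
      (upd v 0%N x m.+1) (upd v 0%N x m.-1) = polarized psi m v (v m) x (v m.+1) (v m.-1).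
    by rewrite ext_end // same !other // polarizedCl.
  by rewrite ends (polarized_linearl _ m_gt1); apply: eq_bigr => i _; rewrite ends.
have [km|km] := ltnP k m.-1.
  have nk j : (m.-1 <= j)%N -> j != k.
    by move=> le_j; rewrite gtn_eqF // (leq_trans km).
  have k_mid : (0 < k < m.-1)%N by rewrite k0.
  have n0k : 0%N != k by rewrite ltn_eqF.
  have [nm nm' nm1] : [/\ m != k, m.+1 != k & m.-1 != k].
    by rewrite !nk // ?leqW ?leq_pred.
  have ends x : polarized psi m (upd v k x) (upd v k x 0%N) (upd v k x m)
      (upd v k x m.+1) (upd v k x m.-1) =
      polarized psi m (upd v k x) (v 0%N) (v m) (v m.+1) (v m.-1) by rewrite !other.
  rewrite ends; under [RHS]eq_bigr do rewrite ends.
  apply: (polarized_linearm psi _ _ _ _ k_mid) => [|i j njk].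
    by rewrite same; apply: eq_bigr => i _; rewrite same.
  by rewrite !other.
have n0k : 0%N != k by rewrite ltn_eqF.
have nmid : ~~ (0 < k < m.-1)%N by rewrite k0 ltnNge km.
have samek x j : j = k -> upd v k x j = x by move->.
have ends x : polarized psi m (upd v k x) (upd v k x 0%N) (upd v k x m)
    (upd v k x m.+1) (upd v k x m.-1) =
    polarized psi m v (v 0%N) (upd v k x m) (upd v k x m.+1) (upd v k x m.-1).
  by rewrite ext_end // (other _ 0%N).
rewrite ends; under [RHS]eq_bigr do rewrite ends.
have [km1|nkm1] := eqVneq k m.-1.
  have [nm nm'] : m != k /\ m.+1 != k by rewrite km1 !gtn_eqF // leqW.
  have val x : [/\ upd v k x m = v m, upd v k x m.+1 = v m.+1 & upd v k x m.-1 = x].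
    by split; (exact: other) || (exact: samek).
  have [-> -> ->] := val (\sum_i t i *: z i); rewrite (polarized_linear _ m_gt1).
  by apply: eq_bigr => i _; have [-> -> ->] := val (z i).
have nm1 : m.-1 != k by rewrite eq_sym.
have [eq_km|nkm] := eqVneq k m.
  have nm' : m.+1 != k by rewrite eq_km gtn_eqF.
  have val x : [/\ upd v k x m = x, upd v k x m.+1 = v m.+1 & upd v k x m.-1 = v m.-1].
    by split; (exact: other) || (exact: samek).
  have [-> -> ->] := val (\sum_i t i *: z i); rewrite (polarized_linearl _ m_gt1).
  by apply: eq_bigr => i _; have [-> -> ->] := val (z i).
have eq_k : m.+1 = k.
  apply/esym/eqP; rewrite eqn_leq -ltnS lt_k ltn_neqAle eq_sym nkm /=.
  by rewrite -(prednK (ltnW m_gt1)) ltn_neqAle eq_sym nkm1.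
have nm : m != k by rewrite eq_sym.
have val x : [/\ upd v k x m = v m, upd v k x m.+1 = x & upd v k x m.-1 = v m.-1].
  by split; (exact: other) || (exact: samek).
have [-> -> ->] := val (\sum_i t i *: z i).
rewrite polarizedCr (polarized_linear _ m_gt1).
by apply: eq_bigr => i _; have [-> -> ->] := val (z i); rewrite polarizedCr.
Qed.

Lemma dbracket_form_points : exists2 c, c != 0 & forall u i j,
  dbracket_form (P \o u) (P i) (P j) =
    c * rowdet (upd (P \o u) m (point_relation i j)).
Proof.
have altG := polarized_diag_alternating two_neq0 m_gt1 T_ext TCl TCr T_aa T_cc
  T_left T_right T_repeat T_share T_suml T_sumr T_summ.
have [c cE] := alternating_rowdet P_sum P_base altG.
have diagE v b : diag v b = c * rowdet (upd (P \o v) m (P b)).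
  transitivity (polarized_diag T (upd v m b) (upd v m b m)).
    rewrite {2}/upd eqxx; apply: (polarized_diag_ext m_gt1 T_ext) => k lt_km.
    by rewrite /upd ltn_eqF.
  rewrite cE; congr (_ * _); apply: rowdet_ext => k _.
  by rewrite /upd /=; case: eqP.
(* Otherwise the polarized chain would vanish at the points and, being multilinear, in all
   directions, against [psi_neq0]. *)
have c_neq0 : c != 0.
  apply/eqP => c0; have diag0 v b : polarized_diag T v b = 0.
    by rewrite -/(diag v b) diagE c0 mul0r.
  have T0 := polarized_eq0 two_neq0 m_gt1 T_ext TCl TCr T_aa T_cc
    T_left T_right T_repeat T_share T_sumr diag0.
  have zero0 : multilinear m.+2 n (fun _ : nat -> V => 0 : L).
    by split=> // v k t z _; rewrite big1 // => i _; rewrite mulr0.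
  have all0 := multilinear_eq P_span multilinear_polarized zero0 isT
    (fun u => T0 u _ _ _ _).
  have [u [a [b [c' [d /eqP[]]]]]] := psi_neq0.
  pose v := upd (upd (upd (upd u 0%N a) m.-1 d) m b) m.+1 c'.
  have m1_lt : (m.-1 < m)%N by case: (m) m_gt1.
  have m1_gt0 : (0 < m.-1)%N by case: (m) m_gt1 => [|[]].
  have [v0 vm vm' vm1] : [/\ v 0%N = a, v m = b, v m.+1 = c' & v m.-1 = d].
    by rewrite /v /upd !eqxx (ltn_eqF (leqW m1_lt)) (ltn_eqF m1_lt)
      (ltn_eqF (ltnW m_gt1)) (ltn_eqF m1_gt0) (ltn_eqF (ltnSn m)).
  rewrite -(all0 v) v0 vm vm' vm1; congr chain_coef.
  apply: eq_mxchain => k lt_km; rewrite /polarized_chain.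
  case: eqP => // /eqP k0; case: eqP => // /eqP km /=.
  by rewrite /v /upd (ltn_eqF lt_km) (ltn_eqF (leqW lt_km)) (negPf k0) (negPf km).
(* The factor 2 comes from [rotation_sum]: [polarized_diag] is half a second derivative. *)
exists (2%:R * c) => [|u i j]; first by rewrite mulf_neq0.
have m_gt0 := ltnW m_gt1.
rewrite /dbracket_form (eq_bigr (fun k => polarized_sym T (rotate u k) i j)); last first.
  move=> k _; rewrite /bracket_form dmx2_mxchain //.
  by rewrite /chain_coef mxE mcoeffD.
rewrite (@rotation_sum L m m_gt1 (polarized_sym T) diag).
- by rewrite rowdet_point_relation !diagE; ring.
- by move=> v s t a b lt_st lt_tm eq_v; apply: polarized_sym_repeat lt_st lt_tm eq_v.
- by move=> *; apply: polarized_sym_diag.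
- by move=> *; apply: polarized_sym_neq.
- by move=> v s t b lt_st lt_tm eq_v; apply: polarized_diag_repeat lt_st lt_tm eq_v.
- by move=> *; apply: polarized_diag_mem.
- by move=> *; apply: polarized_diag_sum.
by move=> v k b; rewrite !diagE rowdet_rotate_points.
Qed.

End AtLeastFour.

End PointFormula.

(** * The case of three points *)

Section TrilinearCombinatorics.

Variable L : fieldType.
Hypothesis three_neq0 : 3%:R != 0 :> L.
Variable T : 'I_3 -> 'I_3 -> 'I_3 -> L.
Implicit Types a b c i j v : 'I_3.
Hypothesis TC : forall a b c, T a b c = T b a c.
Hypothesis TCr : forall a b c, T a b c = T a c b.
Hypothesis T_aaa : forall a, T a a a = 0.
Hypothesis T_sum : forall a b, \sum_x T a b x = 0.

Let sum3 (f : 'I_3 -> L) a b c : a != b -> a != c -> b != c ->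
  \sum_x f x = f a + f b + f c.
Proof.
move=> nab nac nbc; rewrite (bigD1 a) //= (bigD1 b) 1?eq_sym //=.
rewrite (bigD1 c) /=; last by rewrite ![c == _]eq_sym nac nbc.
rewrite big1 ?addr0 ?addrA // => x /andP[/andP[nxa nxb] nxc].
have us : uniq [:: a; b; c] by rewrite /= !inE negb_or nab nac nbc.
by have := uniq_full x us erefl; rewrite !inE (negPf nxa) (negPf nxb) (negPf nxc).
Qed.

(** Each of the three sum relations at two distinct indices contains T a b c once; their terms with
    a repeated index cancel against the relations at two equal indices, leaving 3 T a b c = 0. *)
Lemma trilinear_distinct a b c : a != b -> a != c -> b != c -> T a b c = 0.
Proof.
move=> nab nac nbc.
have := T_sum a b; rewrite (sum3 _ nab nac nbc) => E1.
have := T_sum a c; rewrite (sum3 _ nab nac nbc) => E2.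
have := T_sum b c; rewrite (sum3 _ nab nac nbc) => E3.
have := T_sum a a; rewrite (sum3 _ nab nac nbc) T_aaa => E4.
have := T_sum b b; rewrite (sum3 _ nab nac nbc) T_aaa => E5.
have := T_sum c c; rewrite (sum3 _ nab nac nbc) T_aaa => E6.
have E : 3%:R * T a b c = 0.
  have -> : 3%:R * T a b c = (T a b a + T a b b + T a b c) +
      (T a c a + T a c b + T a c c) + (T b c a + T b c b + T b c c)
      - (0 + T a a b + T a a c) - (T b b a + 0 + T b b c) - (T c c a + T c c b + 0).
    rewrite (TCr a b a) (TCr a c a) (TC b c a) (TCr c b a) (TC c a b) (TCr a c b).
    rewrite (TCr b c b) (TCr b b a) (TC b a b) (TCr c c a) (TC c a c).
    rewrite (TCr c c b) (TC c b c).
    ring.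
  by rewrite E1 E2 E3 E4 E5 E6 !subr0 !addr0.
by move/eqP: E; rewrite mulf_eq0 (negPf three_neq0) => /eqP.
Qed.

Lemma trilinear_shift v b : T v b b = - T v v b.
Proof.
have [->|nvb] := eqVneq v b; first by rewrite T_aaa oppr0.
have [c [nvc nbc]] : exists c, v != c /\ b != c.
  (* In Z/3 the three elements add up to zero, so this is the third one. *)
  exists (- (v + b)); clear -nvb; move: v b nvb.
  by case=> [[|[|[|?]]]] // ? [[|[|[|?]]]] //.
have := T_sum v b; rewrite (sum3 _ nvb nvc nbc) (trilinear_distinct nvb nvc nbc).
by rewrite addr0 addrC TCr => /eqP; rewrite addr_eq0 => /eqP.
Qed.

Lemma trilinear_sum_diag v : \sum_b T v b b = 0.
Proof. by under eq_bigr do rewrite trilinear_shift; rewrite sumrN T_sum oppr0. Qed.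

(** For m = 1 the only rotation is trivial, so the formula holds without averaging. *)
Lemma trilinear_formula v i j :
  T v i j = (3 * (i == j))%N%:R * T v i i - T v i i - T v j j.
Proof.
have [<-|nij] := eqVneq i j; first by rewrite muln1; ring.
rewrite muln0 mul0r sub0r; have [->|nvi] := eqVneq v i.
  by rewrite T_aaa oppr0 sub0r trilinear_shift opprK.
have [->|nvj] := eqVneq v j.
  by rewrite T_aaa subr0 trilinear_shift opprK TCr.
rewrite trilinear_distinct //; apply/esym/eqP.
rewrite -opprD oppr_eq0; apply/eqP.
by have := trilinear_sum_diag v; rewrite (sum3 _ nvi nvj nij) T_aaa add0r.
Qed.

Lemma trilinear_eq0 : (forall v b, T v b b = 0) -> forall a b c, T a b c = 0.
Proof. by move=> diag0 a b c; rewrite trilinear_formula !diag0 mulr0 !subr0. Qed.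

End TrilinearCombinatorics.

Section ThreePoints.

Variables (L : fieldType) (rk : nat -> nat).
Hypothesis three_neq0 : 3%:R != 0 :> L.
Variable psi : forall k, 'M[{mpoly L[2]}]_(rk k, rk k.+1).
Variables (i0 : 'I_(rk 0)) (j0 : 'I_(rk 1)).
Variable P : 'I_3 -> 'rV[L]_2.
Hypothesis P_sum : \sum_i P i = 0.
Hypothesis P_base : rowdet (fun k => P (inord k)) != 0.
Hypothesis P_span : forall x, exists t : 'I_3 -> L, x = \sum_i t i *: P i.
Hypothesis P_point : forall i, dmx (P i) (dmx (P i) (dmx (P i) (psi 0))) = 0.

Let F a b c := chain_coef (m := 1) i0 j0 (dmx a (dmx b (dmx c (psi 0)))).
Hypothesis psi_neq0 : exists a b c, F a b c != 0.

Let FC a b c : F a b c = F b a c. Proof. by rewrite /F dmx_comm. Qed.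
Let FCr a b c : F a b c = F a c b. Proof. by rewrite /F (dmx_comm b c). Qed.

Let F_lin t a b : F a b (\sum_i t i *: P i) = \sum_i t i * F a b (P i).
Proof. by rewrite /F dmx_lincomb !dmx_sum chain_coef_lincomb. Qed.

Let T a b c := F (P a) (P b) (P c).

Let T_sum a b : \sum_x T a b x = 0.
Proof.
transitivity (\sum_x 1 * T a b x); first by apply: eq_bigr => x _; rewrite mul1r.
rewrite -F_lin; have -> : \sum_i 1 *: P i = \sum_i 0 *: P i.
  rewrite [RHS]big1 => [|i _]; last by rewrite scale0r.
  by under eq_bigr do rewrite scale1r.
by rewrite F_lin big1 // => x _; rewrite mul0r.
Qed.

Let T_aaa a : T a a a = 0.
Proof. by rewrite /T /F P_point /chain_coef mxE mcoeff0. Qed.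

Lemma dbracket_form_points3 : exists2 c, c != 0 & forall u i j,
  dbracket_form (m := 1) psi i0 j0 (P \o u) (P i) (P j) =
    c * rowdet (upd (P \o u) 1 (point_relation P i j)).
Proof.
have TC a b c : T a b c = T b a c by apply: FC.
have TCr a b c : T a b c = T a c b by apply: FCr.
have altG : point_alternating (fun u : nat -> 'I_3 => T (u 0%N) (u 1%N) (u 1%N)).
  split=> [u u' eq_u|u [|s] [|[|t]] // _ _ ->|u [|[|s]] // _].
  - by rewrite !eq_u.
  - exact: T_aaa.
  - rewrite -[RHS](T_sum (u 1%N) (u 1%N)); apply: eq_bigr => b _.
    by rewrite /upd /= TC TCr.
  exact: trilinear_sum_diag.
have [c cE] := alternating_rowdet P_sum P_base altG.
have diagE (u : nat -> 'I_3) b : T (u 0%N) b b = c * rowdet (upd (P \o u) 1 (P b)).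
  have := cE (upd u 1 b); rewrite {1 2 3}/upd /= => ->; congr (_ * _).
  by apply: rowdet_ext => k _; rewrite /upd /=; case: eqP.
exists c => [|u i j].
  apply/eqP => c0; have T0 := trilinear_eq0 three_neq0 TC TCr T_aaa T_sum.
  have {}T0 a b d : T a b d = 0.
    by apply: T0 => v w; have := diagE (fun=> v) w; rewrite c0 mul0r.
  have [a [b [d /eqP[]]]] := psi_neq0.
  have [t ->] := P_span d; rewrite F_lin big1 // => x _.
  rewrite FC FCr; have [s ->] := P_span a; rewrite F_lin big1 ?mulr0 // => y _.
  rewrite FC FCr; have [r ->] := P_span b; rewrite F_lin big1 ?mulr0 // => z _.
  by rewrite -/(T _ _ _) T0 mulr0.
rewrite rowdet_point_relation /dbracket_form big_nat1 /bracket_form /= mul1mx.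
rewrite modn1 -/(F _ _ _) -/(T _ _ _) !mulrBr mulrCA -!diagE.
rewrite -[T i j _]/(T i j (u 0%N)) TCr TC.
exact: trilinear_formula.
Qed.

End ThreePoints.

(** * Scaling the points *)

Section GeneralPosition.

Variables (L : fieldType) (m : nat) (X : 'I_m.+2 -> 'rV[L]_m.+1).
Hypothesis X_general : general_position X.

Let M := \matrix_i X i.

(** A nonzero kernel vector would be a hyperplane through all the points other than [X i]. *)
Let M'_unit i : row' i M \in unitmx.
Proof.
rewrite unitmxE unitfE -det_tr; apply/det0P => -[v nzv vM].
have [||k] := @X_general [set~ i] _ v^T.
- by rewrite cardsC1 card_ord.
- by rewrite -(inj_eq trmx_inj) trmxK trmx0.
rewrite !inE => nki; case: (unliftP i k) nki => [j ->|->]; last by rewrite eqxx.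
move=> _ /eqP[]; move/(congr1 trmx): vM; rewrite trmx_mul trmxK trmx0.
move/(congr1 (row j)); rewrite row_mul row0 => <-; congr (_ *m _).
by apply/rowP => k'; rewrite !mxE.
Qed.

(* The points satisfy a linear relation, with all its coefficients nonzero; these
   coefficients are the scaling factors. *)
Lemma general_position_scaling : exists P : 'I_m.+2 -> 'rV[L]_m.+1,
  [/\ forall i, exists2 c, c != 0 & P i = c *: X i, \sum_i P i = 0,
      rowdet (fun k => P (inord k)) != 0 &
      forall x, exists t : 'I_m.+2 -> L, x = \sum_i t i *: P i].
Proof.
have [r rM nzr] : exists2 r : 'rV_m.+2, r *m M = 0 & r != 0.
  have /rowV0Pn[r /sub_kermxP rM nzr] : kermx M != 0.
    rewrite -mxrank_eq0 mxrank_ker subn_eq0 -ltnNge ltnS.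
    exact: rank_leq_col.
  by exists r.
have r_neq0 i : r 0 i != 0.
  apply/eqP => ri0; case/eqP: nzr.
  pose r' : 'rV_m.+1 := \row_j r 0 (lift i j).
  have : r' *m row' i M = 0.
    apply/rowP => k; move/rowP/(_ k): rM; rewrite !mxE (bigD1_ord i) //= ri0 mul0r add0r.
    by move=> E; rewrite -[RHS]E; apply: eq_bigr => j _; rewrite !mxE.
  move/(canRL (mulmxK (M'_unit i))); rewrite mul0mx => /rowP r'0.
  apply/rowP => k; rewrite mxE; case: (unliftP i k) => [j ->|-> //].
  by move: (r'0 j); rewrite !mxE.
pose P i := r 0 i *: X i; exists P.
pose A := \matrix_(i < m.+1) P (inord i).
have AE : A = diag_mx (\row_i r 0 (inord i)) *m row' ord_max M.
  apply/matrixP => i j; rewrite mul_diag_mx !mxE /P.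
  have <- : lift ord_max i = inord i :> 'I_m.+2.
    by apply: val_inj; rewrite /= inordK ?(leqW (ltn_ord i)) // /bump leqNgt ltn_ord.
  by [].
have A_unit : A \in unitmx.
  rewrite AE unitmx_mul M'_unit andbT unitmxE det_diag unitfE.
  by apply/prodf_neq0 => i _; rewrite mxE.
split=> [i||  |x].
- by exists (r 0 i).
- apply/rowP => k; move/rowP/(_ k): rM; rewrite !mxE summxE => E.
  by rewrite -[RHS]E; apply: eq_bigr => i _; rewrite !mxE.
- have -> : rowdet (fun k => P (inord k)) = \det A.
    by congr (\det _); apply/matrixP => i j; rewrite !mxE.
  by rewrite -unitfE -unitmxE.
pose y := x *m invmx A.
exists (fun i => if (i < m.+1)%N then y 0 (inord i) else 0).
rewrite big_ord_recr /= ltnn scale0r addr0 -{1}[x](mulmxKV A_unit) -/y mulmx_sum_row.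
apply: eq_bigr => i _; rewrite ltn_ord inord_val rowK; congr (_ *: P _).
by apply: val_inj; rewrite /= inordK // (leqW (ltn_ord i)).
Qed.

End GeneralPosition.

(** * Extension of scalars *)

Section ScalarExtension.

Variables (K L : fieldType) (iota : {rmorphism K -> L}) (N : nat).
Implicit Types (f : {mpoly K[N]}).

Lemma map_mpoly_mderiv i f : map_mpoly iota f^`M(i) = (map_mpoly iota f)^`M(i).
Proof.
apply/mpolyP => m; rewrite mcoeff_map_mpoly !mcoeff_mderiv mcoeff_map_mpoly.
by rewrite raddfMn.
Qed.

Lemma map_mpoly_homog d f : f \is d.-homog -> map_mpoly iota f \is d.-homog.
Proof.
move=> fd; apply/dhomogP => m; rewrite mcoeff_msupp mcoeff_map_mpoly fmorph_eq0.
by rewrite -mcoeff_msupp => /(dhomog_mf fd).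
Qed.

Lemma meval_scale d (f : {mpoly L[N]}) c (v : 'rV[L]_N) : f \is d.-homog ->
  f.@[(c *: v) 0] = c ^+ d * f.@[v 0].
Proof.
move=> fd; rewrite [f]mpolyE !(linear_sum (meval _)) mulr_sumr /=.
rewrite big_seq [RHS]big_seq; apply: eq_bigr => m /(dhomog_mf fd) /= md.
rewrite !mevalZ !mevalX mulrCA; congr (_ * _).
under eq_bigr do rewrite mxE exprMn.
by rewrite big_split prodrXr /= -mdegE md.
Qed.

Lemma map_mx_dmx i r s (A : 'M[{mpoly K[N]}]_(r, s)) :
  map_mx (map_mpoly iota) (dmx (delta_mx 0 i) A) =
    dmx (delta_mx 0 i) (map_mx (map_mpoly iota) A).
Proof. by apply/matrixP => p q; rewrite !mxE !dird_delta map_mpoly_mderiv. Qed.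

Lemma map_mx_homog d r s (A : 'M[{mpoly K[N]}]_(r, s)) :
  homog_mx d A -> homog_mx d (map_mx (map_mpoly iota) A).
Proof. by move=> Ad i j; rewrite mxE map_mpoly_homog. Qed.

End ScalarExtension.

Section ChainMaps.

Lemma map_mxchain (R S : comPzRingType) (f : {rmorphism R -> S}) (rk : nat -> nat)
    (psi : forall k, 'M[R]_(rk k, rk k.+1)) m :
  map_mx f (mxchain psi m) = mxchain (fun k => map_mx f (psi k)) m.
Proof. by elim: m => [|m IH] /=; rewrite ?map_mx1 // map_mxM IH. Qed.

Lemma homog_mxchain (L : fieldType) N (rk : nat -> nat)
    (psi : forall k, 'M[{mpoly L[N]}]_(rk k, rk k.+1)) m :
  (forall k, (k < m)%N -> homog_mx 0 (psi k)) -> homog_mx 0 (mxchain psi m).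
Proof.
elim: m => [_ i j|m IH psi0] /=; last first.
  by apply: (@homog_mxM _ _ 0 0); [apply: IH => k lt_km; apply/psi0/ltnW | apply: psi0].
by rewrite mxE -mpolyC_nat homogC.
Qed.

End ChainMaps.

Definition first_index n : 'I_(betti n 0) := cast_ord (esym (erefl (betti n 0))) 0.

Lemma first_index_unique n (i : 'I_(betti n 0)) : i = first_index n.
Proof. exact: (etrans (ord1 (i : 'I_1)) (esym (ord1 (first_index n : 'I_1)))). Qed.

Definition last_index n : 'I_(betti n n.-2) := cast_ord (esym (betti_last n)) 0.

(** * The forms Omega at the points *)

Section OmegaPoints.

Variables (K L : fieldType) (charK : [pchar K] =i pred0).
Variables (iota : {rmorphism K -> L}) (m : nat).
Hypothesis m_gt0 : (0 < m)%N.
Local Notation n := m.+2.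
Variable X : 'I_n -> 'rV[L]_n.-1.
Variable phi : forall k, 'M[{mpoly K[n.-1]}]_(betti n k, betti n k.+1).
Hypothesis phi_res : minimal_graded_free_resolution (vanishing_ideal iota X)
  (fun k (_ : 'I_(betti n k)) => shift n k) phi.

Let phi_exact := mgfr_exact phi_res.
Let phi_minimal := mgfr_minimal phi_res.
Local Notation psi := (fun k => map_mx (map_mpoly iota) (phi k)).
Local Notation e := (fun i : 'I_m.+1 => delta_mx 0 i : 'rV[L]_m.+1).
Local Notation eK := (fun i : 'I_m.+1 => delta_mx 0 i : 'rV[K]_m.+1).
Local Notation i0 := (first_index n).
Local Notation j0 := (last_index n : 'I_(betti n m)).

Let psi_complex k : psi k *m psi k.+1 = 0.
Proof. by rewrite -map_mxM (exact_complex phi_exact) map_mx0. Qed.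

Lemma phi_homog k d : (shift n k + d = shift n k.+1)%N -> homog_mx d (phi k).
Proof.
move=> dE i j; have := mgfr_graded phi_res i j.
by rewrite -dE leq_addr addKn.
Qed.

Let natL_neq0 q : (q.+1%:R : L) != 0.
Proof. by rewrite -(rmorph_nat iota) fmorph_eq0 ((pcharf0P _).1 charK). Qed.

Lemma ideal_first r : vanishing_ideal iota X (phi 0 i0 r).
Proof.
apply/(mgfr_coker phi_res); exists (delta_mx r 0).
by apply/matrixP => i j; rewrite -colE !mxE (first_index_unique i).
Qed.

Lemma first_vanish d r (c : L) i : homog_mx d (phi 0) ->
  (psi 0 i0 r).@[(c *: X i) 0] = 0.
Proof.
move=> phid; rewrite (meval_scale c (X i) (map_mx_homog iota phid i0 r)).
have := ideal_first r d i; rewrite /eval_at pihomog_dE; last exact: phid.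
by rewrite mxE => ->; rewrite mulr0.
Qed.

Lemma map_bracket (a : 'I_m -> 'I_m.+1) (v : nat -> 'rV[L]_m.+1) :
    (forall i : 'I_m, v i = e (a i)) ->
  map_mpoly iota (bracket phi a) = mxchain (fun k => dmx (v k) (psi k)) m i0 j0.
Proof.
move=> vE; rewrite /bracket castmxE /=.
set psi' := (X in mxchain X m _ _).
transitivity (map_mx (map_mpoly iota) (mxchain psi' m) i0 j0); first by rewrite mxE.
rewrite map_mxchain; congr ((_ : 'M__) _ _); apply: eq_mxchain => k lt_km.
rewrite /psi' insubT /= -[k in v k]/(nat_of_ord (Ordinal lt_km)) vE; apply/matrixP => r s.
by rewrite !mxE dird_delta map_mpoly_mderiv.
Qed.

Lemma map_Omega_coef (k a b : 'I_m.+1) (v : nat -> 'rV[L]_m.+1) :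
    (forall i : 'I_m, v i = e (lift k i)) ->
  iota (Omega_coef phi k a b) =
    (-1) ^+ k.+1 * dbracket_form psi i0 j0 v (e a) (e b).
Proof.
move=> vE; rewrite /Omega_coef /Omega.
have -> : (-1) ^+ k.+1 = ((-1) ^+ k.+1)%:MP :> {mpoly K[m.+1]}.
  by rewrite rmorphXn rmorphN rmorph1.
rewrite mul_mpolyC !mderivZ mcoeffZ rmorphM rmorphXn rmorphN1; congr (_ * _).
rewrite -mcoeff_map_mpoly !map_mpoly_mderiv /dbracket.
rewrite (raddf_sum (map_mpoly iota)) (linear_sum (mderiv b)) (linear_sum (mderiv a)).
rewrite (raddf_sum (mcoeff _)) /=.
apply: eq_bigr => r _; rewrite /bracket_form /chain_coef !mxE !dird_delta.
congr (_^`M(_)^`M(_)@__); apply: map_bracket => i /=.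
by rewrite -val_iter_ordS vE.
Qed.

Lemma dbracket_form_sum v (x y : 'rV[L]_m.+1) :
  \sum_a \sum_b x 0 a * y 0 b * dbracket_form psi i0 j0 v (e a) (e b) =
    dbracket_form psi i0 j0 v x y.
Proof.
have brE (w : nat -> 'rV[L]_m.+1) : bracket_form psi i0 j0 w x y =
    \sum_a \sum_b x 0 a * y 0 b * bracket_form psi i0 j0 w (e a) (e b).
  rewrite /bracket_form {1}(row_sum_delta x) dmx_lincomb chain_coef_lincomb.
  apply: eq_bigr => a _; rewrite {1}(row_sum_delta y) dmx_lincomb dmx_sum.
  rewrite chain_coef_lincomb mulr_sumr; apply: eq_bigr => b _.
  by rewrite mulrA.
rewrite /dbracket_form [RHS](eq_bigr _ (fun k _ => brE _)) [RHS]exchange_big /=.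
apply: eq_bigr => a _; rewrite [RHS]exchange_big /=; apply: eq_bigr => b _.
by rewrite mulr_sumr.
Qed.

Section Scaled.

Variable P : 'I_n -> 'rV[L]_m.+1.
Hypothesis P_scaled : forall i, exists2 c, c != 0 & P i = c *: X i.
Hypothesis P_sum : \sum_i P i = 0.
Hypothesis P_base : rowdet (fun k => P (inord k)) != 0.
Hypothesis P_span : forall x, exists t : 'I_n -> L, x = \sum_i t i *: P i.

Let first_vanishP d r i : homog_mx d (phi 0) -> (psi 0 i0 r).@[(P i) 0] = 0.
Proof. by move=> phid; have [c _ ->] := P_scaled i; apply: first_vanish phid. Qed.

Let chain_coef_map (A : 'M[{mpoly K[m.+1]}]_(betti n 0, betti n m)) :
  chain_coef i0 j0 (map_mx (map_mpoly iota) A) = iota (A i0 j0)@_0%MM.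
Proof. by rewrite /chain_coef mxE mcoeff_map_mpoly. Qed.

Lemma points_large : (1 < m)%N -> exists2 c, c != 0 & forall u i j,
  dbracket_form psi i0 j0 (P \o u) (P i) (P j) =
    c * rowdet (upd (P \o u) m (point_relation P i j)).
Proof.
move=> m_gt1; have [l def_m] : exists l, m = l.+2 by exists m.-2; case: (m) m_gt1 => [|[]].
have first : homog_mx 2 (phi 0).
  by apply: phi_homog; rewrite /shift /= def_m.
have middle k : (0 < k < m.-1)%N -> homog_mx 1 (phi k).
  case/andP=> k0 km; apply: phi_homog; rewrite /shift /= gtn_eqF //.
  have lt_km : (k.+1 < m)%N by rewrite def_m ltnS in km *.
  by rewrite (ltn_eqF lt_km) (ltn_eqF (ltnW lt_km)) addn1.
have last k : k = l.+1 -> homog_mx 2 (phi k).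
  by move=> ->; apply: phi_homog; rewrite /shift def_m /= eqxx (ltn_eqF (ltnSn _)) addn2.
have m1l : m.-1 = l.+1 by rewrite def_m.
have last_vanish k r s i : k = l.+1 -> (psi k r s).@[(P i) 0] = 0.
  move=> eq_k; subst k; have [|||S phiS] := last_in_ideal phi_exact phi_minimal _ _ _
      first (last _ erefl) i0 s.
  - by [].
  (* The index is n - 1: the first binomial vanishes and the second is 1, so the truncated
     difference is 0. *)
  - by rewrite /betti def_m /= (gtn_eqF (ltnSn _)) bin_small // binn muln0.
  (* The symmetry b_1 = b_(n-3) of the ranks. *)
  - have E1 : 'C(l.+2, l.+1) = 'C(l.+2, 1) by rewrite -(@bin_sub l.+2 1) // subn1.
    have E2 : 'C(l.+4, l.+2) = 'C(l.+4, 2) by rewrite -(@bin_sub l.+4 2) // subn2.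
    by rewrite /betti def_m /= (ltn_eqF (ltnSn _)) E1 E2.
  rewrite mxE phiS (raddf_sum (map_mpoly iota)) (linear_sum (meval _)) big1 // => r' _ /=.
  rewrite map_mpolyZ mevalZ; have := first_vanishP r' i first.
  by rewrite mxE => ->; rewrite mulr0.
apply: dbracket_form_points => //.
- by move=> k km; apply/homog_affine_mx/map_mx_homog/middle.
- exact/homog_quadratic_mx/map_mx_homog.
- exact/homog_quadratic_mx/map_mx_homog/last.
- move=> i; split; apply/matrixP => r s; rewrite !mxE.
    apply: dird2_vanish; first exact: map_mpoly_homog.
    by have := first_vanishP s i first; rewrite mxE -(first_index_unique r).
  apply: dird2_vanish; first exact/map_mpoly_homog/last.
  by have := last_vanish _ r s i m1l; rewrite mxE.
(* Stated for a variable q because the type of the index [j0] depends on m, which cannot be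
   rewritten there directly. *)
have neq0 q : q = l.+2 -> forall j : 'I_(betti n q), exists a b c d u,
    (polarized phi q (eK \o u) (eK a) (eK b) (eK c) (eK d) *m delta_mx j 0 : 'cV_1)
      != 0.
  move=> -> j; apply: (polarized_neq0 charK phi_exact phi_minimal) => //.
    by move=> k; rewrite -m1l; apply: middle.
  exact: last.
have [a [b [c [d [u nz]]]]] := neq0 _ def_m j0.
exists (e \o u), (e a), (e b), (e c), (e d).
have -> : polarized psi m (e \o u) (e a) (e b) (e c) (e d) =
    map_mx (map_mpoly iota) (polarized phi m (eK \o u) (eK a) (eK b) (eK c) (eK d)).
  rewrite map_mxchain; apply: eq_mxchain => k _; rewrite /polarized_chain.
  by case: (k == 0%N); [|case: (k == m.-1)]; rewrite /= !map_mx_dmx.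
rewrite chain_coef_map fmorph_eq0; apply: contraNneq nz => coef0.
apply/eqP/matrixP => i j; rewrite -colE !mxE (first_index_unique i).
have pol0 : homog_mx 0 (polarized phi m (eK \o u) (eK a) (eK b) (eK c) (eK d)).
  apply: homog_mxchain => k lt_km; rewrite /polarized_chain.
  case: eqP => [->|/eqP k0]; first exact: (homog_dmx _ (homog_dmx _ first)).
  case: eqP => [->|/eqP km]; first exact: (homog_dmx _ (homog_dmx _ (last _ m1l))).
  apply: (homog_dmx (d := 1) _ (middle _ _)).
  by rewrite lt0n k0 ltn_neqAle km -ltnS prednK.
by rewrite (homog0P (pol0 i0 j0)) coef0.
Qed.

(** The coefficients of Omega_k are values at the standard basis without its k-th vector. Both sides
    of the hypothesis are multilinear in the chain directions, so it extends from the points to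
    these vectors, where the determinant is a coordinate up to sign. *)
Lemma Omega_coef_points_of c :
    (forall u i j, dbracket_form psi i0 j0 (P \o u) (P i) (P j) =
       c * rowdet (upd (P \o u) m (point_relation P i j))) ->
  forall i j k, \sum_a \sum_b P i 0 a * P j 0 b * iota (Omega_coef phi k a b) =
    (-1) ^+ m.+1 * c * point_relation P i j 0 k.
Proof.
move=> cE i j k.
pose v s : 'rV[L]_m.+1 := if insub s is Some t then e (lift k (t : 'I_m)) else 0.
have vE (s : 'I_m) : v s = e (lift k s) by rewrite /v valK.
under eq_bigr do under eq_bigr do rewrite (map_Omega_coef _ _ vE) mulrCA.
under eq_bigr do rewrite -mulr_sumr.
rewrite -mulr_sumr dbracket_form_sum.
rewrite (multilinear_eq P_span (multilinear_dbracket_form psi i0 j0 _ _ _ m_gt0)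
  (multilinearZ c (multilinear_rowdet _ (point_relation P i j)))) //.
have sgn : (-1) ^+ k.+1 * (-1) ^+ (m + k) = (-1) ^+ m.+1 :> L.
  rewrite -exprD -signr_odd -[RHS]signr_odd !oddD /=.
  by case: (odd k); case: (odd m).
by rewrite (rowdet_basis _ vE) -sgn -!mulrA; congr (_ * _); rewrite mulrCA.
Qed.

End Scaled.

End OmegaPoints.

Section OmegaThreePoints.

Variables (K L : fieldType) (charK : [pchar K] =i pred0).
Variables (iota : {rmorphism K -> L}).
Variable X : 'I_3 -> 'rV[L]_2.
Variable phi : forall k, 'M[{mpoly K[2]}]_(betti 3 k, betti 3 k.+1).
Hypothesis phi_res : minimal_graded_free_resolution (vanishing_ideal iota X)
  (fun k (_ : 'I_(betti 3 k)) => shift 3 k) phi.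
Variable P : 'I_3 -> 'rV[L]_2.
Hypothesis P_scaled : forall i, exists2 c, c != 0 & P i = c *: X i.
Hypothesis P_sum : \sum_i P i = 0.
Hypothesis P_base : rowdet (fun k => P (inord k)) != 0.
Hypothesis P_span : forall x, exists t : 'I_3 -> L, x = \sum_i t i *: P i.

Lemma points_three : exists2 c, c != 0 & forall u i j,
  dbracket_form (m := 1) (fun k => map_mx (map_mpoly iota) (phi k))
      (first_index 3) (last_index 3) (P \o u) (P i) (P j) =
    c * rowdet (upd (P \o u) 1 (point_relation P i j)).
Proof.
have first : homog_mx 3 (phi 0) by apply: (phi_homog (m := 1) phi_res).
apply: dbracket_form_points3 => //.
- by rewrite -(rmorph_nat iota) fmorph_eq0 ((pcharf0P _).1 charK).
- move=> i; apply/matrixP => r s; rewrite !mxE.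
  apply: dird3_vanish; first exact: map_mpoly_homog.
  have [c _ ->] := P_scaled i.
  by have := first_vanish (m := 1) phi_res s c i first; rewrite mxE (first_index_unique r).
pose e (i : 'I_2) : 'rV[K]_2 := delta_mx 0 i.
pose D : 'cV[{mpoly K[2]}]_(betti 3 1) := delta_mx (last_index 3) 0.
have D0 : homog_mx 0 D by move=> i j; rewrite mxE -mpolyC_nat homogC.
have homD : homog_mx 3 (phi 0 *m D) by exact: homog_mxM first D0.
have nz d (A : 'cV[{mpoly K[2]}]_(betti 3 0)) : (0 < d)%N -> homog_mx d A -> A != 0 ->
    exists a, dmx (e a) A != 0.
  move=> d_gt0 Ad nzA; apply/existsP; rewrite -negb_forall.
  apply: contraNN nzA => /forallP dA; apply/eqP/(homog_dmx_eq0 charK d_gt0 Ad) => i.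
  exact/eqP.
have nz0 : phi 0 *m D != 0.
  apply: contraTneq isT.
  move=> /(minimal_free (mgfr_exact phi_res) (mgfr_minimal phi_res) D0).
  move=> /matrixP/(_ (last_index 3) 0).
  by rewrite !mxE !eqxx => /eqP; rewrite oner_eq0.
have [c nzc] := nz 3%N _ isT homD nz0.
have [b nzb] := nz 2%N _ isT (homog_dmx (e c) homD) nzc.
have [a nza] := nz 1%N _ isT (homog_dmx (e b) (homog_dmx (e c) homD)) nzb.
have A0 := homog_dmx (e a) (homog_dmx (e b) (homog_dmx (e c) first)).
have dD u r (A : 'M_(r, _)) : dmx u (A *m D) = dmx u A *m D.
  by rewrite dmxM (homog_mx0 _ D0) mulmx0 addr0.
exists (delta_mx 0 a), (delta_mx 0 b), (delta_mx 0 c); rewrite -!map_mx_dmx /chain_coef.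
rewrite mxE mcoeff_map_mpoly fmorph_eq0; apply: contraNneq nza => coef0.
rewrite !dD; apply/eqP/matrixP => i j; rewrite -colE mxE [i]first_index_unique.
by rewrite (homog0P (A0 _ _)) coef0 [RHS]mxE.
Qed.

End OmegaThreePoints.

Lemma Omega_coef_points (K L : fieldType) (iota : {rmorphism K -> L}) (m : nat)
    (X : 'I_m.+2 -> 'rV[L]_m.+2.-1)
    (phi : forall k, 'M[{mpoly K[m.+2.-1]}]_(betti m.+2 k, betti m.+2 k.+1))
    (P : 'I_m.+2 -> 'rV[L]_m.+1) :
    [pchar K] =i pred0 -> (0 < m)%N ->
    minimal_graded_free_resolution (vanishing_ideal iota X)
      (fun k (_ : 'I_(betti m.+2 k)) => shift m.+2 k) phi ->
    (forall i, exists2 c, c != 0 & P i = c *: X i) -> \sum_i P i = 0 ->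
    rowdet (fun k => P (inord k)) != 0 ->
    (forall x, exists t : 'I_m.+2 -> L, x = \sum_i t i *: P i) ->
  exists2 c, c != 0 & forall i j k,
    \sum_a \sum_b P i 0 a * P j 0 b * iota (Omega_coef (n := m.+2) phi k a b) =
      c * point_relation P i j 0 k.
Proof.
move=> charK m_gt0 phi_res P_scaled P_sum P_base P_span.
have [c nzc cE] : exists2 c, c != 0 & forall u i j,
    dbracket_form (fun k => map_mx (map_mpoly iota) (phi k))
        (first_index m.+2) (last_index m.+2) (P \o u) (P i) (P j) =
      c * rowdet (upd (P \o u) m (point_relation P i j)).
  case: m m_gt0 X phi P phi_res P_scaled P_sum P_base P_span => [|[|m]] // _ X phi P
    phi_res P_scaled P_sum P_base P_span.
    exact: (points_three charK phi_res).
  exact: (points_large (m := m.+2) charK isT phi_res).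
exists ((-1) ^+ m.+1 * c); first by rewrite mulf_neq0 ?signr_eq0.
exact: (Omega_coef_points_of m_gt0 P_span cE).
Qed.

(** * The algebra of the points *)

Section StructureConstants.

Variables (K L : fieldType) (iota : {rmorphism K -> L}) (m : nat).
Hypothesis charK : [pchar K] =i pred0.
Local Notation n := m.+2.
Variable P : 'I_n -> 'rV[L]_m.+1.
Hypothesis P_sum : \sum_i P i = 0.
Hypothesis P_base : rowdet (fun k => P (inord k)) != 0.
Hypothesis P_span : forall x, exists t : 'I_n -> L, x = \sum_i t i *: P i.
Variable Om : 'I_m.+1 -> 'I_m.+1 -> 'I_m.+1 -> K.
Variable c : L.
Hypothesis c_neq0 : c != 0.
Hypothesis OmP : forall i j k,
  \sum_a \sum_b P i 0 a * P j 0 b * iota (Om k a b) = c * point_relation P i j 0 k.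

Let natL_neq0 q : (q.+1%:R : L) != 0.
Proof. by rewrite -(rmorph_nat iota) fmorph_eq0 ((pcharf0P _).1 charK). Qed.

Let n_neq0 : (n%:R : L) != 0 := natL_neq0 _.
Let c' := n%:R * c.
Let c'_neq0 : c' != 0. Proof. by rewrite mulf_neq0. Qed.

Let Pm : 'M[L]_(n, m.+1) := \matrix_i P i.
(* The projection onto the vectors of sum zero. *)
Let avg : 'M[L]_n := const_mx n%:R^-1.
Let proj : 'M[L]_n := 1%:M - avg.

Let left_inverse : exists T : 'M[L]_(m.+1, n), T *m Pm = 1%:M.
Proof.
have [t tE] := fin_all_exists (fun a : 'I_m.+1 => P_span (delta_mx 0 a)).
exists (\matrix_(a, i) t a i); apply/row_matrixP => a.
rewrite row_mul row1 tE mulmx_sum_row; apply: eq_bigr => i _.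
by rewrite rowK !mxE.
Qed.

(** \sum_i P_i = 0 is the only relation up to scalars: subtracting a multiple of it removes the last
    vector, and the others are independent. *)
Let relation_const (r : 'rV[L]_n) : r *m Pm = 0 -> forall i j, r 0 i = r 0 j.
Proof.
move=> rP; pose A := \matrix_(i < m.+1) P (inord i).
have A_unit : A \in unitmx.
  rewrite unitmxE unitfE; have -> // : \det A = rowdet (fun k => P (inord k)).
  by congr (\det _); apply/matrixP => i j; rewrite !mxE.
suff E i : r 0 i = r 0 ord_max by move=> i j; rewrite E [RHS]E.
pose y : 'rV[L]_m.+1 := \row_(i < m.+1) (r 0 (inord i) - r 0 ord_max).
have inordE (k : 'I_m.+1) : inord k = widen_ord (leqnSn _) k :> 'I_n.
  by apply: val_inj; rewrite /= inordK // ltnW // ltnS.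
have : y *m A = 0.
  have : r *m Pm - r 0 ord_max *: \sum_i P i = 0 by rewrite rP P_sum scaler0 subr0.
  rewrite !mulmx_sum_row scaler_sumr -sumrB big_ord_recr /= rowK subrr addr0 => E.
  by rewrite -[RHS]E; apply: eq_bigr => k _; rewrite !rowK !mxE inordE scalerBl.
move/(canRL (mulmxK A_unit)); rewrite mul0mx => /rowP y0.
have [lt_im|] := ltnP i m.+1.
  move: (y0 (Ordinal lt_im)); rewrite !mxE inordE => /eqP; rewrite subr_eq0 => /eqP <-.
  by congr (r 0 _); apply: val_inj.
by move=> ge_im; congr (r 0 _); apply/val_inj/eqP; rewrite eqn_leq ge_im -ltnS ltn_ord.
Qed.

Let avg_P : avg *m Pm = 0.
Proof.
apply/row_matrixP => i; rewrite row_mul row0 mulmx_sum_row.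
rewrite (eq_bigr (fun k => n%:R^-1 *: P k)) -?scaler_sumr ?P_sum ?scaler0 // => k _.
by rewrite rowK !mxE.
Qed.

Let proj_P : proj *m Pm = Pm.
Proof. by rewrite mulmxBl avg_P mul1mx subr0. Qed.

Let avg_proj : avg *m proj = 0.
Proof.
rewrite mulmxBr mulmx1; apply/eqP; rewrite subr_eq0; apply/eqP/matrixP => i j.
rewrite !mxE (eq_bigr (fun=> n%:R^-1 * n%:R^-1)) => [|k _]; last by rewrite !mxE.
by rewrite sumr_const card_ord -[RHS]mulr_natr -mulrA mulVf // mulr1.
Qed.

(** The rows of [Al] will be the values of the alpha_i at the points: a left inverse of [Pm],
    projected to the vectors of sum zero and scaled by c' = n c. With this scale the structure
    constants are exactly [Om]; n comes from [point_relation] and c from [OmP]. *)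
Lemma exists_sum_zero_basis : exists Al : 'M[L]_(m.+1, n),
  [/\ Pm *m Al = c' *: proj, Al *m Pm = c'%:M & forall i, \sum_p Al i p = 0].
Proof.
have [T TP] := left_inverse; exists (c' *: (T *m proj)); split.
- rewrite -scalemxAr mulmxA; congr (_ *: _).
  have -> : Pm *m T = 1%:M + (Pm *m T - 1%:M) by rewrite addrC subrK.
  rewrite mulmxDl mul1mx; set D := Pm *m T - 1%:M.
  have DP : D *m Pm = 0 by rewrite mulmxBl mul1mx -mulmxA TP mulmx1 subrr.
  clearbody D; suff -> : D *m proj = 0 by rewrite addr0.
  have Dc i j : D i j = D i 0.
    have := @relation_const (row i D); rewrite -row_mul DP row0 => /(_ erefl j 0).
    by rewrite !mxE.
  have -> : D = diag_mx (\row_i (D i 0 * n%:R)) *m avg.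
    by apply/matrixP => i j; rewrite mul_diag_mx !mxE Dc mulfK.
  by rewrite -mulmxA avg_proj mulmx0.
- by rewrite -scalemxAl -mulmxA proj_P TP scale_scalar_mx mulr1.
move=> i; rewrite (eq_bigr (fun p => c' * (T *m proj) i p)) => [|p _]; last by rewrite mxE.
rewrite -mulr_sumr [X in _ * X](_ : _ = 0) ?mulr0 //.
under eq_bigr do rewrite mxE.
rewrite exchange_big big1 // => k _; rewrite -mulr_sumr [X in _ * X](_ : _ = 0) ?mulr0 //.
under eq_bigr do rewrite !mxE.
rewrite sumrB sumr_const card_ord -[X in _ - X]mulr_natr mulVf //.
by rewrite (bigD1 k) //= eqxx big1 ?addr0 ?subrr // => p; rewrite eq_sym => /negPf ->.
Qed.

Section SumZeroBasis.

Variable Al : 'M[L]_(m.+1, n).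
Hypothesis P_Al : Pm *m Al = c' *: proj.
Hypothesis Al_P : Al *m Pm = c'%:M.
Hypothesis Al_sum : forall i, \sum_p Al i p = 0.

Let P_AlE q p : \sum_k P q 0 k * Al k p = c' * ((q == p)%:R - n%:R^-1).
Proof.
have := congr1 (fun M : 'M_n => M q p) P_Al; rewrite /proj /avg !mxE => <-.
by apply: eq_bigr => k _; rewrite !mxE.
Qed.

Let Al_PE i k : \sum_q Al i q * P q 0 k = c' * (i == k)%:R.
Proof.
have := congr1 (fun M : 'M_m.+1 => M i k) Al_P; rewrite !mxE mulr_natr => <-.
by apply: eq_bigr => q _; rewrite !mxE.
Qed.

(** Duality expresses c'^2 Om through its values at pairs of points; in [point_relation] the two
    subtracted terms disappear because the rows of [Al] have sum zero. *)
Lemma Om_sum_zero_basis k i j :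
  c' * iota (Om k i j) = \sum_q Al i q * Al j q * P q 0 k.
Proof.
apply: (mulfI c'_neq0).
have E : \sum_q \sum_r Al i q * Al j r *
    (\sum_a \sum_b P q 0 a * P r 0 b * iota (Om k a b)) = c' * (c' * iota (Om k i j)).
  transitivity (\sum_a \sum_b
      (\sum_q Al i q * P q 0 a) * (\sum_r Al j r * P r 0 b) * iota (Om k a b)).
    rewrite (eq_bigr (fun q => \sum_a \sum_b \sum_r
        Al i q * P q 0 a * (Al j r * P r 0 b) * iota (Om k a b))); last first.
      move=> q _; rewrite (eq_bigr (fun r => \sum_a \sum_b
          Al i q * P q 0 a * (Al j r * P r 0 b) * iota (Om k a b))).
        by rewrite exchange_big; apply: eq_bigr => a _; rewrite exchange_big.
      move=> r _; rewrite mulr_sumr; apply: eq_bigr => a _; rewrite mulr_sumr.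
      by apply: eq_bigr => b _; ring.
    rewrite exchange_big; apply: eq_bigr => a _; rewrite exchange_big.
    apply: eq_bigr => b _; rewrite mulr_suml mulr_suml; apply: eq_bigr => q _.
    by rewrite mulr_sumr mulr_suml.
  under eq_bigr do under eq_bigr do rewrite !Al_PE.
  rewrite (bigD1 i) //= [X in _ + X]big1 => [|a na]; last first.
    by apply: big1 => b _; rewrite eq_sym (negPf na) !(mulr0, mul0r).
  rewrite (bigD1 j) //= [X in _ + X + _]big1 => [|b nb]; last first.
    by rewrite (eq_sym j) (negPf nb) !(mulr0, mul0r).
  by rewrite !eqxx !mulr1 !addr0 mulrA.
rewrite -E {E}; under eq_bigr do under eq_bigr do rewrite OmP.
have rel q : \sum_r Al i q * Al j r * (c * point_relation P q r 0 k) =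
    c' * (Al i q * Al j q * P q 0 k) - c * (Al i q * \sum_r Al j r * P r 0 k).
  rewrite (eq_bigr (fun r => c * (Al i q * P q 0 k) * (n%:R * (Al j r * (q == r)%:R) - Al j r)
      - c * Al i q * (Al j r * P r 0 k))); last first.
    by move=> r _; rewrite !mxE natrM; ring.
  rewrite sumrB -!mulr_sumr sumrB Al_sum subr0 -mulr_sumr.
  rewrite (bigD1 q) //= eqxx big1 ?addr0 => [|r nr]; last first.
    by rewrite eq_sym (negPf nr) mulr0.
  by rewrite mulr1 /c'; ring.
rewrite (eq_bigr _ (fun q _ => rel q)) sumrB -!mulr_sumr -mulr_suml Al_sum.
by rewrite mul0r mulr0 subr0.
Qed.

Let pairing i j : L := \sum_q Al i q * Al j q.

(** Minus its mean over the points, the product has sum zero, and [P_Al] expands it in the rows of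
    [Al]. *)
Lemma sum_zero_basis_mul i j p :
  Al i p * Al j p = n%:R^-1 * pairing i j + \sum_l iota (Om l i j) * Al l p.
Proof.
apply: (mulfI c'_neq0); rewrite mulrDr [X in _ = _ + X]mulr_sumr.
have -> : \sum_l c' * (iota (Om l i j) * Al l p) =
    \sum_q Al i q * Al j q * (c' * ((q == p)%:R - n%:R^-1)).
  rewrite (eq_bigr (fun l => \sum_q Al i q * Al j q * (P q 0 l * Al l p))); last first.
    move=> l _; rewrite mulrA Om_sum_zero_basis mulr_suml.
    by apply: eq_bigr => q _; ring.
  rewrite exchange_big; apply: eq_bigr => q _.
  by rewrite -mulr_sumr P_AlE.
rewrite (eq_bigr (fun q => c' * (Al i q * Al j q * (q == p)%:R)
    - c' * n%:R^-1 * (Al i q * Al j q))); last by move=> q _; ring.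
rewrite sumrB -!mulr_sumr -/(pairing i j) (bigD1 p) //= eqxx big1 ?addr0 => [|q nq]; last first.
  by rewrite (negPf nq) mulr0.
by rewrite mulr1; ring.
Qed.

(** The trace of the product of two operators: multiplication by alpha_i, respectively alpha_j, on
    the span of the alpha_l, followed by the projection along the constants. *)
Definition trace_form i j : K := \sum_k \sum_l Om k l i * Om l k j.

(* Hence the constants n^-1 * pairing i j of sum_zero_basis_mul lie in K. *)
Lemma trace_formE i j : iota (trace_form i j) = m%:R * (n%:R^-1 * pairing i j).
Proof.
apply: (mulfI c'_neq0); apply: (mulfI c'_neq0).
transitivity (\sum_k \sum_l (c' * iota (Om k l i)) * (c' * iota (Om l k j))).
  rewrite rmorph_sum mulrA mulr_sumr; apply: eq_bigr => k _.
  rewrite rmorph_sum mulr_sumr; apply: eq_bigr => l _.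
  by rewrite rmorphM; ring.
under eq_bigr do under eq_bigr do rewrite !Om_sum_zero_basis.
transitivity (\sum_q \sum_r Al i q * Al j r *
    ((\sum_k P q 0 k * Al k r) * (\sum_l P r 0 l * Al l q))).
  rewrite (eq_bigr (fun k => \sum_q \sum_r \sum_l
      Al i q * Al j r * (P q 0 k * Al k r * (P r 0 l * Al l q)))); last first.
    move=> k _; rewrite (eq_bigr (fun l => \sum_q \sum_r
        Al i q * Al j r * (P q 0 k * Al k r * (P r 0 l * Al l q)))).
      by rewrite exchange_big; apply: eq_bigr => q _; rewrite exchange_big.
    move=> l _; rewrite mulr_suml; apply: eq_bigr => q _; rewrite mulr_sumr.
    by apply: eq_bigr => r _; ring.
  rewrite exchange_big; apply: eq_bigr => q _; rewrite exchange_big.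
  apply: eq_bigr => r _; rewrite mulr_suml mulr_sumr; apply: eq_bigr => k _.
  by rewrite mulr_sumr mulr_sumr.
(* The square of the entry [q = r] - 1/n of [proj] is [q = r] (1 - 2/n) + 1/n^2, and the last term
   is lost because the rows of [Al] have sum zero. *)
have rel q : \sum_r Al i q * Al j r *
    ((\sum_k P q 0 k * Al k r) * (\sum_l P r 0 l * Al l q)) =
    c' * c' * (1 - 2%:R * n%:R^-1) * (Al i q * Al j q).
  rewrite (eq_bigr (fun r => c' * c' * Al i q *
     ((1 - 2%:R * n%:R^-1) * (Al j r * (q == r)%:R) + n%:R^-1 ^+ 2 * Al j r))); last first.
    move=> r _; rewrite !P_AlE (eq_sym r); by case: (q == r); rewrite ?(mulr1n, mulr0n); ring.
  rewrite -mulr_sumr big_split /= -!mulr_sumr Al_sum mulr0 addr0.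
  rewrite (bigD1 q) //= eqxx big1 ?addr0 => [|r nr]; last first.
    by rewrite eq_sym (negPf nr) mulr0.
  by rewrite mulr1; ring.
rewrite (eq_bigr _ (fun q _ => rel q)) -mulr_sumr -/(pairing i j).
have -> : 1 - 2%:R * n%:R^-1 = m%:R * n%:R^-1 :> L.
  apply: (mulIf n_neq0); rewrite mulfVK // mulrBl mulfVK // mul1r.
  by rewrite -natrB // subSS subSS subn0.
by ring.
Qed.

End SumZeroBasis.

End StructureConstants.

(** * The algebra as matrices over K *)

Section AlgebraOfPoints.

Variables (K L : fieldType) (iota : {rmorphism K -> L}) (m : nat).
Hypothesis charK : [pchar K] =i pred0.
Local Notation n := m.+2.
Variable Q : 'I_n -> 'rV[L]_m.+1.
Variable Al : 'M[L]_(m.+1, n).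
Variable kap : 'I_m.+1 -> 'I_m.+1 -> K.
Variable Om : 'I_m.+1 -> 'I_m.+1 -> 'I_m.+1 -> K.
Hypothesis Al_mul : forall i j p,
  Al i p * Al j p = iota (kap i j) + \sum_l iota (Om l i j) * Al l p.
Hypothesis Al_sum : forall i, \sum_p Al i p = 0.
Hypothesis Q_Al : forall p q, \sum_k Q p 0 k * Al k q = (p == q)%:R - n%:R^-1.
Hypothesis Al_Q : forall i k, \sum_q Al i q * Q q 0 k = (i == k)%:R.

Let natL_neq0 q : (q.+1%:R : L) != 0.
Proof. by rewrite -(rmorph_nat iota) fmorph_eq0 ((pcharf0P _).1 charK). Qed.

(* The values at the points of the basis 1, alpha_1, ..., alpha_(n-1). *)
Let E : 'M[L]_n := \matrix_(a, p) if unlift ord0 a is Some i then Al i p else 1.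

Let E0 p : E ord0 p = 1. Proof. by rewrite mxE unlift_none. Qed.
Let ES i p : E (lift ord0 i) p = Al i p. Proof. by rewrite mxE liftK. Qed.

Let E_unit : E \in unitmx.
Proof.
pose F : 'M[L]_n := \matrix_(p, a) if unlift ord0 a is Some i then Q p 0 i else n%:R^-1.
suff /mulmx1_unit[] : F *m E = 1%:M by [].
apply/matrixP => p q; rewrite !mxE big_ord_recl.
rewrite E0 mxE unlift_none mulr1 (eq_bigr (fun k => Q p 0 k * Al k q)).
  by rewrite Q_Al addrC subrK.
by move=> k _; rewrite ES mxE liftK.
Qed.

(* Multiplication by the a-th basis element, in that basis. *)
Let B (a : 'I_n) : 'M[K]_n :=
  if unlift ord0 a is Some i then
    \matrix_(b, d) if unlift ord0 b is Some j then
                     if unlift ord0 d is Some l then Om l j i else kap j i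
                   else (d == a)%:R
  else 1%:M.

Let B_E a : map_mx iota (B a) *m E = E *m diag_mx (row a E).
Proof.
case: (unliftP ord0 a) => [i ->|->].
  apply/matrixP => b p; rewrite mul_mx_diag !mxE /B liftK.
  case: (unliftP ord0 b) => [j ->|->].
    rewrite big_ord_recl E0 !mxE !liftK unlift_none mulr1 Al_mul; congr (_ + _).
    by apply: eq_bigr => l _; rewrite ES !mxE !liftK.
  rewrite (bigD1 (lift ord0 i)) //= big1 => [|d nd]; last first.
    by rewrite !mxE unlift_none (negPf nd) rmorph0 mul0r.
  by rewrite !mxE !liftK unlift_none eqxx rmorph1 !mul1r addr0.
rewrite /B unlift_none map_mx1 mul1mx; have -> : row ord0 E = const_mx 1.
  by apply/rowP => p; rewrite mxE E0 mxE.
by rewrite diag_const_mx mulmx1.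
Qed.

Let row0_B a : row ord0 (B a) = delta_mx 0 a.
Proof.
apply/rowP => d; rewrite mxE [RHS]mxE /=; case: (unliftP ord0 a) => [i ->|->].
  by rewrite /B liftK mxE unlift_none.
by rewrite /B unlift_none mxE eq_sym.
Qed.

(** The first row of the matrix of a multiplication is the image of 1, hence the element itself in
    coordinates; [E] turns these into values. *)
Definition point_values (M : 'M[K]_n) : 'rV[L]_n := row ord0 (map_mx iota M) *m E.

(** The columns of [E], that is the evaluations at the points, are eigenvectors of M, and the
    eigenvalues are the values of M. *)
Let good M := map_mx iota M *m E = E *m diag_mx (point_values M).

Let valuesD M M' : point_values (M + M') = point_values M + point_values M'.
Proof. by rewrite /point_values map_mxD linearD mulmxDl. Qed.

Let valuesZ a M : point_values (a *: M) = iota a *: point_values M.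
Proof. by rewrite /point_values map_mxZ linearZ -scalemxAl. Qed.

Let values_B a : point_values (B a) = row a E.
Proof.
rewrite /point_values -row_mul B_E; apply/rowP => p.
by rewrite mxE mul_mx_diag !mxE unlift_none mul1r.
Qed.

Let good_sum (I : Type) (r : seq I) (F : I -> 'M[K]_n) (t : I -> K) :
  (forall i, good (F i)) -> good (\sum_(i <- r) t i *: F i).
Proof.
move=> goodF; elim/big_rec: _ => [|i M _ goodM].
  by rewrite /good map_mx0 mul0mx /point_values map_mx0 row0 mul0mx linear0 mulmx0.
rewrite /good map_mxD mulmxDl goodM valuesD linearD mulmxDr; congr (_ + _).
by rewrite map_mxZ -scalemxAl goodF valuesZ linearZ scalemxAr.
Qed.

Let good_B a : good (B a).
Proof. by rewrite /good B_E values_B. Qed.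

Let good_inj M M' : good M -> good M' -> point_values M = point_values M' -> M = M'.
Proof.
move=> gM gM' eq_v; have : map_mx iota M *m E = map_mx iota M' *m E.
  by rewrite gM gM' eq_v.
by move/(can_inj (mulmxK E_unit))/map_mx_inj.
Qed.

Let values_expand M : point_values M = \sum_a iota (M ord0 a) *: row a E.
Proof.
by rewrite /point_values mulmx_sum_row; apply: eq_bigr => a _; rewrite !mxE.
Qed.

Let good_expand M : good M -> M = \sum_a M ord0 a *: B a.
Proof.
move=> gM; apply: good_inj => //; first exact: good_sum.
rewrite values_expand; elim/big_rec2: _ => [|a N v _ ->].
  by rewrite /point_values map_mx0 row0 mul0mx.
by rewrite valuesD valuesZ values_B.
Qed.

Let U : {vspace 'M[K]_n} := <<codom B>>%VS.

(** [good] is visibly stable under products, so the span is a subalgebra of the matrices over K and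
    associativity is inherited. *)
Let mem_U M : M \in U <-> good M.
Proof.
split=> [|gM]; last first.
  rewrite (good_expand gM) rpred_sum // => a _; apply/rpredZ/memv_span/codom_f.
move/(coord_span (X := codom_tuple B)) => ->; apply: good_sum => i.
have /codomP[a ->] : (codom_tuple B)`_i \in codom B by rewrite mem_nth ?size_tuple.
exact: good_B.
Qed.

Let values1 : point_values 1 = const_mx 1.
Proof.
have <- : B ord0 = 1 by rewrite /B unlift_none.
by rewrite values_B; apply/rowP => p; rewrite mxE E0 mxE.
Qed.

Let good1 : good 1.
Proof. by have := good_B ord0; rewrite /B unlift_none. Qed.

Let valuesM M M' : good M -> good M' ->
  point_values (M *m M') = \row_p (point_values M 0 p * point_values M' 0 p).
Proof.
move=> gM gM'; rewrite /point_values -row_mul map_mxM -mulmxA gM' mulmxA gM.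
by apply/rowP => p; rewrite mxE !mul_mx_diag !mxE unlift_none mul1r.
Qed.

Let goodM M M' : good M -> good M' -> good (M *m M').
Proof.
move=> gM gM'; rewrite /good valuesM // map_mxM -mulmxA gM' mulmxA gM -mulmxA.
congr (_ *m _); apply/matrixP => p q; rewrite mul_diag_mx !mxE.
by have [->|] := eqVneq p q; rewrite ?mulr1n ?mulr0n ?mulr0.
Qed.

Let U_aspace : is_aspace U.
Proof.
have U1 : 1 \in U := (mem_U 1).2 good1.
rewrite /is_aspace has_algid1 //=.
by apply/prodvP => M M' /mem_U gM /mem_U gM'; apply/(mem_U (M *m M')).2/goodM.
Qed.

Definition points_aspace : {aspace 'M[K]_n} := ASpace U_aspace.
Definition points_algebra : falgType K := subvs_of points_aspace.

Definition values (a : points_algebra) (p : 'I_n) : L := point_values (vsval a) 0 p.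

Definition points_basis (i : 'I_m.+1) : points_algebra :=
  Subvs (memv_span (codom_f B (lift ord0 i)) : B (lift ord0 i) \in points_aspace).

Let vsvalM (a b : points_algebra) : vsval (a * b) = vsval a *m vsval b.
Proof. by []. Qed.

Let vsval1 : vsval (1 : points_algebra) = 1.
Proof. by apply/eqP; rewrite [_ == _]algid_eq1; apply/mem_U/good1. Qed.

Let good_val (a : points_algebra) : good (vsval a).
Proof. exact/mem_U/subvsP. Qed.

Lemma values_1 p : values 1 p = 1.
Proof. by rewrite /values vsval1 values1 mxE. Qed.

Lemma values_D a b p : values (a + b) p = values a p + values b p.
Proof. by rewrite /values linearD valuesD mxE. Qed.

Lemma values_Z t a p : values (t *: a) p = iota t * values a p.
Proof. by rewrite /values linearZ valuesZ mxE. Qed.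

Lemma values_M a b p : values (a * b) p = values a p * values b p.
Proof. by rewrite /values vsvalM valuesM // mxE. Qed.

Lemma values_sum (I : Type) (r : seq I) (t : I -> K) (a : I -> points_algebra) p :
  values (\sum_(i <- r) t i *: a i) p = \sum_(i <- r) iota (t i) * values (a i) p.
Proof.
elim/big_rec2: _ => [|i y1 y2 _ <-]; last by rewrite values_D values_Z.
by rewrite -(scale0r 1) values_Z rmorph0 mul0r.
Qed.

Lemma values_inj a b : values a =1 values b -> a = b.
Proof.
move=> eq_v; apply: subvs_inj; apply: good_inj => //; apply/rowP => p.
exact: eq_v.
Qed.

Lemma values_basis i p : values (points_basis i) p = Al i p.
Proof. by rewrite /values values_B mxE ES. Qed.

Lemma points_algebraC : commutative (@GRing.mul points_algebra).
Proof. by move=> a b; apply: values_inj => p; rewrite !values_M mulrC. Qed.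

Lemma points_basis_mul i j :
  points_basis i * points_basis j =
    (kap i j)%:A + \sum_k Om k i j *: points_basis k.
Proof.
apply: values_inj => p; rewrite values_M !values_basis Al_mul values_D values_Z.
by rewrite values_1 mulr1 values_sum; under [in RHS]eq_bigr do rewrite values_basis.
Qed.

Definition scalar_part (a : points_algebra) : K := vsval a ord0 ord0.

Lemma points_basis_expand a : a = scalar_part a *: 1 +
  \sum_i vsval a ord0 (lift ord0 i) *: points_basis i.
Proof.
apply: values_inj => p; rewrite values_D values_Z values_1 mulr1 values_sum.
rewrite {1}/values values_expand summxE big_ord_recl !mxE unlift_none mulr1.
congr (_ + _); apply: eq_bigr => i _.
by rewrite values_basis !mxE liftK.
Qed.

Lemma sum_values a : \sum_p values a p = n%:R * iota (scalar_part a).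
Proof.
rewrite {1}[a]points_basis_expand; under eq_bigr do rewrite values_D values_Z values_1 values_sum.
rewrite big_split /= sumr_const card_ord mulr1 mulr_natl exchange_big /=.
rewrite big1 ?addr0 // => i _; rewrite -mulr_sumr.
by under eq_bigr do rewrite values_basis; rewrite Al_sum mulr0.
Qed.

Let span_basis : (fullv <= <<1%R :: codom points_basis>>)%VS.
Proof.
apply/subvP => a _; rewrite [a]points_basis_expand.
apply: rpredD; first by rewrite rpredZ // memv_span ?mem_head.
apply: rpred_sum => i _; rewrite rpredZ // memv_span // inE codom_f orbT //.
Qed.

Let dim_ge : (n <= \dim {:points_algebra})%N.
Proof.
rewrite dimvf -[dim _]/(\dim U).
have dimU : \dim (linfun (row ord0) @: U) = n.
  have -> : (linfun (row ord0) @: U)%VS = fullv.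
    apply/eqP; rewrite eqEsubv subvf; apply/subvP => v _.
    have -> : v = linfun (row ord0) (\sum_a v 0 a *: B a).
      rewrite lfunE linear_sum {1}[v]row_sum_delta; apply: eq_bigr => a _.
      by rewrite linearZ /= row0_B.
    by rewrite memv_img // rpred_sum // => a _; rewrite rpredZ // memv_span // codom_f.
  by rewrite dimvf /dim /= mul1n.
by rewrite -[X in (X <= _)%N]dimU -(limg_ker_dim (linfun (row ord0)) U) leq_addl.
Qed.

Lemma points_basis_of : basis_of {:points_algebra} (1 :: codom points_basis).
Proof. by rewrite basisEdim span_basis /= size_codom card_ord. Qed.

Lemma dim_points_algebra : \dim {:points_algebra} = n.
Proof.
apply/eqP; rewrite eqn_leq dim_ge andbT; apply: leq_trans (dimvS span_basis) _.
by apply: leq_trans (dim_span _) _; rewrite /= size_codom card_ord.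
Qed.

(** Over L the values at the points diagonalise the multiplication by a. *)
Lemma trace_values a : iota (alg_trace a) = \sum_p values a p.
Proof.
pose b := vbasis {:points_algebra}; have b_basis := vbasisP {:points_algebra}.
pose M := passmx.mxof b b (amull a).
pose V := \matrix_(r < \dim {:points_algebra}, p < n) values b`_r p.
have vecE (x : points_algebra) p : values x p = \sum_s iota (passmx.rVof b x 0 s) * V s p.
  rewrite -{1}(passmx.rVofK b_basis x) /passmx.vecof values_sum.
  by apply: eq_bigr => s _; rewrite [V s p]mxE.
have MV : map_mx iota M *m V = V *m diag_mx (\row_p values a p).
  apply/matrixP => r p.
  have -> : (V *m diag_mx (\row_p values a p)) r p = values a p * values b`_r p.
    by rewrite mul_mx_diag !mxE mulrC.
  rewrite -values_M vecE mxE.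
  apply: eq_bigr => s _; rewrite mxE; congr (iota _ * _).
  have := congr1 (fun v : 'rV_ _ => v 0 s) (passmx.mul_mxof b b (amull a) (delta_mx 0 r)).
  by rewrite -rowE mxE passmx.vecof_delta lfunE.
pose elt d : points_algebra := Subvs (memv_span (codom_f B d) : B d \in points_aspace).
(* S expresses the basis behind [E] in terms of [vbasis]; since S V = [E] is invertible, so is V. *)
pose S : 'M[K]_(n, _) := \matrix_(d < n) passmx.rVof b (elt d).
have SV : map_mx iota S *m V = E.
  apply/matrixP => d p; have := vecE (elt d) p; rewrite {1}/values values_B mxE => ->.
  by rewrite mxE; apply: eq_bigr => s _; rewrite !mxE.
pose W := invmx E *m map_mx iota S.
have WV : W *m V = 1%:M by rewrite -mulmxA SV mulVmx.
have freeV : row_free V.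
  have /eqP rkV : row_full V by apply/row_fullP; exists W.
  by rewrite /row_free rkV dim_points_algebra.
have VW : V *m W = 1%:M.
  by apply: (row_free_inj freeV); rewrite -mulmxA WV mulmx1 mul1mx.
rewrite /alg_trace -/M -trace_map_mx -[map_mx _ _]mulmx1 -VW mulmxA MV.
rewrite mxtrace_mulC mulmxA WV mul1mx mxtrace_diag.
by apply: eq_bigr => p _; rewrite mxE.
Qed.

Lemma span_points_basis a : a \in <<codom points_basis>>%VS <-> alg_trace a = 0.
Proof.
split=> [|tr0].
  move/(coord_span (X := codom_tuple points_basis)) => ->.
  apply: (fmorph_inj iota); rewrite rmorph0 trace_values.
  under eq_bigr do rewrite values_sum; rewrite exchange_big big1 //= => i _.
  rewrite -mulr_sumr.
  have /codomP[k ->] : (codom_tuple points_basis)`_i \in codom points_basis.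
    by rewrite mem_nth ?size_tuple.
  by under eq_bigr do rewrite values_basis; rewrite Al_sum mulr0.
have : n%:R * iota (scalar_part a) == 0.
  by rewrite -sum_values -trace_values tr0 rmorph0.
rewrite mulf_eq0 (negPf (natL_neq0 _)) fmorph_eq0 => /eqP a0.
rewrite [a]points_basis_expand a0 scale0r add0r rpred_sum // => i _.
by rewrite rpredZ // memv_span // codom_f.
Qed.

(** The Gram matrix G = Al Al^T has its entries n kap in K, and it maps the coordinate functions of
    the Q_p to the alpha_i. Its inverse writes these coordinates as combinations of the alpha_i over
    K. *)
Lemma coordinates_in_algebra : exists beta : 'I_m.+1 -> points_algebra,
  forall k p, values (beta k) p = Q p 0 k.
Proof.
pose G := \matrix_(i, j) (n%:R * kap i j).
have GE i j : iota (G i j) = \sum_q Al i q * Al j q.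
  under eq_bigr do rewrite Al_mul; rewrite big_split /= sumr_const card_ord.
  rewrite exchange_big big1 ?addr0 => [|l _]; last by rewrite -mulr_sumr Al_sum mulr0.
  by rewrite mxE rmorphM rmorph_nat mulr_natl.
pose Qt : 'M[L]_(m.+1, n) := \matrix_(k, p) Q p 0 k.
have GQ : map_mx iota G *m Qt = Al.
  apply/matrixP => i p; rewrite mxE.
  rewrite (eq_bigr (fun j => \sum_q Al i q * (Q p 0 j * Al j q))); last first.
    move=> j _; rewrite mxE [Qt j p]mxE GE mulr_suml; apply: eq_bigr => q _.
    by rewrite -mulrA [Q p 0 j * _]mulrC.
  rewrite exchange_big (eq_bigr (fun q => Al i q * (p == q)%:R - n%:R^-1 * Al i q)).
    rewrite sumrB -mulr_sumr Al_sum mulr0 subr0 (bigD1 p) //= eqxx mulr1.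
    by rewrite big1 ?addr0 // => q; rewrite eq_sym => /negPf->; rewrite mulr0.
  by move=> q _; rewrite -mulr_sumr Q_Al mulrBr [_ * n%:R^-1]mulrC.
have G_unit : G \in unitmx.
  rewrite -(map_unitmx iota); have [] // := @mulmx1_unit _ _ (map_mx iota G) (Qt *m Qt^T).
  rewrite mulmxA GQ; apply/matrixP => i k; rewrite !mxE -Al_Q.
  by apply: eq_bigr => q _; rewrite !mxE.
exists (fun k => \sum_j invmx G k j *: points_basis j) => k p.
rewrite values_sum; have -> : Q p 0 k = Qt k p by rewrite mxE.
rewrite -[Qt](mulKmx (_ : map_mx iota G \in unitmx)) ?map_unitmx // GQ -map_invmx mxE.
by apply: eq_bigr => j _; rewrite values_basis mxE.
Qed.

Let sum_zero_pair p q r : \sum_k Q r 0 k * (Al k p - Al k q) = (r == p)%:R - (r == q)%:R.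
Proof.
under eq_bigr do rewrite mulrBr; rewrite sumrB !Q_Al opprB addrA.
by rewrite subrK.
Qed.

(* The points impose independent conditions on quadrics: e_p is a product of
   two vectors e_p - e_q and e_p - e_s of sum zero, q and s being other points. *)
Lemma quadric_values_span (y : 'I_n -> L) : (0 < m)%N ->
  (forall i j, \sum_r y r * (Q r 0 i * Q r 0 j) = 0) -> forall p, y p = 0.
Proof.
move=> m_gt0 y0 p; have [q [s [npq nps nqs]]] : exists q s : 'I_n,
    [/\ p != q, p != s & q != s].
  have [q npq] : exists q, q \notin [:: p].
    apply/existsP; rewrite -negb_forall; apply/negP => /forallP all_p.
    have := subset_leq_card (introT subsetP (fun x (_ : x \in predT) => all_p x)).
    by rewrite cardT size_enum_ord (card_uniqP _).
  have [s nps] : exists s, s \notin [:: p; q].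
    apply/existsP; rewrite -negb_forall; apply/negP => /forallP all_p.
    have := subset_leq_card (introT subsetP (fun x (_ : x \in predT) => all_p x)).
    rewrite cardT size_enum_ord => /leq_trans/(_ (card_size _)) /=.
    by rewrite !ltnS leqNgt m_gt0.
  exists q, s; move: npq nps; rewrite !inE !negb_or => npq /andP[nps nqs].
  by rewrite eq_sym npq eq_sym nps eq_sym nqs.
transitivity (\sum_r y r * ((\sum_i Q r 0 i * (Al i p - Al i q)) *
    (\sum_j Q r 0 j * (Al j p - Al j s)))).
  rewrite (bigD1 p) //= [X in _ + X]big1 => [|r nrp]; last first.
    rewrite !sum_zero_pair (negPf nrp) sub0r; have [->|] := eqVneq r q.
      by rewrite (negPf nqs) subr0 mulr0 mulr0.
    by rewrite oppr0 mul0r mulr0.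
  by rewrite !sum_zero_pair eqxx (negPf npq) (negPf nps) !subr0 !mulr1 addr0.
transitivity (\sum_i \sum_j (Al i p - Al i q) * (Al j p - Al j s) *
    (\sum_r y r * (Q r 0 i * Q r 0 j))).
  rewrite (eq_bigr (fun r => \sum_i \sum_j (Al i p - Al i q) * (Al j p - Al j s) *
      (y r * (Q r 0 i * Q r 0 j)))).
    rewrite exchange_big; apply: eq_bigr => i _; rewrite exchange_big.
    by apply: eq_bigr => j _; rewrite mulr_sumr.
  move=> r _; rewrite mulr_suml mulr_sumr; apply: eq_bigr => i _.
  by rewrite mulr_sumr mulr_sumr; apply: eq_bigr => j _; ring.
by apply: big1 => i _; apply: big1 => j _; rewrite y0 mulr0.
Qed.

(** By [quadric_values_span] the products of two coordinates span L^n over L. They lie in the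
    algebra over K, and the rank of a matrix over K does not change under [iota], so they span the
    algebra over K. *)
Lemma quadrics_in_algebra (a : points_algebra) : (0 < m)%N ->
  exists t : 'I_m.+1 * 'I_m.+1 -> K, forall p,
    values a p = \sum_ij iota (t ij) * (Q p 0 ij.1 * Q p 0 ij.2).
Proof.
move=> m_gt0; have [beta betaE] := coordinates_in_algebra.
pose I := ('I_m.+1 * 'I_m.+1)%type; pose prod (ij : I) := beta ij.1 * beta ij.2.
pose W := \matrix_(r < #|{: I}|) row ord0 (vsval (prod (enum_val r))).
have valuesW r p : (map_mx iota W *m E) r p = Q p 0 (enum_val r).1 * Q p 0 (enum_val r).2.
  rewrite -!betaE -values_M /values /point_values !mxE; apply: eq_bigr => d _.
  by rewrite !mxE.
have freeW : row_free (map_mx iota W *m E)^T.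
  apply: inj_row_free => y yW; apply/rowP => p; rewrite [RHS]mxE.
  apply: (quadric_values_span m_gt0) => i j.
  have := congr1 (fun v : 'rV_ _ => v 0 (enum_rank (i, j))) yW.
  rewrite /= !mxE => E0'; rewrite -[RHS]E0'; apply: eq_bigr => r _.
  by rewrite [_^T _ _]mxE valuesW enum_rankK.
have /row_fullP[S SW] : row_full W.
  rewrite /row_full -(mxrank_map iota) -(mxrankMfree _ (_ : row_free E)) ?row_free_unit //.
  by rewrite -mxrank_tr.
pose x := row ord0 (vsval a) *m S.
exists (fun ij => x 0 (enum_rank ij)) => p.
have -> : values a p = (map_mx iota x *m (map_mx iota W *m E)) 0 p.
  by rewrite mulmxA -map_mxM -mulmxA SW mulmx1 /values /point_values map_row.
rewrite mxE (reindex (@enum_val _ {: I})) /=; last exact/onW_bij/enum_val_bij.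
by apply: eq_bigr => r _; rewrite valuesW enum_valK mxE.
Qed.

End AlgebraOfPoints.

(** * Regular functions *)

Section RegularFunctions.

Variables (K L : fieldType) (iota : {rmorphism K -> L}) (N n : nat).
Hypothesis charK : [pchar K] =i pred0.
Variables (A : falgType K) (Phi : A -> 'I_n -> L).
Hypothesis Phi1 : forall p, Phi 1 p = 1.
Hypothesis PhiD : forall a b p, Phi (a + b) p = Phi a p + Phi b p.
Hypothesis PhiM : forall a b p, Phi (a * b) p = Phi a p * Phi b p.
Hypothesis PhiZ : forall t a p, Phi (t *: a) p = iota t * Phi a p.
Hypothesis Phi_inj : forall a b, Phi a =1 Phi b -> a = b.
Variables (X Q : 'I_n -> 'rV[L]_N).
Hypothesis X_scaled : forall p, exists2 c, c != 0 & X p = c *: Q p.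
Hypothesis X_neq0 : forall p, X p != 0.
Hypothesis Q_in : exists beta : 'I_N -> A, forall k p, Phi (beta k) p = Q p 0 k.
Hypothesis Q_quadrics : forall a, exists t : 'I_N * 'I_N -> K, forall p,
  Phi a p = \sum_ij iota (t ij) * (Q p 0 ij.1 * Q p 0 ij.2).

Let Phi0 p : Phi 0 p = 0.
Proof. by rewrite -(scale0r 1) PhiZ rmorph0 mul0r. Qed.

Let Phi_sum (t : 'I_n -> K) (a : 'I_n -> A) p :
  Phi (\sum_i t i *: a i) p = \sum_i iota (t i) * Phi (a i) p.
Proof.
rewrite (big_morph (fun a => Phi a p) (fun a b => PhiD a b p) (Phi0 p)).
by apply: eq_bigr => i _; rewrite PhiZ.
Qed.

Lemma monomial_in_algebra (e : 'X_{1..N}) :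
  exists a, forall p, Phi a p = \prod_(i < N) Q p 0 i ^+ e i.
Proof.
have [beta betaE] := Q_in; exists (\prod_i beta i ^+ e i) => p.
have PhiX a k : Phi (a ^+ k) p = Phi a p ^+ k.
  by elim: k => [|k IH]; rewrite ?Phi1 // !exprS PhiM IH.
rewrite (big_morph (fun a => Phi a p) (fun a b => PhiM a b p) (Phi1 p)).
by apply: eq_bigr => i _; rewrite PhiX betaE.
Qed.

Lemma eval_in_algebra (f : {mpoly K[N]}) :
  exists a, forall p, Phi a p = eval_at iota f (Q p).
Proof.
elim/mpolyind: f => [|c e f _ _ [a aE]].
  by exists 0 => p; rewrite Phi0 /eval_at raddf0 meval0.
have [b bE] := monomial_in_algebra e; exists (c *: b + a) => p.
rewrite PhiD PhiZ aE bE /eval_at (raddfD (map_mpoly iota)) /= map_mpolyZ map_mpolyX.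
by rewrite mevalD mevalZ mevalX.
Qed.

Lemma eval_scaled d (f : {mpoly K[N]}) p c : f \is d.-homog -> X p = c *: Q p ->
  eval_at iota f (X p) = c ^+ d * eval_at iota f (Q p).
Proof. by move=> fd ->; rewrite /eval_at (meval_scale _ _ (map_mpoly_homog iota fd)). Qed.

(** Where x_k does not vanish, a = (a x_k^2) / x_k^2, and the numerator, as an element of the
    algebra, is a quadratic form over K. The scaling of the points cancels, both degrees being 2. *)
Lemma algebra_regular a : regular_function iota X (Phi a).
Proof.
move=> i; have /rV0Pn[k Xik] := X_neq0 i; have [beta betaE] := Q_in.
have [t tE] := Q_quadrics (a * (beta k * beta k)).
pose g : {mpoly K[N]} := \sum_ij t ij *: ('X_ij.1 * 'X_ij.2).
have homX (r s : 'I_N) : ('X_r * 'X_s : {mpoly K[N]}) \is 2.-homog.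
  by rewrite -[2%N]/(1 + 1)%N dhomogM // dhomogX /= ?mdeg1. 
have evX (r s : 'I_N) (v : 'rV[L]_N) : eval_at iota ('X_r * 'X_s) v = v 0 r * v 0 s.
  by rewrite /eval_at rmorphM /= !map_mpolyX mevalM !mevalXU.
exists 2%N, g, ('X_k * 'X_k); split=> [||  |j].
- by apply: rpred_sum => ij _; exact/rpredZ/homX.
- exact: homX.
- by rewrite evX mulf_neq0.
have [c nzc XQ] := X_scaled j.
have gh : g \is 2.-homog by apply: rpred_sum => ij _; exact/rpredZ/homX.
have gE : eval_at iota g (Q j) = Phi a j * (Q j 0 k * Q j 0 k).
  rewrite -!betaE -!PhiM tE /eval_at (raddf_sum (map_mpoly iota)) (raddf_sum (meval (Q j 0))).
  apply: eq_bigr => ij _ /=; rewrite map_mpolyZ mevalZ; congr (_ * _); exact: evX.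
rewrite (eval_scaled gh XQ) (eval_scaled (homX k k) XQ) gE evX.
rewrite mulf_eq0 negb_or => /andP[nzc2 nzQ].
by rewrite mulrCA mulfK // mulf_neq0.
Qed.

Let generic_nat (q : {poly L}) : q != 0 -> exists k : nat, q.[k%:R] != 0.
Proof.
move=> nzq; pose s : seq L := [seq k%:R | k <- seq.iota 0 (size q)].
have us : uniq s.
  rewrite map_inj_uniq ?iota_uniq //.
  have nat_inj i j : (i <= j)%N -> i%:R = j%:R :> L -> i = j.
    move=> le_ij /eqP; rewrite eq_sym -subr_eq0 -natrB // -(rmorph_nat iota) fmorph_eq0.
    rewrite ((pcharf0P _).1 charK) subn_eq0 => le_ji.
    by apply/eqP; rewrite eqn_leq le_ij.
  by move=> i j E; case/orP: (leq_total i j) => /nat_inj; [apply | move=> <-].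
have := max_poly_roots nzq _ us; rewrite size_map size_iota ltnn.
have [/allP all_roots /(_ isT) //|] := boolP (all (root q) s).
by case/allPn=> _ /mapP[k _ ->] nr _; exists k.
Qed.

(** Multiplication by b is injective, hence surjective by finite dimension, so the inverse stays in
    the algebra. *)
Lemma algebra_invert b : (forall p, Phi b p != 0) ->
  exists b', forall p, Phi b' p = (Phi b p)^-1.
Proof.
move=> nzb; have ker0 : lker (amull b) == 0%VS.
  apply/lker0P => x y; rewrite !lfunE /= => eq_b; apply: Phi_inj => p.
  by have := congr1 (fun z => Phi z p) eq_b; rewrite !PhiM => /(mulfI (nzb p)).
have /memv_imgP[b' _ bE] : 1 \in limg (amull b) by rewrite lker0_limgf ?memvf.
exists b' => p; apply: (mulfI (nzb p)); rewrite divff // -PhiM.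
by move: bE; rewrite lfunE /= => <-; rewrite Phi1.
Qed.

(* If s = g_i / h_i near the i-th point then s h_i^2 = g_i h_i at all the points;
   some K-combination of the h_i^2 vanishes nowhere. *)
Lemma regular_in_algebra s : regular_function iota X s ->
  exists a, Phi a =1 s.
Proof.
move=> reg; have local i : exists GH : A * A, Phi GH.2 i != 0 /\
    forall p, s p * (Phi GH.2 p * Phi GH.2 p) = Phi GH.1 p * Phi GH.2 p.
  have [d [g [h [gd hd nzh sE]]]] := reg i.
  have [G GE] := eval_in_algebra g; have [H HE] := eval_in_algebra h.
  exists (G, H); split=> [|p] /=.
    have [c _ XQ] := X_scaled i; rewrite HE.
    by move: nzh; rewrite (eval_scaled hd XQ) mulf_eq0 negb_or => /andP[].
  have [H0|nzH] := eqVneq (Phi H p) 0; first by rewrite H0 !mulr0.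
  have [c nzc XQ] := X_scaled p.
  have nzcd : c ^+ d != 0 by rewrite expf_neq0.
  have := sE p; rewrite (eval_scaled gd XQ) (eval_scaled hd XQ) -GE -HE.
  rewrite mulf_neq0 // => /(_ isT) ->.
  by rewrite -mulf_div divff // mul1r mulrA divfK.
have [GH GHP] := fin_all_exists local.
pose G i := (GH i).1; pose H i := (GH i).2.
(* Weights k^i turn the choice of a combination into the choice of a natural number k that is no
   root of the polynomials [q p]. *)
pose w k (i : 'I_n) : K := k%:R ^+ i.
pose q p : {poly L} := \sum_i (Phi (H i) p * Phi (H i) p) *: 'X^i.
have qE p (k : nat) : (q p).[k%:R] = Phi (\sum_i w k i *: (H i * H i)) p.
  rewrite horner_sum (Phi_sum (w k) (fun i => H i * H i)); apply: eq_bigr => i _.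
  by rewrite hornerZ hornerXn PhiM rmorphXn rmorph_nat mulrC.
(* The coefficient of [q p] at index p is the square of h_p at the p-th point, which is nonzero. *)
have nzq : \prod_p q p != 0.
  apply/prodf_neq0 => p _; apply/eqP => q0.
  have := congr1 (fun f : {poly L} => f`_p) q0.
  rewrite coef0 coef_sum (bigD1 p) //= big1 => [|i nip]; last first.
    by rewrite coefZ coefXn eq_sym (inj_eq val_inj) (negPf nip) mulr0.
  rewrite coefZ coefXn eqxx mulr1 addr0 => /eqP.
  by rewrite mulf_eq0 orbb; apply/negP; case: (GHP p).
have [k] := generic_nat nzq; rewrite horner_prod => /prodf_neq0 nzk.
have [p|b' b'E] := @algebra_invert (\sum_i w k i *: (H i * H i)).
  by rewrite -qE nzk.
exists ((\sum_i w k i *: (G i * H i)) * b') => p.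
rewrite PhiM b'E (Phi_sum (w k) (fun i => G i * H i)).
apply: (canLR (mulfK _)); first by rewrite -qE nzk.
rewrite (Phi_sum (w k) (fun i => H i * H i)) mulr_sumr; apply: eq_bigr => i _.
by rewrite !PhiM [RHS]mulrCA; have [_ ->] := GHP i.
Qed.

End RegularFunctions.

Theorem theorem2p8 (K : fieldType) (charK : [pchar K] =i pred0)
    (Kbar : closedFieldType) (iota : {rmorphism K -> Kbar})
    (Kbar_alg : forall z : Kbar, algebraicOver iota z)
    (n : nat) (n_ge3 : (3 <= n)%N)
    (X : 'I_n -> 'rV[Kbar]_n.-1)
    (X_distinct : distinct_points X)
    (X_over_K : defined_over iota X)
    (X_general : general_position X)
    (phi : forall k, 'M[{mpoly K[n.-1]}]_(betti n k, betti n k.+1))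
    (phi_res : minimal_graded_free_resolution (vanishing_ideal iota X)
                 (fun k (_ : 'I_(betti n k)) => shift n k) phi) :
  exists (A : falgType K) (alpha : 'I_n.-1 -> A),
    [/\ commutative (@GRing.mul A),
        \dim {:A} = n /\ basis_of {:A} (1 :: codom alpha),
        forall i j, exists c : K,
          alpha i * alpha j =
            c%:A + \sum_(k < n.-1) Omega_coef phi k i j *: alpha k,
        iso_to_global_functions iota X A &
        forall a : A, a \in <<codom alpha>>%VS <-> alg_trace a = 0].
Proof.
case: n n_ge3 X X_distinct X_over_K X_general phi phi_res => [|[|m]] //.
rewrite !ltnS => m_gt0 X X_distinct _ X_general phi phi_res.
have [P [P_scaled P_sum P_base P_span]] := general_position_scaling X_general.
have [c nzc OmP] := Omega_coef_points charK m_gt0 phi_res P_scaled P_sum P_base P_span.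
have [Al [P_Al Al_P Al_sum]] := exists_sum_zero_basis iota charK P_sum P_base P_span c.
have nat_neq0 k : (0 < k)%N -> (k%:R : Kbar) != 0.
  by rewrite -(rmorph_nat iota) fmorph_eq0 ((pcharf0P _).1 charK) lt0n.
have nznc : (m.+2%:R * c : Kbar) != 0 by rewrite mulf_neq0 ?nat_neq0.
(* With this scale Q is exactly dual to [Al], and its coordinate functions belong to the algebra
   over K. *)
pose Q p := (m.+2%:R * c)^-1 *: P p.
(* By [trace_formE] this element of K maps to the mean over the points of the product of the rows i
   and j of [Al]. *)
pose kap i j := trace_form (Omega_coef phi) i j / m%:R.
have Al_mul i j p : Al i p * Al j p =
    iota (kap i j) + \sum_l iota (Omega_coef phi l i j) * Al l p.
  rewrite (sum_zero_basis_mul charK nzc OmP P_Al Al_P Al_sum); congr (_ + _).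
  rewrite fmorph_div rmorph_nat (trace_formE charK nzc OmP P_Al Al_P Al_sum).
  by rewrite [RHS]mulrC mulKf ?nat_neq0.
have Q_Al p q : \sum_k Q p 0 k * Al k q = (p == q)%:R - m.+2%:R^-1.
  have := congr1 (fun M : 'M_ _ => (m.+2%:R * c)^-1 * M p q) P_Al.
  rewrite /= !mxE mulKf // => <-; rewrite mulr_sumr.
  by apply: eq_bigr => k _; rewrite !mxE mulrA.
have Al_Q i k : \sum_q Al i q * Q q 0 k = (i == k)%:R.
  have := congr1 (fun M : 'M_ _ => (m.+2%:R * c)^-1 * M i k) Al_P.
  rewrite /= !mxE -[X in _ = _ * X]mulr_natr mulKf // => <-; rewrite mulr_sumr.
  by apply: eq_bigr => q _; rewrite !mxE mulrCA.
exists (points_algebra Al_mul Q_Al), (points_basis Al_mul Q_Al); split.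
- exact: points_algebraC.
- by split; [exact: dim_points_algebra | exact: points_basis_of].
- by move=> i j; exists (kap i j); exact: points_basis_mul.
- have X_scaled p : exists2 t, t != 0 & X p = t *: Q p.
    have [t nzt PX] := P_scaled p; exists (t^-1 * (m.+2%:R * c)).
      by rewrite mulf_neq0 ?invr_neq0.
    by rewrite scalerA mulfK // PX scalerA mulVf // scale1r.
  have Q_in := coordinates_in_algebra Al_mul Al_sum Q_Al Al_Q.
  exists (@values _ _ _ _ _ _ _ _ Al_mul Q_Al); split.
  + by split; [exact: values_1 | exact: values_D | exact: values_M | exact: values_Z].
  + exact: values_inj.
  + apply: (algebra_regular (@values_M _ _ _ _ _ _ _ _ Al_mul Q_Al) X_scaled _ Q_in).
      by case: X_distinct.
    by move=> a; exact: quadrics_in_algebra.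
  + move=> s; apply: (regular_in_algebra charK _ _ _ _ _ X_scaled Q_in).
    * exact: values_1.
    * exact: values_D.
    * exact: values_M.
    * exact: values_Z.
    * exact: values_inj.
- exact: span_points_basis.
Qed.
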